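(* There exists $n_0\in\mathbb{N}$ such that for every integer $n\ge n_0$, every $\Delta\in\mathbb{N}$ and all reals $p,\beta>0$ with \[ \beta\le \frac{pn}{4\Delta^{5\sqrt{\log n}}}, \] every $n$-vertex $(p,\beta)$-bijumbled graph with minimum degree at least $4\sqrt{\beta p n}$ is $\mathcal{T}(n,\Delta)$-universal.
   Context: All graphs are finite and simple. A graph $G=(V,E)$ is $(p,\beta)$-bijumbled if for all vertex sets $X,Y\subseteq V$ we have $\bigl|e_G(X,Y)-p|X||Y|\bigr|\le \beta\sqrt{|X||Y|}$, where $e_G(X,Y)$ is the number of pairs $(x,y)\in X\times Y$ with $xy\in E$ (so edges inside $X\cap Y$ are counted twice). $\mathcal{T}(n,\Delta)$ is the family of all $n$-vertex trees with maximum degree at most $\Delta$. A graph $G$ is $\mathcal{T}(n,\Delta)$-universal if it contains every $T\in\mathcal{T}(n,\Delta)$ as a (not necessarily induced) subgraph. $\log$ denotes the natural logarithm. *)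

(* Defs.v *)
(* Written in Mathematical Components with MathComp-Analysis. *)
From HB Require Import structures.
From mathcomp Require Import all_boot all_order all_algebra.
From mathcomp Require Import reals exp.

Set Implicit Arguments.
Unset Strict Implicit.
Unset Printing Implicit Defensive.

Import Order.TTheory GRing.Theory Num.Theory.

Record sgraph := SGraph {
  vertex :> finType;
  adj : rel vertex;
  adj_sym : symmetric adj;
  adj_irrefl : irreflexive adj
}.

Definition degree (G : sgraph) (x : G) : nat := #|[set y | adj x y]|.

Definition max_degree (G : sgraph) : nat := \max_(x : G) degree x.

(* Every degree is at most #|G|, so the initial value #|G| is irrelevant as
   soon as G has a vertex. *)
Definition min_degree (G : sgraph) : nat := \big[minn/#|G|]_(x : G) degree x.

(* Ordered pairs: an edge inside X :&: Y is counted twice. *)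
Definition edges_between (G : sgraph) (X Y : {set G}) : nat :=
  #|[set xy in setX X Y | adj xy.1 xy.2]|.

Definition connected (G : sgraph) : Prop :=
  0 < #|G| /\ forall x y : G, connect (@adj G) x y.

(* A closed walk of length 2 along one edge is also a [ucycle], hence the
   bound on the size. *)
Definition acyclic (G : sgraph) : Prop :=
  forall c : seq G, ucycle (@adj G) c -> size c <= 2.

Definition is_tree (G : sgraph) : Prop := connected G /\ acyclic G.

Definition subgraph (H G : sgraph) : Prop :=
  exists2 f : H -> G, injective f & forall x y : H, adj x y -> adj (f x) (f y).

Definition tree_family (n Delta : nat) (T : sgraph) : Prop :=
  [/\ is_tree T, #|T| = n & max_degree T <= Delta].

Definition tree_universal (n Delta : nat) (G : sgraph) : Prop :=
  forall T : sgraph, tree_family n Delta T -> subgraph T G.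

Local Open Scope ring_scope.

Definition bijumbled (R : realType) (p beta : R) (G : sgraph) : Prop :=
  forall X Y : {set G},
    `|(edges_between X Y)%:R - p * #|X|%:R * #|Y|%:R|
      <= beta * Num.sqrt (#|X|%:R * #|Y|%:R).

(* Main.v *)
Require Import Defs.
From mathcomp Require Import all_boot all_order all_algebra.
From mathcomp Require Import reals sequences exp.
From mathcomp Require Import zify ring lra.

(** The bijumbledness and the minimum degree give an expander: any two sets of
    more than [M = n / (4 Delta^(20w))] vertices are joined by an edge, and sets
    of at most [M] vertices expand by a factor [4 Delta^(10w)], where [w] is about
    [sqrt (log n) / 4].  In such a graph a partial embedding can be kept
    extendable in the sense of Friedman and Pippenger; since unused branches may
    be rolled back, any two embedded vertices can be connected by a new path of a
    fixed length [ell] of order [sqrt (log n)], until only few vertices remain.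

    A random colouring yields small reservoirs [Q] into which all sets of at most
    [M] vertices expand.  If the tree has many leaves, parents of leaves whose
    chains of [ell] ancestors are disjoint are placed onto all of [Q]; once the
    tree without its leaves is embedded, Hall's condition holds between the parents
    (by extendability) and the remaining vertices (which expand into [Q]).

    If the tree has few leaves, it has [2^j] disjoint bare paths of a common
    polylogarithmic length.  The image of the [i]-th one enters a vertex [u i],
    visits one remaining vertex, enters a vertex [z 0 i'] and runs through an
    embedded Benes permutation network.  As above, the remaining vertices are
    perfectly matched to the [u i] and to the [z 0 i']; the network then sends each
    path to its own end.  A switch consists of two ladders: a path traversing all
    the rungs of a ladder may end on either rail, and it covers the same vertices
    in both cases. *)

Set Implicit Arguments.
Unset Strict Implicit.
Unset Printing Implicit Defensive.

(** * Extendable families and Hall's theorem *)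

(** The exponents come from one balance. A connection needs two trees of branching [d] with more
    than [M] leaves each, so [ell] is about [2 log n / log d]. Choosing leaf parents with disjoint
    ancestor chains of that length may lose a factor [Delta^ell], which must be beaten by [D], the
    factor by which a reservoir is smaller than the graph; and [d <= D], since the demand must allow
    the branching. With [d = Delta^(8w)] and [n <= 2^(32(w+1)^2)] one gets [ell <= 8w + 15], and
    [D = Delta^(9w)] suffices. A further factor [Delta^w] pays for the random colouring, so sets
    must expand by [4A] with [A = Delta^(10w)]; the degree condition yields this for sets of at most
    [n / (4A^2)] vertices, whence the exponent [20w <= 5 sqrt(log n)]. Extension alone cannot finish
    the embedding, as it has to keep more than [2mD] vertices free. The last vertices are therefore
    placed by exact matchings, for which the reservoirs are prepared in advance. *)

Section Extendability.

Variables (A B : finType) (N : A -> {set B}) (r : A -> nat) (M : nat).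

Definition nbs (U : {set A}) : {set B} := \bigcup_(x in U) N x.

Definition dom (pi : B -> option A) : {set B} := [set y | pi y].

Definition kids (pi : B -> option A) (U : {set A}) : {set B} :=
  [set y | if pi y is Some x then x \in U else false].

Definition upd (pi : B -> option A) (y : B) (x : A) : B -> option A :=
  fun z => if z == y then Some x else pi z.

(* [pi y = Some x] means that [y] has been attached to [x].  The vertices already
   attached to [U] count towards the demand of [U], which makes [good] stable
   under detaching vertices. *)
Definition good (pi : B -> option A) : Prop :=
  forall U : {set A}, #|U| <= M ->
    \sum_(x in U) r x <= #|nbs U :\: dom pi| + #|kids pi U|.

Definition tight (pi : B -> option A) (U : {set A}) : bool :=
  (#|U| <= M) && (\sum_(x in U) r x == #|nbs U :\: dom pi| + #|kids pi U|).

Lemma nbsU (U V : {set A}) : nbs (U :|: V) = nbs U :|: nbs V.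
Proof. exact: bigcup_setU. Qed.

Lemma nbsS (U V : {set A}) : U \subset V -> nbs U \subset nbs V.
Proof.
by move=> sUV; apply/bigcupsP=> x xU; apply: bigcup_sup; apply: (subsetP sUV).
Qed.

Lemma nbs1 (x : A) : nbs [set x] = N x.
Proof. by rewrite /nbs big_set1. Qed.

Lemma mem_nbs (U : {set A}) (x : A) (y : B) : x \in U -> y \in N x -> y \in nbs U.
Proof. by move=> xU yx; apply/bigcupP; exists x. Qed.

Lemma kidsU pi (U V : {set A}) : kids pi (U :|: V) = kids pi U :|: kids pi V.
Proof. by apply/setP=> y; rewrite !inE; case: (pi y) => [x|] //; rewrite inE. Qed.

Lemma kidsI pi (U V : {set A}) : kids pi (U :&: V) = kids pi U :&: kids pi V.
Proof. by apply/setP=> y; rewrite !inE; case: (pi y) => [x|] //; rewrite inE. Qed.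

Lemma card_kids_le pi (U : {set A}) b :
  (forall x, x \in U -> #|kids pi [set x]| <= b) -> #|kids pi U| <= b * #|U|.
Proof.
move=> kb; have -> : kids pi U = \bigcup_(x in U) kids pi [set x].
  apply/setP=> y; rewrite inE; case E: (pi y) => [x|].
    apply/idP/bigcupP => [xU|[z zU]]; last by rewrite !inE E inE => /eqP ->.
    by exists x; rewrite // !inE E inE.
  by apply/esym/bigcupP => -[z _]; rewrite inE E.
rewrite mulnC -sum_nat_const; apply: leq_trans (_ : _ <= \sum_(x in U) #|kids pi [set x]|) _.
  elim/big_rec2: _ => [|x m W _ le]; first by rewrite cards0.
  by apply: leq_trans (leq_card_setU _ _) _; rewrite leq_add2l.
by apply: leq_sum.
Qed.

Lemma sum_setUI (f : A -> nat) (U V : {set A}) :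
  \sum_(x in U :|: V) f x + \sum_(x in U :&: V) f x =
  \sum_(x in U) f x + \sum_(x in V) f x.
Proof.
rewrite (big_setID V) /= [in RHS](big_setID V) /=.
have -> : (U :|: V) :&: V = V by apply/setP=> x; rewrite !inE; case: (x \in V); rewrite ?orbT ?andbF.
have -> : (U :|: V) :\: V = U :\: V by rewrite setDUl setDv setU0.
lia.
Qed.

(** The demand and [kids] are modular in the set, the free neighbourhood is submodular. So the
    surpluses of union and intersection add up to at most zero, and neither is negative by
    [good]. *)
Lemma tightU pi (U V : {set A}) :
  good pi -> #|U :|: V| <= M -> tight pi U -> tight pi V -> tight pi (U :|: V).
Proof.
move=> gp leM /andP[Um /eqP eU] /andP[Vm /eqP eV].
have leI : #|U :&: V| <= M by apply: leq_trans Um; rewrite subset_leq_card ?subsetIl.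
rewrite /tight leM /= eqn_leq gp //=.
have gI := gp _ leI; have := sum_setUI r U V.
have kUI : #|kids pi (U :|: V)| + #|kids pi (U :&: V)| = #|kids pi U| + #|kids pi V|.
  by rewrite kidsU kidsI cardsUI.
have nUI : #|nbs (U :|: V) :\: dom pi| + #|nbs (U :&: V) :\: dom pi| <=
    #|nbs U :\: dom pi| + #|nbs V :\: dom pi|.
  rewrite nbsU setDUl -[X in _ <= X]cardsUI leq_add2l subset_leq_card //.
  apply/subsetP => y; rewrite !inE => /andP[-> /bigcupP[x]].
  by rewrite inE => /andP[xU xV] yx; rewrite !(mem_nbs _ yx).
lia.
Qed.

(* A vertex [y] of [N s] outside the neighbourhood of every tight set avoiding
   [s] can be used; it exists because the union of these tight sets is tight. *)
Lemma extend_one (pi : B -> option A) (s : A) :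
  good pi ->
  (forall U, tight pi U -> 2 * #|U| < M) ->
  #|kids pi [set s]| < r s ->
  exists y, [/\ y \in N s, pi y = None & good (upd pi y s)].
Proof.
move=> gp small cs.
pose Us := \bigcup_(U : {set A} | tight pi U && (s \notin U)) U.
have [tUs sUs] : tight pi Us /\ s \notin Us.
  apply: (big_ind (fun W => tight pi W /\ s \notin W)).
  - by rewrite /tight cards0 inE big_set0 /nbs big_set0 set0D cards0 /=;
      rewrite (_ : kids _ _ = set0) ?cards0 //; apply/setP => y;
      rewrite !inE; case: (pi y) => // x; rewrite inE.
  - move=> U V [tU sU] [tV sV]; rewrite inE negb_or sU sV; split=> //.
    apply: tightU => //; have := small _ tU; have := small _ tV.
    by have [+ _] := leq_card_setU U V; lia.
  - by move=> U /andP.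
have [/existsP[y /and3P[ys /eqP yd yU]]|none] :=
    boolP [exists y, [&& y \in N s, pi y == None & y \notin nbs Us]].
  exists y; split=> // U Um.
  have dE : dom (upd pi y s) = y |: dom pi.
    by apply/setP=> z; rewrite !inE /upd; case: eqP.
  have [sU|sU] := boolP (s \in U).
    have kE : #|kids (upd pi y s) U| = #|kids pi U|.+1.
      have -> : kids (upd pi y s) U = y |: kids pi U.
        by apply/setP=> z; rewrite !inE /upd; case: eqP => //= _; rewrite sU.
      by rewrite cardsU1 inE yd.
    have := gp U Um; rewrite kE dE setUC -setDDl.
    by have := cardsD1 y (nbs U :\: dom pi); lia.
  have kE : kids (upd pi y s) U = kids pi U.
    apply/setP=> z; rewrite !inE /upd; case: eqP => //= ->.
    by rewrite yd (negbTE sU).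
  rewrite kE dE.
  have [yN|yN] := boolP (y \in nbs U); last first.
    rewrite (_ : nbs U :\: _ = nbs U :\: dom pi) ?gp //.
    apply/setP=> z; rewrite !inE; case: eqP => //= ->.
    by rewrite (negbTE yN) !andbF.
  have ntU : ~~ tight pi U.
    apply: contra yU => tU; apply: (subsetP (nbsS _)) yN.
    by apply: bigcup_sup; rewrite tU.
  have := gp U Um; move: ntU; rewrite /tight Um /= => ne le.
  rewrite setUC -setDDl; have := cardsD1 y (nbs U :\: dom pi); lia.
(* Without such a [y], adding [s] to [Us] gains no free neighbour, so the demand [r s] would have to
   be met by the children of [s] alone. *)
have leM : #|s |: Us| <= M.
  by have := small _ tUs; rewrite cardsU1 sUs /=; lia.
have := gp _ leM; rewrite nbsU nbs1 kidsU big_setU1 //=.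
have -> : (N s :|: nbs Us) :\: dom pi = nbs Us :\: dom pi.
  rewrite setDUl; apply/setUidPr/subsetP=> y; rewrite !inE => /andP[yd ys].
  rewrite yd /=; apply: contraNT none => yU; apply/existsP; exists y.
  by rewrite ys yU; case: (pi y) yd.
case/andP: tUs => _ /eqP ->.
have [+ _] := leq_card_setU (kids pi [set s]) (kids pi Us); lia.
Qed.

(** Rolling back is harmless: a detached vertex lies in [N x] for its former parent [x], so for
    every set containing [x] it turns from a child into a free neighbour. *)
Lemma good_restrict (pi pi' : B -> option A) :
  (forall y x, pi' y = Some x -> y \in N x) ->
  (forall y, pi y = pi' y \/ pi y = None) -> good pi' -> good pi.
Proof.
move=> piN sub gp U Um; apply: leq_trans (gp U Um) _.
have sk : kids pi U \subset kids pi' U.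
  by apply/subsetP => y; rewrite !inE; case: (sub y) => ->.
rewrite -(cardsID (kids pi U) (kids pi' U)) (setIidPr sk).
rewrite [X in _ <= X]addnC [X in X <= _]addnC -addnA leq_add2l -cardsUI.
rewrite (_ : _ :&: _ = set0) ?cards0 ?addn0; last first.
  apply/setP=> y; rewrite !inE; by case: (pi' y) => [x|] /=; rewrite ?andbF.
apply: subset_leq_card; apply/subsetP=> y; rewrite !inE.
case E: (pi' y) => [x|] /=; rewrite ?andbF ?orbF /=; last first.
  by case: (sub y) => ->; rewrite ?E //= orbF.
case: (sub y) => ->; rewrite ?E /= ?orbF ?andbF //=; first by case: (x \in U).
by move=> xU; rewrite (mem_nbs xU) ?piN.
Qed.

End Extendability.

(** Constant demand 1 on sets of every size is Hall's condition, and [extend_one] serves one more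
    element at a time. *)
Lemma hall (A B : finType) (N : A -> {set B}) :
  (forall U : {set A}, #|U| <= #|nbs N U|) ->
  exists2 f : A -> B, injective f & forall a, f a \in N a.
Proof.
move=> hc.
(* With this bound the smallness condition on tight sets in [extend_one] holds for all sets. *)
pose M := (2 * #|A|).+1.
pose ok (pi : B -> option A) :=
  good N (fun=> 1) M pi /\ forall y x, pi y = Some x -> y \in N x.
suff main k : k <= #|A| -> exists2 pi, ok pi &
    k <= #|[set a | kids pi [set a] != set0]|.
  have [pi [_ piN]] := main _ (leqnn _).
  rewrite -cardsT => full; have full' : [set: A] = [set a | kids pi [set a] != set0].
    by apply/esym/eqP; rewrite eqEcard subsetT.
  have ex a : exists y, pi y == Some a.
    have : a \in [set: A] by rewrite inE.
    rewrite full' inE => /set0Pn[y]; rewrite inE.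
    by case E: (pi y) => [x|] //; rewrite inE => /eqP <-; exists y; rewrite E.
  exists (fun a => xchoose (ex a)) => [a b /(congr1 pi)|a].
    by rewrite (eqP (xchooseP (ex a))) (eqP (xchooseP (ex b))) => -[].
  exact/piN/eqP/(xchooseP (ex a)).
elim: k => [_|k IH kA].
  exists (fun=> None) => //; split=> // U _; rewrite sum1_card.
  by apply: leq_trans (hc U) _; apply: leq_trans (leq_addr _ _); rewrite subset_leq_card //;
    apply/subsetP=> y yU; rewrite !inE.
have [pi [gp piN] kk] := IH (ltnW kA).
have [lt|le] := ltnP k #|[set a | kids pi [set a] != set0]|; first by exists pi.
have /set0Pn[s] : ~: [set a | kids pi [set a] != set0] != set0.
  rewrite -card_gt0; have := cardsC [set a | kids pi [set a] != set0]; lia.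
rewrite !inE negbK => /eqP s0.
have [U _||y [ys yd gp']] := extend_one (s := s) gp.
- by rewrite /M ltnS leq_mul2l max_card.
- by rewrite s0 cards0.
exists (upd pi y s); first split=> // z x.
  by rewrite /upd; case: eqP => [-> [<-] //|_ /piN].
apply: leq_ltn_trans kk _; apply: proper_card; apply/properP; split.
  apply/subsetP => a; rewrite !inE => /set0Pn[z]; rewrite inE => zk.
  apply/set0Pn; exists z; rewrite inE /upd; case: eqP => // zy.
  by rewrite zy yd in zk.
exists s; rewrite !inE ?s0 ?eqxx //; apply/set0Pn; exists y.
by rewrite inE /upd eqxx inE.
Qed.

(** * Connecting vertices by paths of a prescribed length *)

Definition joined (V : finType) (e : rel V) (k : nat) : Prop :=
  forall X Y : {set V}, k <= #|X| -> k <= #|Y| -> exists x y, [/\ x \in X, y \in Y & e x y].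

Definition nbh (V : finType) (e : rel V) (U : {set V}) : {set V} :=
  nbs (fun x => [set y | e x y]) U.

Lemma mem_nbh (V : finType) (e : rel V) (U : {set V}) x y : x \in U -> e x y -> y \in nbh e U.
Proof. by move=> xU xy; apply: mem_nbs xU _; rewrite inE. Qed.

Lemma joined_nbh (V : finType) (e : rel V) (k : nat) (U : {set V}) :
  joined e k -> k <= #|U| -> #|~: nbh e U| < k.
Proof.
move=> jk kU; rewrite ltnNge; apply/negP => kC.
have [x [y [xU yC xy]]] := jk _ _ kU kC.
by move: yC; rewrite inE (mem_nbh xU xy).
Qed.

Section Connecting.

Variables (V : finType) (e : rel V).
Hypothesis e_sym : symmetric e.
Variables (S0 : {set V}) (D m : nat).
Hypotheses (m_gt0 : 0 < m) (e_joined : joined e m).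

(* [S0] holds the vertices fixed in advance, [used pi] all vertices embedded. *)
Definition outer (x : V) : {set V} := [set y | e x y & y \notin S0].

Definition used (pi : V -> option V) : {set V} := S0 :|: dom pi.

Definition nkids (pi : V -> option V) (x : V) : nat := #|kids pi [set x]|.

Definition ext (pi : V -> option V) : Prop :=
  good outer (fun=> D) (2 * m) pi /\
  forall y x, pi y = Some x -> [/\ e x y, y \notin S0 & x \in used pi].

(** With [s] vertices used, a set of at least [m] vertices is adjacent to all but fewer than [m]
    vertices, hence has more than [2 * m * D] free neighbours. It then cannot be tight, which is
    what [extend_one] asks for. *)
Definition room (s : nat) : Prop := s + m + 2 * m * D < #|V|.

Lemma nbs_outer (U : {set V}) : nbs outer U = nbh e U :\: S0.
Proof.
apply/setP=> y; rewrite !inE; apply/bigcupP/andP => [[x xU]|[yS /bigcupP[x xU]]].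
  by rewrite inE => /andP[xy ->]; rewrite (mem_nbh xU xy).
by rewrite inE => xy; exists x; rewrite // inE xy.
Qed.

Lemma nbs_outer_dom (U : {set V}) pi : nbs outer U :\: dom pi = nbh e U :\: used pi.
Proof. by rewrite nbs_outer setDDl. Qed.

Lemma extP pi (U : {set V}) :
  ext pi -> #|U| <= 2 * m -> D * #|U| <= #|nbh e U :\: used pi| + #|kids pi U|.
Proof.
case=> gp _ Um; have := gp U Um.
by rewrite sum_nat_const nbs_outer_dom mulnC.
Qed.

Lemma used_upd pi y x : used (upd pi y x) = y |: used pi.
Proof. by apply/setP=> z; rewrite !inE /upd; case: eqP => //= _; rewrite orbT. Qed.

Lemma nkids_upd pi y x z : pi y = None ->
  nkids (upd pi y x) z = nkids pi z + (x == z).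
Proof.
move=> yN; rewrite /nkids.
have [<-|xz] := eqVneq x z.
  rewrite (_ : kids _ _ = y |: kids pi [set x]); last first.
    by apply/setP=> u; rewrite !inE /upd; case: (eqVneq u y) => [->|] //=; rewrite inE eqxx.
  by rewrite cardsU1 inE yN /= addnC.
rewrite addn0; congr #|pred_of_set _|; apply/setP=> u; rewrite !inE /upd.
by case: (eqVneq u y) => [->|] //=; rewrite yN inE (negbTE xz).
Qed.

Lemma nkids_unused pi x : ext pi -> x \notin used pi -> nkids pi x = 0.
Proof.
case=> _ cl xu; apply/eqP; rewrite cards_eq0; apply/eqP/setP=> y; rewrite !inE.
case E: (pi y) => [z|] //; rewrite inE; apply: contraNF xu => /eqP <-.
by case: (cl _ _ E).
Qed.

Lemma extend pi x :
  ext pi -> x \in used pi -> nkids pi x < D -> room #|used pi| ->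
  exists y, [/\ y \notin used pi, pi y = None, e x y & ext (upd pi y x)].
Proof.
move=> xp xu xD rm; have [gp cl] := xp.
have [U /andP[Um /eqP tU]||y [+ yN gp']] := extend_one (s := x) gp => //.
- rewrite ltn_pmul2l // ltnNge; apply/negP => mU.
  have := joined_nbh e_joined mU.
  move: tU; rewrite sum_nat_const nbs_outer_dom.
  have := cardsCs (nbh e U :\: used pi); rewrite setCD => ->.
  have [+ _] := leq_card_setU (~: nbh e U) (used pi).
  have : #|U| * D <= 2 * m * D by rewrite leq_mul2r Um orbT.
  move: rm; rewrite /room; have := cardsC (~: nbh e U :|: used pi); lia.
rewrite inE => /andP[xy yS].
have yu : y \notin used pi by rewrite !inE yN (negbTE yS).
exists y; split=> //; split=> // z w; rewrite used_upd /upd.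
case: eqP => [-> [<-]|_ /cl[ewz zS wu]]; split=> //.
  by rewrite inE xu orbT.
by rewrite inE wu orbT.
Qed.

(** A vertex may be repeated in [xs] and then receives several children, so that a whole level of a
    tree is attached at once. *)
Lemma extend_seq (xs : seq V) pi :
  ext pi -> {subset xs <= used pi} ->
  {in xs, forall x, nkids pi x + count_mem x xs <= D} ->
  room (#|used pi| + size xs) ->
  exists pi' ys, [/\ [/\ ext pi', map pi' ys = map Some xs, uniq ys &
      {in ys, forall y, y \notin used pi}],
    (forall y, y \notin ys -> pi' y = pi y),
    used pi' = used pi :|: [set y in ys],
    #|used pi'| = #|used pi| + size xs &
    forall x, nkids pi' x = nkids pi x + count_mem x xs].
Proof.
elim: xs pi => [|x xs IH] pi xp xsu xsD rm.
  exists pi, [::]; split; rewrite ?addn0 //; last by move=> x; rewrite addn0.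
  by apply/setP=> z; rewrite !inE orbF.
have xu : x \in used pi by apply: xsu; rewrite mem_head.
have [||y [yu yN xy xp1]] := extend xp xu.
- by have := xsD x (mem_head _ _); rewrite /= eqxx; lia.
- by move: rm; rewrite /room /=; lia.
have uE := used_upd pi y x.
have cE : #|used (upd pi y x)| = #|used pi|.+1 by rewrite uE cardsU1 yu.
have [z zxs|z zxs||pi' [ys [[xp' mE uq ysu] oE usE csE kE]]] := IH _ xp1.
- by rewrite uE inE xsu ?orbT // inE zxs orbT.
- rewrite nkids_upd //; have := xsD z; rewrite inE zxs orbT /= => /(_ isT); lia.
- by move: rm; rewrite /room cE /= addSnnS.
have yys : y \notin ys by apply/negP => /ysu; rewrite uE setU11.
exists pi', (y :: ys); split.
- split=> //; first by rewrite /= mE oE // /upd eqxx.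
    by rewrite /= yys.
  move=> z; rewrite inE => /predU1P[-> //|/ysu]; apply: contra.
  by move=> zu; rewrite uE in_setU zu orbT.
- move=> z; rewrite inE negb_or => /andP[zy zys]; rewrite oE //.
  by rewrite /upd (negbTE zy).
- by rewrite usE uE; apply/setP=> z; rewrite !inE; do !case: (_ \in _) => //; case: (_ == _); rewrite ?orbT ?orbF //.
- by rewrite csE cE /= addSnnS.
- by move=> z; rewrite kE nkids_upd // /= addnA.
Qed.

Variable d : nat.
Hypotheses (d_gt0 : 0 < d) (dD : d <= D).

Definition parent_rel (pi : V -> option V) : rel V := fun x y => pi y == Some x.

Lemma parent_path_dom pi a p : path (parent_rel pi) a p -> {subset p <= dom pi}.
Proof.
elim: p a => //= z p IH a /andP[/eqP zE /IH sub] y.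
by rewrite inE => /predU1P[->|/sub //]; rewrite inE zE.
Qed.

(** The vertex [a] gets a single child, and the [d]-fold branching starts only below it. A
    connection thus uses just one unit of the demand of its end, and one vertex can be the end of
    several paths. *)
Lemma grow t a pi :
  ext pi -> a \in used pi -> nkids pi a < D ->
  room (#|used pi| + \sum_(i < t.+1) d ^ i) ->
  exists pi' L, [/\ [/\ ext pi', uniq L & size L = d ^ t],
    {in used pi, pi' =1 pi},
    #|used pi'| = #|used pi| + \sum_(i < t.+1) d ^ i,
    {in used pi, forall x, nkids pi' x = nkids pi x + (a == x)} &
    {in L, forall y, [/\ y \in used pi', nkids pi' y = 0 &
      exists p, [/\ size p = t.+1, last a p = y, path (parent_rel pi') a p, uniq p &
                    {in p, forall z, z \notin used pi}]]}].
Proof.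
move=> xp au aD; elim: t => [|t IH] rm.
  have [||| pi' [ys [[xp' mE uq ysu] oE usE csE kE]]] := extend_seq (xs := [:: a]) xp.
  - by move=> x; rewrite inE => /eqP ->.
  - by move=> x; rewrite inE => /eqP ->; rewrite /= eqxx; lia.
  - by move: rm; rewrite big_ord1.
  case: ys => [|y [|]] // in mE uq ysu oE usE *; case: mE => mE.
  have ysu' : y \notin used pi by apply: ysu; rewrite mem_head.
  exists pi', [:: y]; split=> //.
  - move=> x xu; apply: oE; rewrite inE; apply: contraTneq xu => ->.
    exact: ysu'.
  - by rewrite big_ord1 csE.
  - by move=> x xu; rewrite kE /= addn0.
  move=> z; rewrite inE => /eqP ->; split.
  - by rewrite usE !inE eqxx orbT.
  - rewrite kE nkids_unused //= addn0; case: eqP => // ay.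
    by rewrite ay (negbTE ysu') in au.
  by exists [:: y]; split=> //=; rewrite ?/parent_rel ?mE ?eqxx // => x;
    rewrite inE => /eqP ->.
have [|pi1 [L [[xp1 uL sL] oE1 cE1 kE1 LP]]] := IH.
  by move: rm; rewrite /room [in X in X -> _]big_ord_recr /=; lia.
pose xs := flatten [seq nseq d x | x <- L].
have sxs : size xs = d ^ t.+1.
  rewrite /xs size_flatten /shape -map_comp.
  rewrite (eq_map (g := fun=> d)); last by move=> x /=; rewrite size_nseq.
  by rewrite sumnE big_map big_const_seq count_predT iter_addn_0 sL expnS.
have cxs x : count_mem x xs = d * (x \in L).
  rewrite /xs count_flatten -map_comp.
  rewrite (eq_map (g := fun z => d * (z == x))); last first.
    by move=> z /=; rewrite count_nseq /= mulnC.
  rewrite -(count_uniq_mem _ uL) -sum1_count sumnE big_map big_distrr /=.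
  by rewrite [RHS]big_mkcond; apply: eq_bigr => i _ /=; case: (i == x); rewrite ?muln0.
have xsL x : x \in xs -> x \in L.
  by case/flatten_mapP=> z zL; rewrite mem_nseq => /andP[_ /eqP ->].
have [x /xsL/LP[]//|x xL||pi' [ys [[xp' mE uq ysu] oE usE csE kE]]] := extend_seq (xs := xs) xp1.
- by have [_ -> _] := LP _ (xsL _ xL); rewrite cxs (xsL _ xL) muln1.
- by move: rm; rewrite cE1 sxs [in X in X -> _]big_ord_recr /= addnA.
have sub1 x : x \in used pi -> x \in used pi1.
  move=> xu; rewrite !inE oE1 //; move: xu; rewrite !inE.
  by [].
have oE' x : x \in used pi1 -> pi' x = pi1 x.
  by move=> xu; apply: oE; apply: contraTN xu => /ysu.
have kkL x : x \in used pi -> count_mem x xs = 0.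
  move=> xu; rewrite cxs; case: (boolP (x \in L)) => [xL|]; rewrite ?muln0 //.
  have [_ _ [p [sp lp _ _ pu]]] := LP _ xL.
  case: (lastP p) sp lp pu => // p' z _; rewrite last_rcons => -> /(_ x).
  by rewrite mem_rcons mem_head xu => /(_ isT).
exists pi', ys; split.
- by split=> //; rewrite -sxs -(size_map Some xs) -mE size_map.
- by move=> x xu; rewrite oE' ?sub1 // oE1.
- by rewrite csE cE1 sxs [in RHS]big_ord_recr addnA.
- by move=> x xu; rewrite kE kE1 // kkL // addn0.
move=> y yys; split.
- by rewrite usE inE [y \in [set _ in _]]inE yys orbT.
- have yu := ysu _ yys; rewrite kE nkids_unused // add0n cxs.
  case: (boolP (y \in L)) => [/LP[yu1]|]; last by rewrite muln0.
  by rewrite yu1 in yu.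
have /mapP[x xxs yx] : pi' y \in map Some xs by rewrite -mE map_f.
have [xu1 _ [p [sp lp pp up pu]]] := LP _ (xsL _ xxs).
have pu1 z : z \in p -> z \in used pi1.
  by move/(parent_path_dom pp); rewrite [z \in used _]inE => ->; rewrite orbT.
exists (rcons p y); split.
- by rewrite size_rcons sp.
- by rewrite last_rcons.
- rewrite rcons_path lp /parent_rel yx eqxx andbT.
  apply: (sub_in_path (P := mem (used pi1))) pp => [u v uu vu|].
    by rewrite /parent_rel oE'.
  by apply/allP => z; rewrite inE => /predU1P[->|/pu1 //]; apply: sub1.
- by rewrite rcons_uniq up andbT; apply: contra (ysu _ yys) => /pu1.
move=> z; rewrite mem_rcons inE => /predU1P[->|/pu //].
by apply: contra (ysu _ yys) => /sub1.
Qed.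

(* The two trees of [m] leaves grown from [a] and [b] are joined by an edge;
   everything else is then discarded, which keeps the state extendable. *)
Lemma connect_pair t a b pi : m <= d ^ t ->
  ext pi -> a \in used pi -> b \in used pi -> a != b ->
  nkids pi a < D -> nkids pi b < D ->
  room (#|used pi| + 2 * \sum_(i < t.+1) d ^ i) ->
  exists pi' p, [/\ ext pi', [/\ size p = t.+1.*2, uniq p, path e a (rcons p b) &
      {in p, forall y, y \notin used pi}],
    used pi' = used pi :|: [set y in p],
    {in used pi, forall x, nkids pi' x <= nkids pi x + (a == x) + (b == x)} &
    {in p, forall x, nkids pi' x <= t.+1.*2}].
Proof.
move=> mt xp au bu ab aD bD rm.
have [|pi1 [La [[xp1 uLa sLa] oE1 cE1 kE1 LaP]]] := grow (t := t) xp au aD.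
  by move: rm; rewrite /room; lia.
have dsub : dom pi \subset dom pi1.
  by apply/subsetP => y; rewrite !inE => yd; rewrite oE1 // !inE yd orbT.
have usub : used pi \subset used pi1 by rewrite setUS.
have bu1 : b \in used pi1 by apply: (subsetP usub).
have [||pi2 [Lb [[xp2 uLb sLb] oE2 cE2 kE2 LbP]]] := grow (t := t) xp1 bu1.
- by rewrite kE1 // (negbTE ab) addn0.
- by move: rm; rewrite cE1 /room; lia.
have cL (L : seq V) : uniq L -> size L = d ^ t -> m <= #|[set y in L]|.
  by move=> uL sL; rewrite cardsE (card_uniqP uL) sL.
have [y [z []]] := e_joined (cL _ uLa sLa) (cL _ uLb sLb).
rewrite !inE => yL zL yz.
have [_ _ [p [sp lp pp up pu]]] := LaP _ yL.
have [_ _ [q [sq lq pq uq qu]]] := LbP _ zL.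
have p1 : {subset p <= dom pi1} := parent_path_dom pp.
have q2 : {subset q <= dom pi2} := parent_path_dom pq.
have p12 x : x \in p -> pi2 x = pi1 x.
  by move=> /p1 xd; rewrite oE2 // inE xd orbT.
pose pi' x := if (x \in p) || (x \in q) then pi2 x else pi x.
have piE x : x \in used pi -> pi' x = pi x.
  move=> xu; rewrite /pi'; case: ifP => // /orP[/pu|/qu]; first by rewrite xu.
  by rewrite (subsetP usub).
have dom' : dom pi' = dom pi :|: [set x in p ++ q].
  apply/setP=> x; rewrite !inE mem_cat /pi'.
  case: (boolP (x \in p)) => [xp0|_] /=.
    by rewrite orbT p12 //; have := p1 _ xp0; rewrite inE.
  case: (boolP (x \in q)) => [xq0|_] /=; last by rewrite orbF.
  by rewrite orbT; have := q2 _ xq0; rewrite inE.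
have used' : used pi' = used pi :|: [set x in p ++ q] by rewrite /used dom' setUA.
have e1 x w : pi1 x = Some w -> e w x by case: xp1 => _ /[apply] -[].
have e2 x w : pi2 x = Some w -> e w x by case: xp2 => _ /[apply] -[].
have par_p x w : x \in p -> pi1 x = Some w -> w \in a :: p.
  clear -pp up; elim: p a pp up => //= u p IH a /andP[/eqP uE pp] /andP[un up].
  rewrite inE => /predU1P[->|xp]; first by rewrite uE => -[->]; rewrite mem_head.
  by move=> /(IH _ pp up xp) wp; rewrite inE wp orbT.
have par_q x w : x \in q -> pi2 x = Some w -> w \in b :: q.
  clear -pq uq; elim: q b pq uq => //= u q IH b /andP[/eqP uE pq] /andP[un uq].
  rewrite inE => /predU1P[->|xq]; first by rewrite uE => -[->]; rewrite mem_head.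
  by move=> /(IH _ pq uq xq) wq; rewrite inE wq orbT.
have sub2 x : pi' x = pi2 x \/ pi' x = None.
  rewrite /pi'; case: ifP => [_|/negbT npq]; first by left.
  case E: (pi x) => [w|]; [left|by right].
  have xu : x \in used pi by rewrite !inE E orbT.
  by rewrite oE2 ?(subsetP usub) // oE1.
have xp' : ext pi'.
  split.
    apply: (good_restrict (pi' := pi2)) => //; last by case: xp2.
    by move=> x w /(proj2 xp2)[ewx xS _]; rewrite inE ewx.
  move=> x w E; have : pi2 x = Some w by case: (sub2 x) E => ->.
  case/(proj2 xp2) => ewx xS _; split=> //; rewrite used' in_setU.
  move: E; rewrite /pi'; case: ifP => [/orP[xp0|xq]|_].
  - rewrite p12 // => /(par_p _ _ xp0); rewrite in_cons => /predU1P[->|wp].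
      by rewrite au.
    by rewrite [w \in [set _ in _]]inE mem_cat wp orbT.
  - move=> /(par_q _ _ xq); rewrite in_cons => /predU1P[->|wq]; first by rewrite bu.
    by rewrite [w \in [set _ in _]]inE mem_cat wq !orbT.
  by move=> /(proj2 xp)[_ _ ->].
have upq : uniq (p ++ q).
  rewrite cat_uniq up uq andbT /=; apply/hasPn=> x /qu; apply: contra => /p1.
  by rewrite [x \in used _]inE => ->; rewrite orbT.
exists pi', (p ++ rev q).
have memE : p ++ rev q =i p ++ q by move=> x; rewrite !mem_cat mem_rev.
have setE : [set x in p ++ rev q] = [set x in p ++ q].
  by apply/setP=> x; rewrite !inE memE.
split=> //.
- split.
  + by rewrite size_cat size_rev sp sq addnn.
  + rewrite (perm_uniq (s2 := p ++ q)) //.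
    by rewrite perm_cat2l perm_rev.
  + have epath s0 pi0 c : (forall x w, pi0 x = Some w -> e w x) ->
        path (parent_rel pi0) c s0 -> path e c s0.
      move=> e0; apply: sub_path => u v /eqP; exact: e0.
    rewrite rcons_cat cat_path (epath _ _ _ e1 pp) lp /=.
    case/lastP: q lq pq {sq uq qu q2 par_q dom' used' sub2 piE pi' upq memE setE xp'} => [|q' w].
      by move=> /= bz _; rewrite /rev /= bz yz.
    rewrite last_rcons => -> pq; rewrite rev_rcons /= yz /=.
    have := epath _ _ _ e2 pq; rewrite -rev_path last_rcons belast_rcons rev_cons.
    by rewrite (eq_path (e' := e)) // => u v; rewrite e_sym.
  + move=> x; rewrite memE mem_cat => /orP[/pu //|/qu]; apply: contra.
    exact: (subsetP usub).
- by rewrite used' setE.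
- move=> x xu; have xu1 := subsetP usub _ xu.
  apply: leq_trans (_ : nkids pi2 x <= _); last by rewrite kE2 // kE1.
  apply: subset_leq_card; apply/subsetP => w; rewrite !inE.
  by case: (sub2 w) => ->.
move=> x; rewrite memE => xpq.
have -> : t.+1.*2 = size (p ++ q) by rewrite size_cat sp sq addnn.
apply: leq_trans (card_size _).
apply: subset_leq_card; apply/subsetP => w; rewrite inE.
case E: (pi' w) => [v|] //; rewrite inE => /eqP vx; rewrite {v}vx in E.
rewrite mem_cat; apply: contraT => nw; move: E; rewrite /pi' (negbTE nw).
case/(proj2 xp) => _ _ xu; move: xpq; rewrite mem_cat.
case/orP => [/pu|/qu]; first by rewrite xu.
by rewrite (subsetP usub).
Qed.

(** The room for the two auxiliary trees is counted only once, because each connection releases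
    everything except its path. *)
Lemma connect_all t (J : eqType) (a b : J -> V) (js : seq J) pi : m <= d ^ t ->
  let ends := flatten [seq [:: a j; b j] | j <- js] in
  ext pi -> uniq js -> {in js, forall j, a j != b j} -> {subset ends <= used pi} ->
  {in ends, forall x, nkids pi x + count_mem x ends <= D} ->
  room (#|used pi| + size js * t.+1.*2 + 2 * \sum_(i < t.+1) d ^ i) ->
  exists pi' (P : J -> seq V), [/\ ext pi',
    {in js, forall j, size (P j) = t.+1.*2 /\ path e (a j) (rcons (P j) (b j))},
    [/\ uniq (flatten [seq P j | j <- js]),
      {in flatten [seq P j | j <- js], forall y, y \notin used pi} &
      used pi' = used pi :|: [set y in flatten [seq P j | j <- js]]],
    {in used pi, forall x, nkids pi' x <= nkids pi x + count_mem x ends} &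
    {in flatten [seq P j | j <- js], forall x, nkids pi' x <= t.+1.*2}].
Proof.
move=> mt; elim: js pi => [|j js IH] pi /=.
  move=> xp _ _ _ _ _; exists pi, (fun=> [::]); split=> // [|x xu].
    by split=> //; apply/setP=> y; rewrite !inE orbF.
  by rewrite addn0.
set ends := flatten _ => xp /andP[jjs ujs] ne su kD rm.
have au : a j \in used pi by apply: su; rewrite mem_head.
have bu : b j \in used pi by apply: su; rewrite !inE eqxx orbT.
have ab : a j != b j by apply: ne; rewrite mem_head.
have [|||pi1 [p [xp1 [sp up pp pu] uE kE kp]]] := connect_pair mt xp au bu ab.
- by have := kD (a j); rewrite mem_head /= eqxx => /(_ isT); lia.
- by have := kD (b j); rewrite !inE eqxx orbT /= => /(_ isT); lia.
- by move: rm; rewrite /room [(size js).+1 * _]mulSn; apply: leq_ltn_trans; rewrite !leq_add2r leq_addr.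
have sub1 x : x \in used pi -> x \in used pi1 by rewrite uE in_setU => ->.
have endsu x : x \in ends -> x \in used pi.
  by move=> xe; apply: su; rewrite !inE xe !orbT.
have c1 : #|used pi1| = #|used pi| + t.+1.*2.
  rewrite uE cardsU (_ : _ :&: _ = set0) ?cards0 ?subn0.
    by congr (_ + _); rewrite cardsE (card_uniqP up) sp.
  apply/setP=> x; rewrite in_setI in_set0 [x \in [set _ in _]]inE.
  by apply/negP=> /andP[xu /pu]; rewrite xu.
have [//|i iJ|x /endsu/sub1 //|x xe||pi' [P [xp' PP [uP Pu usE kE' kP]]]] := IH pi1 xp1.
- by apply: ne; rewrite inE iJ orbT.
- have xu := endsu _ xe.
  have := kD x; rewrite !inE xe !orbT /= => /(_ isT); apply: leq_trans.
  by have := kE _ xu; rewrite -/ends !addnA leq_add2r.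
- by move: rm; rewrite /room c1 [(size js).+1 * _]mulSn !addnA.
pose Q i := if i == j then p else P i.
have QE : [seq Q i | i <- js] = [seq P i | i <- js].
  by apply/eq_in_map => i iJ; rewrite /Q; case: eqP => // ij; rewrite -ij iJ in jjs.
have Qj : Q j = p by rewrite /Q eqxx.
exists pi', Q; rewrite QE Qj; split=> //.
- move=> i; rewrite in_cons /Q; case: eqP => [-> _|_ /PP //].
  by rewrite sp.
- split.
  + rewrite cat_uniq up uP andbT; apply/hasPn=> x /Pu; apply: contra => xp0.
    by rewrite uE in_setU [x \in [set _ in _]]inE xp0 orbT.
  + by move=> x; rewrite mem_cat => /orP[/pu //|/Pu]; apply: contra; apply: sub1.
  by rewrite usE uE; apply/setP=> x; rewrite !in_setU ![x \in [set _ in _]]inE mem_cat orbA.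
- by move=> x xu; apply: leq_trans (kE' _ (sub1 _ xu)) _; have := kE _ xu; rewrite -/ends !addnA leq_add2r.
move=> x; rewrite mem_cat => /orP[xp0|/kP //].
have xu : x \notin ends by apply: contra (pu _ xp0); apply: endsu.
have x1 : x \in used pi1 by rewrite uE in_setU [x \in [set _ in _]]inE xp0 orbT.
by apply: leq_trans (kE' _ x1) _; rewrite -/ends (count_memPn xu) addn0 kp.
Qed.

End Connecting.

(** * Permutation networks and ladders *)

(** For an involution [tau] this is a row of two-way switches: each pair [x], [tau x] is either left
    alone or exchanged. *)
Definition switch (A : Type) (tau f : A -> A) : Prop :=
  injective f /\ forall x, f x = x \/ f x = tau x.

Definition run (A : Type) (fs : nat -> A -> A) (L : nat) (x : A) : A :=
  iteri L fs x.

Definition network (A : Type) (L : nat) (tau : nat -> A -> A) : Prop :=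
  forall s : A -> A, injective s ->
  exists fs : nat -> A -> A, (forall i, i < L -> switch (tau i) (fs i)) /\ run fs L =1 s.

(* The first and last levels flip the new bit, the levels in between act as the
   smaller network on each of the two halves. *)
Definition benes_tau (A : Type) (L : nat) (tau : nat -> A -> A) (i : nat) (x : bool * A) : bool * A :=
  if (i == 0) || (i == L.+1) then (~~ x.1, x.2) else (x.1, tau i.-1 x.2).

Lemma benes_tau_inj (A : Type) (L : nat) (tau : nat -> A -> A) i :
  (forall c, injective (tau c)) -> injective (benes_tau L tau i).
Proof.
move=> tau_inj [b a] [b' a']; rewrite /benes_tau /=.
by case: ifP => _ [eb ea]; [rewrite (negb_inj eb) ea | rewrite eb (tau_inj _ _ _ ea)].
Qed.

(* Hall's theorem selects one of the two inputs of each first-level switch such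
   that each last-level switch contains exactly one of their outputs; these are
   routed through the upper half, the others through the lower half. *)
Lemma benes_network (A : finType) (L : nat) (tau : nat -> A -> A) :
  network L tau -> network L.+2 (benes_tau L tau).
Proof.
move=> net s s_inj.
pose N (a : A) : {set A} := [set (s (b, a)).2 | b : bool].
(* The [2 * #|U|] outputs of the first-level switches in [U] lie in the last-level switches of
   [nbs N U], each of which holds only two outputs. *)
have [U|o o_inj oN] := hall (N := N).
  have : #|[set s x | x in [set y : bool * A | y.2 \in U]]| <= #|setX [set: bool] (nbs N U)|.
    apply/subset_leq_card/subsetP=> _ /imsetP[[b a] + ->]; rewrite !inE /= => aU.
    by apply: mem_nbs aU _; apply/imsetP; exists b.
  rewrite card_imset // (_ : [set y | _] = setX [set: bool] U).
    by rewrite !cardsX cardsT card_bool leq_pmul2l.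
  by apply/setP=> -[b a]; rewrite !inE.
have ex a : exists b, (s (b, a)).2 == o a by have /imsetP[b _ ->] := oN a; exists b.
pose be a := xchoose (ex a).
have beP a : (s (be a, a)).2 = o a by apply/eqP/(xchooseP (ex a)).
have o_surj y : exists a, o a = y by exists (invF o_inj y); rewrite f_invF.
pose o' a := (s (~~ be a, a)).2.
(* If two inputs that were not selected ended in the same last-level switch, the selected input of
   that switch would be a third one ending there. *)
have o'_inj : injective o'.
  move=> a a' eo; apply/eqP; apply: contraT => aa'.
  have [c oc] := o_surj (o' a).
  have : (s (be c, c)).1 = (s (~~ be a, a)).1 \/ (s (be c, c)).1 = (s (~~ be a', a')).1.
    case E1: ((s (~~ be a, a)).1 == (s (~~ be a', a')).1).
      have /s_inj[] : s (~~ be a, a) = s (~~ be a', a').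
        apply: etrans (surjective_pairing _) _; rewrite (eqP E1) -/(o' a) eo.
        by rewrite [RHS]surjective_pairing.
      by move=> _ ea; rewrite ea eqxx in aa'.
    move/negbT: E1; case: (s (be c, c)).1; case: (s (~~ be a, a)).1 => //;
     case: (s (~~ be a', a')).1 => //; by [left|right].
  have eq1 a1 : (s (be c, c)).1 = (s (~~ be a1, a1)).1 -> o' a = o' a1 -> False.
    move=> e1 e2; have /s_inj[] : s (be c, c) = s (~~ be a1, a1).
      apply: etrans (surjective_pairing _) _; rewrite e1 beP oc e2.
      by rewrite [RHS]surjective_pairing.
    by move=> + ec; rewrite -ec; case: (be c).
  by case=> /eq1; [case|case/(_ eo)].
have [f0 [f0s f0r]] := net o o_inj.
have [f1 [f1s f1r]] := net o' o'_inj.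
(* The selected input of each pair leaves with bit [false], the half on which [f0] realises [o]; the
   other one leaves with bit [true], where [f1] realises [o']. *)
pose first (x : bool * A) := (x.1 (+) be x.2, x.2).
pose inv (x : bool * A) := if x.1 then invF o'_inj x.2 else invF o_inj x.2.
pose last (x : bool * A) := s (x.1 (+) be (inv x), inv x).
pose mid i (x : bool * A) := (x.1, if x.1 then f1 i x.2 else f0 i x.2).
exists (fun i => if i == 0 then first else if i == L.+1 then last else mid i.-1).
split=> [i iL|].
  rewrite /benes_tau; case: (eqVneq i 0) => [i0|i0] /=.
    split=> [[b a] [b' a'] [+ ea]|[b a]]; first by rewrite ea => /addIb ->.
    by rewrite /first /=; case: (be a); [right|left]; rewrite ?addbT ?addbF.
  case: (eqVneq i L.+1) => [iL1|iL1].
    have last2 x : (last x).2 = x.2.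
      rewrite /last /inv; case: x => -[] a /=; last by rewrite beP f_invF.
      by rewrite -/(o' _) f_invF.
    have last_inj : injective last.
      move=> [b a] [b' a'] e; have ea : a = a' by have := congr1 snd e; rewrite !last2.
      rewrite -ea in e *; congr (_, _); move/s_inj: e => [].
      move=> e ei; move: e; rewrite ei => /addIb; exact.
    split=> // x; case E: ((last x).1 == x.1); [left|right].
      by rewrite [LHS]surjective_pairing last2 (eqP E) -surjective_pairing.
    rewrite [LHS]surjective_pairing last2; congr (_, _).
    by move: E; case: (last x).1; case: x.1.
  have i1L : i.-1 < L by lia.
  have [f0i f0x] := f0s _ i1L; have [f1i f1x] := f1s _ i1L.
  split=> [[b a] [b' a'] [<-]|[b a]].
    by case: b => [/f1i|/f0i] ->.
  by rewrite /mid /=; case: b; [case: (f1x a)|case: (f0x a)] => ->; [left|right|left|right].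
move=> [b a]; rewrite /run /=.
have midE k : k <= L -> iteri k.+1 (fun i => if i == 0 then first else if i == L.+1 then last else mid i.-1) (b, a)
   = (b (+) be a, if b (+) be a then iteri k f1 a else iteri k f0 a).
  elim: k => [|k IH] kL; first by rewrite /= /first /=; case: (b (+) be a).
  rewrite iteriS IH ?(ltnW kL) //= (_ : k.+1 == L.+1 = false); last by apply/eqP; lia.
  by rewrite /mid /=; case: (b (+) be a).
rewrite eqxx -/(iteri _ _ _) /last.
have := midE L (leqnn _) => /= ->; rewrite /inv /=.
rewrite -[in RHS](addbK (be a) b).
by case: (b (+) be a); rewrite -!/(run _ _ _) ?f0r ?f1r !invF_f.
Qed.

Fixpoint cube (j : nat) : finType :=
  if j is j'.+1 then (bool * cube j')%type : finType else unit : finType.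

Lemma card_cube j : #|cube j| = 2 ^ j.
Proof. by elim: j => [|j IH] /=; rewrite ?card_unit // card_prod card_bool IH expnS. Qed.

Lemma cube_network j : exists tau : nat -> cube j -> cube j,
  (forall i, injective (tau i)) /\ network j.*2 tau.
Proof.
elim: j => [|j [tau [tau_inj /benes_network net]]].
  by exists (fun _ => id); split=> [i x y //|s _]; exists (fun _ => id); split=> // -[]; case: (s tt).
exists (benes_tau j.*2 tau); split=> // i; exact: benes_tau_inj.
Qed.

Section Ladder.

Variables (V : eqType) (e : rel V).
Hypothesis e_sym : symmetric e.

(* The ladder with rail vertices [x], [y] and rungs [g], traversed by taking
   every rung and alternating between the rails; [b] is the rail entered first. *)
Fixpoint zigzag (b : bool) (l : seq (V * V * seq V)) : seq V :=
  if l is (x, y, g) :: l' then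
    (if b then x :: g ++ [:: y] else y :: rev g ++ [:: x]) ++ zigzag (~~ b) l'
  else [::].

Lemma rev_path_rcons x y g : path e x (rcons g y) -> path e y (rcons (rev g) x).
Proof.
move=> pg; rewrite -rev_cons -(belast_rcons x g y).
by rewrite -[in X in path _ X](last_rcons x g y) rev_path (eq_path (e' := e)) // => u v; rewrite e_sym.
Qed.

Lemma mem_zigzag b l z :
  (z \in zigzag b l) = has (fun u => [|| z == u.1.1, z == u.1.2 | z \in u.2]) l.
Proof.
elim: l b => //= -[[x y] g] l IH b; rewrite mem_cat IH; congr (_ || _).
case: b; rewrite inE mem_cat ?mem_rev inE /=.
  by rewrite orbA orbAC -orbA.
by case: (z == x); case: (z == y); case: (z \in g).
Qed.

Lemma size_zigzag b l k : (forall u, u \in l -> size u.2 = k) ->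
  size (zigzag b l) = k.+2 * size l.
Proof.
elim: l b => [|[[x y] g] l IH] b /= lk; first by rewrite muln0.
have sg : size g = k by apply: (lk (x, y, g)); rewrite mem_head.
rewrite size_cat IH => [|u ul]; last by apply: lk; rewrite inE ul orbT.
by rewrite mulnS; case: b; rewrite /= size_cat ?size_rev sg /= addn1.
Qed.

(** The walk changes rails at every rung. With an even number of rungs it leaves by the rail entered
    first, so [b] chooses the exit, whereas by [mem_zigzag] the covered vertices do not depend on
    [b]. *)
Lemma path_zigzag b l ax ay c d :
  path e ax (rcons [seq u.1.1 | u <- l] c) -> path e ay (rcons [seq u.1.2 | u <- l] d) ->
  (forall u, u \in l -> path e u.1.1 (rcons u.2 u.1.2)) ->
  path e (if b then ax else ay) (rcons (zigzag b l) (if b (+) odd (size l) then c else d)).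
Proof.
elim: l b ax ay => [|[[x y] g] l IH] b ax ay /=.
  by rewrite addbF; case: b.
case/andP=> axx px /andP[ayy py] pl.
have pg : path e x (rcons g y) by apply: (pl (x, y, g)); rewrite mem_head.
have /(IH (~~ b)) := px => /(_ y py) {}IH.
have {}IH := IH (fun u ul => pl u (mem_behead (s := (x, y, g) :: l) ul)).
case: b IH => /=.
  by rewrite axx -catA rcons_cat /= -cat_rcons cat_path pg last_rcons /= negbK.
by rewrite ayy -catA rcons_cat /= -cat_rcons cat_path rev_path_rcons // last_rcons.
Qed.

End Ladder.

(** * Reservoirs by random colouring *)

Lemma leq_expn2r m n k : m <= n -> m ^ k <= n ^ k.
Proof. by case: k => // k mn; rewrite leq_exp2r. Qed.

Lemma bernoulli_expS x k : x ^ k.+1 + k.+1 * x ^ k <= x.+1 ^ k.+1.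
Proof.
elim: k => [|k IH]; first by rewrite expn1 expn0; lia.
rewrite [in X in _ <= X]expnS; apply: leq_trans (leq_mul (leqnn x.+1) IH).
rewrite !expnS; nia.
Qed.

(** The bound [b / (b - n)] for [(1 + 1/b)^n], free of division; it controls the sum of the weights
    [b^(-#|Y|)] over all sets [Y]. *)
Lemma bernoulli_sub b n : n <= b -> b.+1 ^ n * (b - n) <= b ^ n.+1.
Proof.
elim: n => [|n IH] nb; first by rewrite expn0 expn1 mul1n subn0.
have [c bE] : exists c, b = c + n.+1 by exists (b - n.+1); lia.
have -> : b - n.+1 = c by lia.
have := IH (ltnW nb); have -> : b - n = c.+1 by lia.
rewrite [b.+1 ^ n.+1]expnS [b ^ n.+2]expnS => h.
apply: leq_trans (leq_mul (leqnn b) h); rewrite (mulnC b.+1) -mulnA.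
by rewrite [X in _ <= X]mulnCA leq_mul2l mulSn mulnS leq_add2r bE leq_addr orbT.
Qed.

Lemma prod_if_card (V : finType) (P : pred V) (x y : nat) :
  \prod_(v : V) (if P v then x else y) = x ^ #|P| * y ^ (#|V| - #|P|).
Proof.
rewrite (bigID P) /=; congr (_ * _).
  by rewrite -prod_nat_const; apply: eq_bigr => v ->.
rewrite -[in RHS](cardC P) addKn -prod_nat_const.
by apply: eq_big => [v|v /negbTE ->].
Qed.

Section Colouring.

Variables (V K : finType) (nb : {set V} -> {set V}) (M a : nat).
Hypothesis K_gt0 : 0 < #|K|.
Hypothesis expand : forall Y : {set V}, 0 < #|Y| <= M -> 2 * #|K| * a.+1 * #|Y| <= #|nb Y|.
Hypothesis a_large : #|K| * #|V| + #|V| < 2 ^ a.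

Let c := #|K|.

Definition bad_colourings (Y : {set V}) (j : K) : {set {ffun V -> K}} :=
  [set f | #|nb Y :&: [set v | (f : {ffun V -> K}) v == j]| < #|Y|].

(** An exponential moment bound. Let [hits f] count the vertices of [nb Y] that miss colour [j].
    Over a uniform colouring the mean of [2^hits] is [(2 - 1/c)^g], while [hits > g - y] on a bad
    colouring; so bad ones have proportion at most [2^y (1 - 1/(2c))^g]. Since [g >= 2c(a+1)y] and
    [(1 - 1/(2c))^(2c) <= 1/2], this is at most [2^(-ay)]. *)
Lemma card_bad_colourings (Y : {set V}) (j : K) : 0 < #|Y| <= M ->
  #|bad_colourings Y j| * (2 ^ a) ^ #|Y| <= c ^ #|V|.
Proof.
move=> YM; have c0 : 0 < c by apply/card_gt0P; exists j.
set g := #|nb Y|; set y := #|Y|.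
have gV : g <= #|V| := max_card _.
pose hits (f : {ffun V -> K}) := #|nb Y :\: [set v | f v == j]|.
have total : \sum_(f : {ffun V -> K}) 2 ^ hits f = c ^ (#|V| - g) * (2 * c).-1 ^ g.
  transitivity (\sum_(f : {ffun V -> K}) \prod_(v : V) (if (v \in nb Y) && (f v != j) then 2 else 1)).
    apply: eq_bigr => f _; rewrite prod_if_card exp1n muln1; congr (_ ^ _).
    by apply: eq_card => v; rewrite !inE andbC.
  rewrite -(bigA_distr_bigA (fun v k => if (v \in nb Y) && (k != j) then 2 else 1)).
  transitivity (\prod_(v : V) (if v \in nb Y then (2 * c).-1 else c)); last first.
    by rewrite prod_if_card mulnC.
  apply: eq_bigr => v _; case: (v \in nb Y) => /=; last by rewrite sum1_card.
  rewrite (bigD1 j) //= eqxx (eq_bigr (fun=> 2)) => [|k /= ->] //.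
  have := cardC1 j; rewrite sum_nat_const -/c => cE.
  rewrite (_ : #|_| = c.-1); first by rewrite /=; lia.
  by rewrite -cE; apply: eq_card.
have B2g : #|bad_colourings Y j| * 2 ^ g <= 2 ^ y * (c ^ (#|V| - g) * (2 * c).-1 ^ g).
  rewrite -total big_distrr /= -sum_nat_const [X in _ <= X](bigID (mem (bad_colourings Y j))) /=.
  apply: leq_trans (leq_addr _ _); apply: leq_sum => f; rewrite inE => fb.
  rewrite -expnD leq_pexp2l // /g -(cardsID [set v | f v == j] (nb Y)) leq_add2r ltnW //.
have half : (2 * c).-1 ^ g * 2 ^ (a.+1 * y) <= (2 * c) ^ g.
  have ge : 2 * c * (a.+1 * y) <= g by rewrite mulnA; apply: expand.
  have [x xE] : exists x, 2 * c = x.+1 by exists (2 * c).-1; lia.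
  rewrite xE in ge *; move: (a.+1 * y) ge => k ge.
  have [r ->] : exists r, g = x.+1 * k + r by exists (g - x.+1 * k); rewrite subnKC.
  rewrite /= (expnD x) (expnD x.+1) (expnM x) (expnM x.+1).
  rewrite -mulnA (mulnC (x ^ _)) mulnA -expnMn; apply: leq_mul; apply: leq_expn2r => //.
  apply: leq_trans (bernoulli_expS x x).
  by rewrite muln2 -addnn leq_add2l expnS leq_mul2r leqnSn orbT.
have : #|bad_colourings Y j| * 2 ^ (a.+1 * y) * 2 ^ g <= 2 ^ y * c ^ #|V| * 2 ^ g.
  have -> : c ^ #|V| = c ^ (#|V| - g) * c ^ g by rewrite -expnD subnK.
  rewrite mulnAC; apply: leq_trans (leq_mul B2g (leqnn (2 ^ (a.+1 * y)))) _.
  rewrite -!mulnA leq_mul2l; apply/orP; right.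
  by rewrite leq_mul2l -expnMn [c * 2]mulnC half orbT.
rewrite leq_pmul2r ?expn_gt0 // mulSn expnD mulnCA leq_pmul2l ?expn_gt0 //.
by rewrite expnM.
Qed.

(** A union bound over colours and non-empty sets: with [b = 2^a] the failure probability is at most
    [c ((1 + 1/b)^#|V| - 1)], which is below 1 as soon as [b] exceeds [c #|V| + #|V|]. *)
Lemma good_colouring : exists f : V -> K, forall (j : K) (Y : {set V}), #|Y| <= M ->
  #|Y| <= #|nb Y :&: [set v | f v == j]|.
Proof.
have [/existsP[f /forallP fP]|none] :=
    boolP [exists f : {ffun V -> K}, [forall j : K, [forall Y : {set V},
      (0 < #|Y| <= M) ==> (f \notin bad_colourings Y j)]]].
  exists f => j Y YM; have [|Y0] := posnP #|Y|; first by move->.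
  have := forallP (fP j) Y; rewrite Y0 YM /= inE -leqNgt; exact.
exfalso.
set b := 2 ^ a; have nb_ : c * #|V| + #|V| < b by [].
have all_bad : c ^ #|V| <= \sum_(j : K) \sum_(Y : {set V} | 0 < #|Y| <= M) #|bad_colourings Y j|.
  rewrite -card_ffun -sum1_card.
  have -> : \sum_(j : K) \sum_(Y : {set V} | 0 < #|Y| <= M) #|bad_colourings Y j| =
      \sum_(f : {ffun V -> K}) \sum_(j : K) \sum_(Y : {set V} | 0 < #|Y| <= M) (f \in bad_colourings Y j).
    rewrite [RHS]exchange_big; apply: eq_bigr => j _.
    rewrite [RHS]exchange_big; apply: eq_bigr => Y _.
    by rewrite -sum1_card big_mkcond.
  apply: leq_sum => f _.
  move: none; rewrite negb_exists => /forallP/(_ f); rewrite negb_forall => /existsP[j].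
  rewrite negb_forall => /existsP[Y]; rewrite negb_imply negbK => /andP[YM fb].
  by rewrite (bigD1 j) //= (bigD1 Y) //= fb.
have sub : \sum_(Y : {set V}) b ^ (#|V| - #|Y|) = b.+1 ^ #|V|.
  have <- : \prod_(v : V) (1 + b) = b.+1 ^ #|V| by apply: (prod_nat_const (mem V)).
  rewrite bigA_distr; apply: eq_bigr => Y _.
  by rewrite prod_if_card exp1n mul1n.
have sum_le : c ^ #|V| * b ^ #|V| <= c * (c ^ #|V| * (b.+1 ^ #|V| - b ^ #|V|)).
  apply: leq_trans (leq_mul all_bad (leqnn _)) _; rewrite big_distrl /=.
  rewrite -sum_nat_const; apply: leq_sum => j _; rewrite big_distrl /=.
  have -> : b.+1 ^ #|V| - b ^ #|V| = \sum_(Y : {set V} | Y != set0) b ^ (#|V| - #|Y|).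
    by rewrite -sub (bigD1 set0) //= cards0 subn0 addKn.
  rewrite big_distrr /= big_mkcond [X in _ <= X]big_mkcond; apply: leq_sum => Y _.
  rewrite -card_gt0; case: ifP => // YM; have /andP[-> _] := YM.
  rewrite -[in b ^ #|V|](subnKC (max_card (mem Y))) expnD mulnA leq_mul2r.
  by apply/orP; right; apply: card_bad_colourings.
have bern := @bernoulli_sub b #|V| ltac:(lia).
have b0 : 0 < b by rewrite expn_gt0.
have c0 : 0 < c := K_gt0.
have cb : b ^ #|V| <= c * (b.+1 ^ #|V| - b ^ #|V|).
  by rewrite -(@leq_pmul2l (c ^ #|V|)) ?expn_gt0 ?c0 // mulnCA.
have bV : 0 < b ^ #|V| by rewrite expn_gt0 b0.
move: bern cb; rewrite expnS.
have : b ^ #|V| <= b.+1 ^ #|V| by apply: leq_expn2r.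
move: (b ^ #|V|) (b.+1 ^ #|V|) bV nb_ => p q p0 nb_ pq.
nia.
Qed.

End Colouring.

(** The colours form two sides of [D.+1] classes each. The smaller side is [W], where a set expands
    into every class. [Q1] and [Q2] are the two smallest classes of the other side; the second
    smallest is minimal among [D] classes, hence the bound [#|V| / D]. *)
Lemma reservoir (V : finType) (e : rel V) (M D a : nat) : 0 < D ->
  (forall Y : {set V}, 0 < #|Y| <= M -> 2 * (2 * D.+1) * a.+1 * #|Y| <= #|nbh e Y|) ->
  2 * D.+1 * #|V| + #|V| < 2 ^ a ->
  exists Q1 Q2 W : {set V},
    [/\ [/\ [disjoint Q1 & Q2], [disjoint Q1 & W] & [disjoint Q2 & W]],
        [/\ #|Q1| * D <= #|V|, #|Q2| * D <= #|V| & 2 * #|W| <= #|V|] &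
        forall Y : {set V}, #|Y| <= M -> [/\ #|Y| <= #|nbh e Y :&: Q1|,
          #|Y| <= #|nbh e Y :&: Q2| & D * #|Y| <= #|nbh e Y :&: W|]].
Proof.
move=> D0 ex al.
pose K : finType := (bool * 'I_D.+1)%type.
have cK : #|K| = 2 * D.+1 by rewrite card_prod card_bool card_ord.
have [|Y YM||f fP] := @good_colouring V K (nbh e) M a; rewrite ?cK //; first exact: ex.
pose side b := [set v | (f v).1 == b].
pose cls j := [set v | f v == j].
have sum_side (A : {set V}) b : #|A :&: side b| = \sum_(i < D.+1) #|A :&: cls (b, i)|.
  rewrite -sum1_card (partition_big (fun v => (f v).2) predT) //=.
  apply: eq_bigr => i _; rewrite -sum1_card; apply: eq_bigl => v.
  by rewrite !inE -andbA; case: (f v) => b' i'.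
have [b bV] : exists b, 2 * #|side b| <= #|V|.
  have : #|side true| + #|side false| = #|V|.
    rewrite -(cardC (mem (side true))); congr (_ + _); apply: eq_card => v.
    by rewrite !inE; case: (f v).1.
  by case: (leqP #|side true| #|side false|) => ? ?; [exists true|exists false]; lia.
have disj j j' : j != j' -> [disjoint cls j & cls j'].
  move=> jj'; rewrite -setI_eq0; apply/eqP/setP=> v; rewrite !inE.
  by apply/andP=> -[/eqP vj /eqP vj']; rewrite -vj -vj' eqxx in jj'.
have disjs i : [disjoint cls (~~ b, i) & side b].
  rewrite -setI_eq0; apply/eqP/setP=> v; rewrite !inE; by case: (f v) => b' i'; rewrite /= xpair_eqE; case: b'; case: (b); rewrite /= ?andbF.
pose sz i := #|cls (~~ b, i)|.
have szV : \sum_(i < D.+1) sz i <= #|V|.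
  apply: leq_trans (max_card (mem (side (~~ b)))).
  by rewrite -[side _]setTI sum_side; apply: leq_sum => i _; rewrite setTI.
have [i1 _ i1P] := arg_minnP (P := xpredT) sz (i0 := ord0) isT.
have [i0 i01] : exists i0, i0 != i1.
  by case: (eqVneq ord0 i1) => [<-|]; [exists ord_max; rewrite -val_eqE /= -lt0n|exists ord0].
have [i2 i21 i2P] := arg_minnP (P := fun i => i != i1) sz i01.
have i2V : sz i2 * D <= #|V|.
  apply: leq_trans szV; rewrite (bigD1 i1) //=; apply: leq_trans (leq_addl _ _).
  have cD : #|[pred i : 'I_D.+1 | i != i1]| = D by rewrite cardC1 card_ord.
  rewrite mulnC -[X in X * _]cD -sum_nat_const; apply: leq_sum => i; exact: i2P.
exists (cls (~~ b, i1)), (cls (~~ b, i2)), (side b); split.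
- split=> //; apply: disj; apply: contraNneq i21 => -[->] //.
- split=> //; apply: leq_trans i2V; rewrite leq_mul2r; apply/orP; right; exact: i1P.
move=> Y YM; split; try exact: fP.
rewrite sum_side; apply: (@leq_trans (D.+1 * #|Y|)); first by rewrite leq_mul2r leqnSn orbT.
rewrite -[in D.+1 * _](card_ord D.+1) -sum_nat_const; apply: leq_sum => i _; exact: fP.
Qed.

(** * Rooted trees *)

Definition rooted_tree (T : finType) (e : rel T) (rho : T) (par : T -> T)
    (depth : T -> nat) : Prop :=
  [/\ par rho = rho, depth rho = 0,
      forall x, x != rho -> depth x = (depth (par x)).+1,
      forall x, x != rho -> e (par x) x &
      forall x y, e x y -> x != rho /\ par x = y \/ y != rho /\ par y = x].

Lemma path_exit (T : finType) (e : rel T) (A : {set T}) x p :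
  path e x p -> x \in A -> last x p \notin A -> exists u v, [/\ u \in A, v \notin A & e u v].
Proof.
elim: p x => [|y p IH] x /=; first by move=> _ ->.
move=> /andP[xy yp] xA; have [yA|yA _] := boolP (y \in A); first exact: IH.
by exists x, y.
Qed.

(* The root's component is swept outwards; a new vertex has a single neighbour
   among the previous ones, as two would close a cycle. *)
Lemma rooted_tree_exists (T : finType) (e : rel T) (rho : T) :
  symmetric e -> irreflexive e -> (forall x y, connect e x y) ->
  (forall c, ucycle e c -> size c <= 2) ->
  exists par depth, rooted_tree e rho par depth.
Proof.
move=> es ei conn acy.
pose inside (A : {set T}) : rel T := fun u v => [&& e u v, u \in A & v \in A].
pose ok (A : {set T}) (par : T -> T) (depth : T -> nat) := [/\ rho \in A,
  par rho = rho /\ depth rho = 0,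
  forall x, x \in A -> x != rho -> [/\ par x \in A, depth x = (depth (par x)).+1 & e (par x) x],
  forall x y, x \in A -> y \in A -> e x y -> x != rho /\ par x = y \/ y != rho /\ par y = x &
  forall x, x \in A -> connect (inside A) rho x].
suff main k : k < #|T| -> exists A par depth, ok A par depth /\ k < #|A|.
  have T0 : 0 < #|T| by apply/card_gt0P; exists rho.
  have [|A [par [depth [[rA [pr dr] pA eA _] lt]]]] := main #|T|.-1; first by rewrite prednK.
  have AT x : x \in A.
    suff -> : A = setT by rewrite inE.
    by apply/eqP; rewrite eqEcard subsetT cardsT; lia.
  exists par, depth; split=> // [x xr|x xr|x y].
  - by have [] := pA x (AT x) xr.
  - by have [] := pA x (AT x) xr.
  - exact: eA.
elim: k => [|k IH] kT.
  exists [set rho], (fun=> rho), (fun=> 0); rewrite cards1; split=> //; split=> //.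
  - by rewrite inE.
  - by move=> x; rewrite inE => ->.
  - by move=> x y; rewrite !inE => /eqP -> /eqP ->; rewrite ei.
  - by move=> x; rewrite inE => /eqP ->.
have [A [par [depth [okA kA]]]] := IH (ltnW kT).
have [lt|le] := ltnP k.+1 #|A|; first by exists A, par, depth.
have [rA [pr dr] pA eA cA] := okA.
have /set0Pn[z] : ~: A != set0 by rewrite -card_gt0; have := cardsC A; lia.
rewrite inE => zA; have /connectP[p pp zE] := conn rho z.
rewrite zE in zA; have [u [v [uA vA uv]]] := path_exit pp rA zA.
have v_rho : v != rho by apply: contraNneq vA => ->.
have insS : symmetric (inside A).
  by move=> x y; rewrite /inside es; congr (_ && _); rewrite andbC.
have nb_uniq w : w \in A -> e w v -> w = u.
  move=> wA wv; have : connect (inside A) w u.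
    by apply: connect_trans (cA u uA); rewrite (sym_connect_sym insS) cA.
  case/connectP => p0 pp0 uE; case: (shortenP pp0) uE => p' pp' up' _ uE.
  apply/eqP; apply: contraT => wu.
  have : ucycle e (v :: w :: p').
    have subA x q : path (inside A) x q -> {subset q <= A}.
      elim: q x => // y q IHq x /= /andP[/and3P[_ _ yA] /IHq sq] t.
      by rewrite inE => /predU1P[->|/sq].
    rewrite /ucycle cons_uniq up' andbT /= es wv /= rcons_path -uE uv andbT.
    rewrite (sub_path _ pp') => [|x y /and3P[]//] /=.
    rewrite inE negb_or (contraNneq _ vA) => [/=|->//].
    by apply: contra vA => /(subA _ _ pp').
  by move/acy; case: (p') uE => [/= uE|]; rewrite // uE eqxx in wu.
exists (v |: A), (fun x => if x == v then u else par x),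
  (fun x => if x == v then (depth u).+1 else depth x).
rewrite cardsU1 vA; split=> //.
have uNv : u == v = false by apply/negbTE; apply: contraNneq vA => <-.
split.
- by rewrite inE rA orbT.
- by rewrite eq_sym (negbTE v_rho).
- move=> x; rewrite !inE; case: (eqVneq x v) => [-> _ _|xv /= xA xr].
    by rewrite uNv uA orbT.
  have [pxA dx ex] := pA x xA xr.
  by rewrite pxA orbT (negbTE (contraNneq _ vA)) // => <-.
- move=> x y; rewrite !inE; case: (eqVneq x v) => [->|xv] /=; case: (eqVneq y v) => [->|yv] /= xA yA exy.
  + by rewrite ei in exy.
  + by left; split=> //; rewrite (nb_uniq y) // es.
  + by right; split=> //; rewrite (nb_uniq x).
  + exact: eA.
- have sub x y : inside A x y -> connect (inside (v |: A)) x y.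
    by case/and3P=> ? ? ?; apply: connect1; apply/and3P; split=> //; rewrite inE; apply/orP; right.
  move=> x /setU1P[->|xA]; last by apply: connect_sub (cA _ xA).
  apply: connect_trans (connect_sub sub (cA _ uA)) (connect1 _).
  by rewrite /inside uv !inE eqxx uA orbT.
Qed.

Section RootedTree.

Variables (T : finType) (e : rel T) (rho : T) (par : T -> T) (depth : T -> nat).
Hypothesis rt : rooted_tree e rho par depth.

Definition children (x : T) : {set T} := [set y | (y != rho) && (par y == x)].

Lemma depth0 x : (depth x == 0) = (x == rho).
Proof.
have [_ dr dp _ _] := rt; apply/eqP/eqP => [|->//].
by move=> dx; apply/eqP; apply: contraT => /dp; rewrite dx.
Qed.

Lemma depth_par x : depth (par x) = (depth x).-1.
Proof.
have [pr dr dp _ _] := rt.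
by have [->|/dp ->//] := eqVneq x rho; rewrite pr dr.
Qed.

Lemma depth_iter a x : depth (iter a par x) = depth x - a.
Proof. by elim: a => [|a IH]; rewrite ?subn0 //= depth_par IH subnS. Qed.

Lemma iter_neq_root a x : a < depth x -> iter a par x != rho.
Proof. by move=> ad; rewrite -depth0 depth_iter subn_eq0 -ltnNge. Qed.

Lemma mem_ch_par x : x != rho -> x \in children (par x).
Proof. by move=> xr; rewrite inE xr eqxx. Qed.

Lemma card_ch_sum : (\sum_(x : T) #|children x|) = #|T|.-1.
Proof.
have <- : \sum_(y | y != rho) 1 = #|T|.-1 by rewrite sum1_card -(cardC1 rho).
rewrite [RHS](partition_big par predT) //=.
by apply: eq_bigr => x _; rewrite -sum1_card; apply: eq_bigl => y; rewrite !inE.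
Qed.

Lemma card_descendants b a x : (forall y, #|children y| <= b) ->
  #|[set z | (a <= depth z) && (iter a par z == x)]| <= b ^ a.
Proof.
move=> chb; elim: a x => [|a IH] x.
  by rewrite (_ : [set z | _] = [set x]) ?cards1 //; apply/setP=> z; rewrite !inE.
pose F y := [set z | (a <= depth z) && (iter a par z == y)].
apply: (@leq_trans (\sum_(y in children x) #|F y|)); last first.
  rewrite expnS; apply: leq_trans (leq_mul (chb x) (leqnn _)).
  by rewrite -sum_nat_const; apply: leq_sum => y _; apply: IH.
have -> : [set z | (a.+1 <= depth z) && (iter a.+1 par z == x)] = \bigcup_(y in children x) F y.
  apply/setP=> z; rewrite !inE; apply/andP/bigcupP => [[az /eqP zx]|[y]].
    exists (iter a par z); last by rewrite inE eqxx ltnW.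
    by rewrite inE iter_neq_root //=; apply/eqP.
  rewrite !inE => /andP[yr /eqP yx] /andP[az /eqP zy]; rewrite /= zy yx eqxx; split=> //.
  by move: yr; rewrite -zy -depth0 depth_iter subn_eq0 -ltnNge.
elim/big_rec2: _ => [|y m W _ le]; first by rewrite cards0.
by apply: leq_trans (leq_card_setU _ _).1 _; rewrite leq_add2l.
Qed.

(** Descending through vertices with a single child leaves no choice, so a bare path of given length
    is determined by its top. *)
Lemma unary_inj c z z' : c <= depth z -> c <= depth z' ->
  (forall b, 0 < b <= c -> #|children (iter b par z)| = 1) ->
  iter c par z = iter c par z' -> z = z'.
Proof.
elim: c z z' => // c IH z z' cz cz' un; rewrite !iterSr => eqz.
have pz : par z = par z'.
  apply: IH eqz; rewrite ?depth_par; try lia.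
  by move=> b bc; rewrite -iterSr; apply: un; lia.
have /eqP/cards1P[w chE] := un 1 isT; rewrite /= in chE.
have r x : c < depth x -> x != rho by rewrite -depth0 -lt0n; apply: leq_trans.
have := @mem_ch_par z (r _ cz); have := @mem_ch_par z' (r _ cz').
by rewrite -pz chE !inE => /eqP -> /eqP.
Qed.

Definition leaves : {set T} := [set x | children x == set0].

(** Keep one residue class of depths modulo [K.+1], and in it one vertex for each [K]-th ancestor.
    If two chains meet, after [a] and [a'] steps, then [a] and [a'] are congruent modulo [K.+1],
    hence equal; the two [K]-th ancestors then coincide, and so do the vertices. *)
Lemma spread_chains (Z : {set T}) K mu :
  {in Z, forall z, K <= depth z} ->
  (forall x, #|[set z in Z | iter K par z == x]| <= mu) ->
  exists Z1 : {set T}, [/\ Z1 \subset Z, #|Z| <= K.+1 * mu * #|Z1| &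
    {in Z1 &, forall z z' a a', a <= K -> a' <= K ->
      iter a par z = iter a' par z' -> z = z' /\ a = a'}].
Proof.
move=> Zd Zmu; pose Zr (r : 'I_K.+1) := [set z in Z | depth z %% K.+1 == r].
have [r _ rP] := arg_maxnP (P := xpredT) (fun r => #|Zr r|) (i0 := ord0) isT.
have cZ : #|Z| <= K.+1 * #|Zr r|.
  rewrite -sum1_card (partition_big (fun z => inord (depth z %% K.+1) : 'I_K.+1) predT) //=.
  rewrite -[X in X * _](card_ord K.+1) -sum_nat_const; apply: leq_sum => i _.
  apply: leq_trans (rP i isT); rewrite sum1_card subset_leq_card //.
  apply/subsetP=> z; rewrite !inE unfold_in => /andP[-> /eqP <-].
  by rewrite inordK ?ltn_mod ?eqxx.
pose X := (iter K par) @: Zr r.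
have cX : #|Zr r| <= mu * #|X|.
  rewrite -sum1_card (partition_big_imset (iter K par)) /= mulnC -sum_nat_const.
  apply: leq_sum => x _; apply: leq_trans (Zmu x); rewrite sum1_card subset_leq_card //.
  by apply/subsetP=> z; rewrite !inE unfold_in inE => /andP[/andP[-> _] ->].
pose rep x := odflt x [pick z in Zr r | iter K par z == x].
have repP x : x \in X -> rep x \in Zr r /\ iter K par (rep x) = x.
  case/imsetP=> z zZ ->; rewrite /rep; case: pickP => [w /andP[wZ /eqP ->] //|/(_ z)].
  by rewrite zZ eqxx.
exists (rep @: X); split.
- by apply/subsetP=> _ /imsetP[x /repP[+ _] ->]; rewrite inE => /andP[].
- rewrite card_in_imset => [|x y /repP[_ ex] /repP[_ ey] exy]; last by rewrite -ex -ey exy.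
  by apply: leq_trans cZ _; rewrite -mulnA leq_mul2l cX orbT.
move=> _ _ /imsetP[x xX ->] /imsetP[y yX ->] a a' aK a'K eqa.
have [+ ex] := repP x xX; have [+ ey] := repP y yX.
rewrite !inE => /andP[yZ /eqP ry] /andP[xZ /eqP rx].
have dx := Zd _ xZ; have dy := Zd _ yZ.
have dd : depth (rep x) - a = depth (rep y) - a' by rewrite -!depth_iter eqa.
have dmod : depth (rep x) = depth (rep y) %[mod K.+1] by rewrite rx ry.
have aa : a = a'.
  have : (depth (rep x) + a' = depth (rep x) + a %[mod K.+1]).
    by rewrite -(modnDml _ a) dmod modnDml; congr (_ %% _); lia.
  by move/eqP; rewrite eqn_modDl !modn_small // => /eqP.
split=> //; subst a'; suff -> : x = y by [].
rewrite -ex -ey -(subnKC aK) addnC !iterD; congr iter; exact: eqa.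
Qed.

Definition bare_ends K : {set T} :=
  [set z | (K <= depth z) && [forall a : 'I_K.+1, (0 < a) ==> (#|children (iter a par z)| == 1)]].

(* A vertex that is not the lower end of a bare path is determined by the first
   non-unary vertex (or root) above it: the child [y] of that vertex on the way,
   and the distance to it. *)
Lemma card_bare_ends K : #|T| <= #|bare_ends K| + (2 * #|leaves| * K.+1).+1.
Proof.
pose Y := [set y | (y != rho) && ((#|children (par y)| != 1) || (par y == rho))].
have cY : #|Y| <= 2 * #|leaves|.
  have T0 : 0 < #|T| by apply/card_gt0P; exists rho.
  (* Vertex by vertex, with [c] children: [c + 2 <= 2c] if [c >= 2], and equality holds in the cases
     [c = 0] and [c = 1]. In total, non-unary vertices have at most [2 * #|leaves| - 2] children,
     which leaves space for the child of a unary root. *)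
  have sumE : \sum_(x : T) (#|children x| != 1) * #|children x| + \sum_(x : T) 2 <=
              \sum_(x : T) 2 * #|children x| + \sum_(x : T) 2 * (x \in leaves).
    rewrite -!big_split; apply: leq_sum => x _; rewrite inE -cards_eq0.
    by case: #|children x| => [|[|c]] //=; lia.
  have e1 : \sum_(x : T) 2 * #|children x| = 2 * #|T|.-1 by rewrite -big_distrr card_ch_sum.
  have e2 : \sum_(x : T) 2 * (x \in leaves) = 2 * #|leaves|.
    by rewrite -big_distrr -[#|leaves|]sum1_card [in RHS]big_mkcond.
  rewrite e1 e2 (sum_nat_const (mem T)) in sumE.
  pose Y2 := [set y | (y != rho) && (#|children (par y)| != 1)].
  have cY2 : #|Y2| <= \sum_(x : T) (#|children x| != 1) * #|children x|.
    rewrite -sum1_card (partition_big par predT) //=; apply: leq_sum => x _.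
    rewrite sum1_card; have [c1|c1] := eqVneq #|children x| 1.
      rewrite leqn0; apply/eqP/eq_card0 => y; rewrite unfold_in inE.
      by apply/negP => /andP[/andP[_ yx] /eqP xE]; rewrite xE c1 in yx.
    rewrite mul1n subset_leq_card //; apply/subsetP => y; rewrite !inE unfold_in inE.
    by move=> /andP[/andP[-> _] ->].
  have Y12 : #|Y| <= #|Y2| + 1.
    have [c1|c1] := eqVneq #|children rho| 1.
      rewrite -c1; apply: leq_trans (subset_leq_card _) (leq_card_setU Y2 (children rho)).1.
      by apply/subsetP=> y; rewrite !inE => /andP[-> /orP[->|->]]; rewrite ?orbT.
    apply: leq_trans (leq_addr _ _); apply/subset_leq_card/subsetP=> y; rewrite !inE.
    by move=> /andP[-> /orP[->|/eqP ->]].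
  move: sumE cY2 Y12 T0; move: (\sum_x _) #|Y| #|Y2| #|T| #|leaves| => ? ? ? ? ?; lia.
pose q z a := (0 < a) && ((#|children (iter a par z)| != 1) || (depth z == a)).
pose fa z := find (q z) (iota 0 K.+1).
pose g z : T * 'I_K.+1 := (iter (fa z).-1 par z, inord (fa z)).
pose bad := ~: bare_ends K :\ rho.
have badP z : z \in bad -> [/\ fa z < K.+1, q z (fa z), fa z <= depth z &
    forall b, 0 < b < fa z -> #|children (iter b par z)| = 1].
  rewrite !inE => /andP[zr zb].
  have z0 : 0 < depth z by rewrite lt0n depth0.
  have hq : has (q z) (iota 0 K.+1).
    apply/hasP; move: zb; rewrite negb_and -ltnNge => /orP[dK|].
      by exists (depth z); rewrite ?mem_iota /q ?eqxx ?orbT ?andbT //; lia.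
    rewrite negb_forall => /existsP[a]; rewrite negb_imply => /andP[a0 ca].
    by exists (a : nat); rewrite ?mem_iota /q ?a0 ?ca //= add0n.
  have lt := hq; rewrite has_find size_iota -/(fa z) in lt.
  have before b : b < fa z -> q z b = false.
    move=> bf; have := @before_find _ 0 (q z) (iota 0 K.+1) b bf.
    by rewrite nth_iota // (ltn_trans bf).
  split=> //.
  - by have := nth_find 0 hq; rewrite nth_iota.
  - by rewrite leqNgt; apply/negP => /before; rewrite /q eqxx orbT andbT z0.
  move=> b /andP[b0 /before]; rewrite /q b0 /= => /negbT; rewrite negb_or negbK.
  by case/andP => /eqP.
have g_inj : {in bad &, injective g}.
  move=> z z' /badP[lz qz dz bz] /badP[lz' qz' dz' bz'] eg.
  have eqf : inord (fa z) = inord (fa z') :> 'I_K.+1 := congr1 snd eg.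
  have eqi : iter (fa z).-1 par z = iter (fa z').-1 par z' := congr1 fst eg.
  have ff : fa z = fa z' by rewrite -(inordK lz) eqf inordK.
  rewrite -ff in eqi dz' *; apply: unary_inj eqi; try by lia.
  by move=> b bf; apply: bz; move: qz => /andP[]; lia.
have gY : g @: bad \subset setX Y [set: 'I_K.+1].
  apply/subsetP=> _ /imsetP[z /badP[lz qz dz bz] ->].
  rewrite in_setX in_setT andbT; change (iter (fa z).-1 par z \in Y); rewrite inE.
  have f0 : 0 < fa z by case/andP: qz.
  rewrite iter_neq_root; last by apply: leq_trans dz; rewrite prednK.
  rewrite -iterS prednK //; move: qz; rewrite /q f0 andTb => /orP[->//|/eqP dE].
  by rewrite -depth0 depth_iter dE subnn eqxx orbT.
have cbad : #|bad| <= 2 * #|leaves| * K.+1.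
  rewrite -(card_in_imset g_inj); apply: leq_trans (subset_leq_card gY) _.
  by rewrite cardsX cardsT card_ord leq_mul2r cY orbT.
rewrite -(cardsC (bare_ends K)) leq_add2l (cardsD1 rho) -/bad.
apply: (@leq_trans (1 + #|bad|)); first by rewrite leq_add2r leq_b1.
by rewrite add1n ltnS.
Qed.

End RootedTree.

(** * Embedding a tree with prescribed images for some vertices *)

Section EmbedForest.

Variables (V : finType) (e : rel V).
Hypothesis e_sym : symmetric e.
Variables (S0 : {set V}) (D m d t : nat).
Hypotheses (m_gt0 : 0 < m) (e_joined : joined e m) (d_gt0 : 0 < d) (dD : d <= D).
Hypothesis mt : m <= d ^ t.

Variables (T : finType) (eT : rel T) (rho : T) (par : T -> T) (depth : T -> nat).
Hypotheses (eT_sym : symmetric eT) (rt : rooted_tree eT rho par depth).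

Let ell := t.+1.*2.+1.

Variables (Delta : nat) (R C Xt : {set T}) (q : T -> V).
Hypothesis eT_deg : forall x, #|[set y | eT x y]| <= Delta.
Hypothesis DeltaD : ell + Delta < D.
Hypotheses (rhoR : rho \in R) (CR : C \subset R) (RXt : R \subset Xt).
Hypotheses (q_inj : {in R &, injective q}) (qS0 : {in R, forall x, q x \in S0}).
Hypothesis Xt_closed : {in Xt :\: R, forall x, par x \in Xt}.
Hypothesis C_depth : {in C, forall p, ell <= depth p}.
Hypothesis C_chain : {in C, forall p a, 0 < a < ell -> iter a par p \in Xt :\: R}.
Hypothesis C_disj : {in C &, forall p p' a a', 0 < a < ell -> 0 < a' < ell ->
  iter a par p = iter a' par p' -> p = p'}.
Hypothesis enough : room V D m (#|S0| + #|Xt :\: R| + 2 * \sum_(i < t.+1) d ^ i).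

Let xt := ext e S0 D m.
Let us := used S0.

(** [R] are the vertices with images fixed in advance. A vertex [p] of [C] must moreover be reached
    from above: the vertices strictly between [p] and its [ell]-th ancestor are embedded all at
    once, as a connecting path that ends in [q p]. For the other vertices of [R] no edge to the
    parent is required. The term [ell] in [part_kids] allows for the children that a vertex on such
    a path has along the path. *)
Record partial (X : {set T}) (phi : T -> V) (pi : V -> option V) : Prop := Partial {
  part_R : R \subset X;
  part_Xt : X \subset Xt;
  part_inj : {in X &, injective phi};
  part_q : {in R, phi =1 q};
  part_ext : xt pi;
  part_used : us pi = S0 :|: phi @: (X :\: R);
  part_card : #|us pi| = #|S0| + #|X :\: R|;
  part_edge : {in X :\: R, forall x, par x \in X /\ e (phi (par x)) (phi x)};
  part_chain : {in C, forall p a, 0 < a < ell -> iter a par p \in X ->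
    (forall b, 0 < b < ell -> iter b par p \in X) /\ e (phi (par p)) (phi p)};
  part_kids : {in X, forall x, nkids pi (phi x) <= ell + #|[set y in X | eT x y]|};
  part_kids0 : forall g, g \notin phi @: X -> nkids pi g = 0 }.

Lemma partial_used X phi pi x : partial X phi pi -> x \in X -> phi x \in us pi.
Proof.
move=> P xX; rewrite (part_used P) inE; have [xR|xR] := boolP (x \in R).
  by rewrite (part_q P) // qS0.
by rewrite imset_f ?orbT // inE xR.
Qed.

(** The bookkeeping common to both kinds of extension: [A] is a single vertex or the interior of a
    chain. *)
Lemma partial_grow (X : {set T}) phi pi (A : {set T}) phi' pi' :
  partial X phi pi -> A \subset Xt -> [disjoint A & X] -> {in X, phi' =1 phi} ->
  {in A &, injective phi'} -> {in A, forall x, phi' x \notin us pi} ->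
  xt pi' -> us pi' = us pi :|: phi' @: A ->
  {in A, forall x, par x \in X :|: A /\ e (phi' (par x)) (phi' x)} ->
  {in C, forall p a, 0 < a < ell -> iter a par p \in A ->
    (forall b, 0 < b < ell -> iter b par p \in X :|: A) /\ e (phi' (par p)) (phi' p)} ->
  {in X, forall x, nkids pi' (phi x) <= nkids pi (phi x) + #|[set y in A | eT x y]|} ->
  {in A, forall x, nkids pi' (phi' x) <= ell} ->
  {in us pi, forall g, g \notin phi @: X -> nkids pi' g <= nkids pi g} ->
  partial (X :|: A) phi' pi'.
Proof.
move=> P AXt dAX eX injA freshA xp' usE edgeA chainA kX kA k0.
have phiX : phi' @: X = phi @: X by apply: eq_in_imset.
have XA x : x \in X -> x \in X :|: A by rewrite inE => ->.
have AX x : x \in A -> x \in X = false by move=> xA; apply: (disjointFr dAX).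
have AR x : x \in A -> x \notin R.
  by move=> xA; apply: contraFN (AX _ xA); apply: (subsetP (part_R P)).
have XAR : (X :|: A) :\: R = (X :\: R) :|: A.
  apply/setP=> x; rewrite !inE; case: (boolP (x \in A)) => [/AR ->|_]; rewrite ?orbT ?orbF //.
have dXA : [disjoint X :\: R & A].
  by rewrite disjoint_sym; apply: disjointWr dAX; apply: subsetDl.
split.
- by apply: subset_trans (part_R P) _; apply: subsetUl.
- by rewrite subUset (part_Xt P).
- move=> x y; rewrite !inE => /orP[xX|xA] /orP[yX|yA].
  + by rewrite !eX //; apply: (part_inj P).
  + rewrite eX // => xy; have := freshA _ yA.
    by rewrite -xy (partial_used P).
  + rewrite (eX y) // => xy; have := freshA _ xA.
    by rewrite xy (partial_used P).
  + exact: injA.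
- by move=> x xR; rewrite eX ?(part_q P) // (subsetP (part_R P)).
- exact: xp'.
- rewrite usE (part_used P) XAR imsetU setUA; congr (_ :|: _ :|: _).
  by apply/esym/eq_in_imset => x; rewrite inE => /andP[_ xX]; rewrite eX.
- rewrite usE XAR [#|us pi :|: _|]cardsU [#|_ :|: A|]cardsU (part_card P) (disjoint_setI0 dXA) cards0 subn0.
  rewrite (_ : us pi :&: _ = set0) ?cards0 ?subn0; last first.
    apply/setP=> g; rewrite [LHS]inE in_set0; apply/negP => /andP[gu /imsetP[x xA gE]].
    by have := freshA _ xA; rewrite -gE gu.
  by rewrite card_in_imset // addnA.
- move=> x; rewrite XAR inE => /orP[xX|/edgeA //].
  have [px ex] := part_edge P xX; rewrite XA //; split=> //.
  by rewrite !eX //; move: xX; rewrite inE => /andP[].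
- move=> p pC a a0; rewrite inE => /orP[xX|xA]; last exact: (chainA _ pC a a0 xA).
  have [all_b ep] := part_chain P pC a0 xX; split=> [b b0|]; first by rewrite XA ?all_b.
  have p1X : par p \in X := all_b 1 isT.
  by rewrite !eX // ?(subsetP (part_R P)) ?(subsetP CR).
- move=> x; rewrite inE => /orP[xX|xA]; last by apply: leq_trans (kA _ xA) (leq_addr _ _).
  rewrite eX //; apply: leq_trans (kX _ xX) _.
  rewrite (_ : [set y in X :|: A | eT x y] = [set y in X | eT x y] :|: [set y in A | eT x y]).
    rewrite cardsU (_ : _ :&: _ = set0) ?cards0 ?subn0.
      by rewrite addnA leq_add2r (part_kids P).
    by apply/setP=> y; rewrite !inE; case: (boolP (y \in A)) => [/AX ->|]; rewrite ?andbF.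
  by apply/setP=> y; rewrite !inE andb_orl.
move=> g; rewrite imsetU phiX inE negb_or => /andP[gX gA].
have [gu|gu] := boolP (g \in us pi).
  by apply/eqP; rewrite -leqn0 -(part_kids0 P gX); apply: k0.
by apply: (nkids_unused xp'); rewrite -/(us pi') usE inE negb_or gu.
Qed.

Lemma partial_room X phi pi : partial X phi pi ->
  room V D m (#|us pi| + 2 * \sum_(i < t.+1) d ^ i).
Proof.
move=> P; apply: leq_ltn_trans enough; rewrite !leq_add2r (part_card P) leq_add2l.
by rewrite subset_leq_card // setSD // (part_Xt P).
Qed.

Lemma partial_kids_lt X phi pi x : partial X phi pi -> x \in X -> nkids pi (phi x) < D.
Proof.
move=> P xX; apply: leq_ltn_trans (part_kids P xX) _; apply: leq_ltn_trans DeltaD.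
rewrite leq_add2l; apply: leq_trans (eT_deg x); apply: subset_leq_card.
by apply/subsetP=> y; rewrite !inE => /andP[].
Qed.

Lemma eT_par x : x != rho -> eT x (par x).
Proof. by case: rt => _ _ _ pe _ /pe; rewrite eT_sym. Qed.

Lemma partial_add_vertex X phi pi x : partial X phi pi ->
  x \in Xt -> x \notin X -> par x \in X ->
  (forall p a, p \in C -> 0 < a < ell -> iter a par p != x) ->
  exists phi' pi', partial (X :|: [set x]) phi' pi'.
Proof.
move=> P xXt xX pX nC; have pu := partial_used P pX.
have xr : x != rho by apply: contraNneq xX => ->; apply: (subsetP (part_R P)).
have rm := partial_room P.
have [|y [yu yN ey xp']] := extend m_gt0 e_joined (part_ext P) pu (partial_kids_lt P pX).
  by apply: leq_ltn_trans rm; rewrite !leq_add2r leq_addr.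
pose phi' z := if z == x then y else phi z.
have phix : phi' x = y by rewrite /phi' eqxx.
have eX : {in X, phi' =1 phi}.
  by move=> z zX; rewrite /phi'; case: eqP => // zx; rewrite -zx zX in xX.
exists phi', (upd pi y (phi (par x))); apply: (partial_grow P) => //.
- by rewrite sub1set.
- by rewrite disjoints1.
- by move=> u v; rewrite !inE => /eqP -> /eqP ->.
- by move=> z; rewrite inE => /eqP ->; rewrite phix.
- by rewrite imset_set1 phix /us used_upd setUC.
- by move=> z; rewrite inE => /eqP ->; rewrite phix eX // !inE pX.
- by move=> p pC a a0; rewrite inE => /eqP xE; have := nC p a pC a0; rewrite xE eqxx.
- move=> z zX; rewrite nkids_upd // leq_add2l.
  case: eqP => // /(part_inj P pX zX) <-; apply/card_gt0P; exists x.
  by rewrite !inE eqxx eT_sym eT_par.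
- move=> z; rewrite inE => /eqP ->; rewrite phix nkids_upd // (nkids_unused (part_ext P)) //.
  by case: eqP.
move=> g gu gX; rewrite nkids_upd //; case: eqP => [gE|]; last by rewrite addn0.
by rewrite -gE imset_f in gX.
Qed.

Lemma partial_add_chain X phi pi p : partial X phi pi -> p \in C ->
  (forall a, 0 < a < ell -> iter a par p \notin X) -> iter ell par p \in X ->
  exists phi' pi', partial (X :|: [set iter (nat_of_ord a) par p | a in 'I_ell & 0 < a]) phi' pi'.
Proof.
move=> P pC new topX; set A := [set _ | _ in _ & _].
have pR : p \in R by apply: (subsetP CR).
have pX : p \in X by apply: (subsetP (part_R P)).
have dp := C_depth pC.
have ditera a : a <= ell -> depth (iter a par p) = depth p - a by rewrite (depth_iter rt).
have iter_inj a b : a <= ell -> b <= ell -> iter a par p = iter b par p -> a = b.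
  move=> al bl /(congr1 depth); rewrite !ditera // => eab.
  by rewrite -(subKn (leq_trans al dp)) eab subKn // (leq_trans bl dp).
have topp : iter ell par p != p.
  by apply/eqP => /(iter_inj ell 0 (leqnn _) isT).
have memA z : z \in A -> exists2 a, 0 < a < ell & z = iter a par p.
  case/imsetP=> a; rewrite inE => /andP[_ a0] ->; exists (a : nat) => //.
  by rewrite a0 ltn_ord.
have inA a : 0 < a < ell -> iter a par p \in A.
  case/andP=> a0 al; apply/imsetP; exists (Ordinal al) => //; rewrite inE //.
have dAX : [disjoint A & X].
  rewrite -setI_eq0; apply/eqP/setP=> z; rewrite !inE; apply/negP=> /andP[/memA[a a0 ->]].
  by apply/negP/new.
have tu := partial_used P topX; have pu := partial_used P pX.
have [||||pi' [s [xp' [ss us_ ps su] usE kE ks]]] :=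
    connect_pair e_sym m_gt0 e_joined d_gt0 dD mt (part_ext P) tu pu.
- by apply: contraNneq topp => /(part_inj P topX pX) ->.
- exact: partial_kids_lt P topX.
- exact: partial_kids_lt P pX.
- exact: partial_room P.
pose s' := phi (iter ell par p) :: rcons s (phi p).
have ss' : size s' = ell.+1 by rewrite /= size_rcons ss.
(* Along the chain the depth determines the position; [s'] runs downwards from the [ell]-th ancestor
   to [p]. *)
pose phi' z := if z \in A then nth (phi p) s' (ell - (depth p - depth z)) else phi z.
have eX : {in X, phi' =1 phi}.
  by move=> z zX; rewrite /phi' (disjointFl dAX zX).
have phiA a : a <= ell -> phi' (iter a par p) = nth (phi p) s' (ell - a).
  move=> al; have [a0|/andP aN] := boolP (0 < a < ell).
    by rewrite /phi' inA // ditera // subKn // (leq_trans al dp).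
  have [->|->] : a = 0 \/ a = ell.
      case: (posnP a) => [|a0]; [by left|right; apply/eqP].
      by rewrite eqn_leq al leqNgt; apply/negP => al'; case: aN.
    by rewrite subn0 /= nth_rcons ss ltnn eqxx eX.
  by rewrite subnn eX.
have phiAs a : 0 < a < ell -> phi' (iter a par p) = nth (phi p) s (ell - a).-1.
  case/andP=> a0 al; rewrite phiA ?(ltnW al) // /s' -[in LHS](@prednK (ell - a)) ?subn_gt0 //=.
  by rewrite nth_rcons ss ifT // -ltnS prednK ?subn_gt0 // -/ell ltn_subrL a0.
have phiAin z : z \in A -> phi' z \in s.
  case/memA=> a a0 ->; rewrite phiAs // mem_nth // ss; case/andP: a0 => a0 al.
  by rewrite -ltnS prednK ?subn_gt0 // -/ell ltn_subrL a0.
have edge a : a < ell -> e (phi' (iter a.+1 par p)) (phi' (iter a par p)).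
  move=> al; rewrite !phiA ?(ltnW al) //; have := pathP (phi p) ps.
  rewrite -(subnSK al); apply; rewrite size_rcons ss.
  by rewrite -/ell ltn_subrL.
have phiAimg : phi' @: A = [set z in s].
  apply/setP=> g; rewrite inE; apply/imsetP/idP => [[z zA ->]|gs]; first exact: phiAin.
  have := gs; rewrite -index_mem ss => il.
  have a0 : 0 < ell.-1 - index g s < ell.
    by move: il; rewrite /ell; move: t.+1.*2 (index g s) => k i; clear; lia.
  exists (iter (ell.-1 - index g s) par p); first exact: inA.
  rewrite phiAs // (_ : (ell - _).-1 = index g s) ?nth_index //.
  by move: il; rewrite /ell; move: t.+1.*2 (index g s) => k i; clear; lia.
have memXA a : 0 < a < ell -> iter a par p \in X :|: A.
  by move=> a0; rewrite inE inA ?orbT.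
have XN z : z \in A -> z \in X = false by move=> zA; apply: (disjointFr dAX).
exists phi', pi'; apply: (partial_grow P) => //.
- by apply/subsetP=> z /memA[a a0 ->]; have := C_chain pC a0; rewrite inE => /andP[].
- move=> x y /memA[a a0 ->] /memA[b b0 ->]; rewrite !phiAs // => /eqP.
  have lt c : 0 < c < ell -> (ell - c).-1 < size s.
    by rewrite ss /ell; move: t.+1.*2 => k; clear; lia.
  rewrite nth_uniq ?lt // => /eqP ab; congr iter.
  by move: a0 b0 ab; move: (ell) => l; clear; lia.
- by move=> x /phiAin /su.
- by rewrite phiAimg.
- move=> x /memA[a a0 ->]; split; last by rewrite -iterS edge; case/andP: a0.
  rewrite -iterS; have [al|al] := ltnP a.+1 ell; first by rewrite memXA.
  have -> : a.+1 = ell by apply/eqP; rewrite eqn_leq al; case/andP: a0 => _ ->.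
  by rewrite inE topX.
- move=> p' p'C a a0 /memA[b b0 eab]; have := C_disj p'C pC a0 b0 eab => ->.
  by split=> [b' /memXA //|]; apply: (edge 0).
- move=> x xX; apply: leq_trans (kE _ (partial_used P xX)) _; rewrite -addnA leq_add2l.
  case: eqP => [/(part_inj P topX xX) xE|_].
    rewrite -xE; case: eqP => [/(part_inj P pX topX) pE|_]; first by rewrite -pE eqxx in topp.
    rewrite addn0; apply/card_gt0P; exists (iter ell.-1 par p); rewrite inE inA; last by rewrite /ell doubleS /= ltnS.
    rewrite eT_sym; apply: (eT_par (x := iter ell.-1 par p)).
    rewrite -(depth0 rt) ditera ?leq_pred // -lt0n; move: dp; move: (ell) (depth p) (isT : 0 < ell) => l k; clear; lia.
  case: (eqVneq (phi p) (phi x)) => [/(part_inj P pX xX) xE|_] //.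
  rewrite -xE; apply/card_gt0P; exists (par p); rewrite inE (inA 1) //=.
  by rewrite eT_par // -(depth0 rt) -lt0n; apply: leq_trans dp.
- by move=> x /phiAin /ks le; apply: leq_trans le _; rewrite /ell.
move=> g gu gX; apply: leq_trans (kE _ gu) _.
have ng x : x \in X -> (phi x == g) = false.
  by move=> xX; apply: contraNF gX => /eqP <-; apply: imset_f.
by rewrite !ng // !addn0.
Qed.

(** A missing vertex of least depth has an embedded parent. Chains are embedded entirely or not at
    all, so if the vertex lies on the chain of some [p], it is the one just below the [ell]-th
    ancestor, and the whole chain can be added. *)
Lemma partial_extend X phi pi : partial X phi pi -> X != Xt ->
  exists X' phi' pi', partial X' phi' pi' /\ #|X| < #|X'|.
Proof.
move=> P XXt.
have [x0 x0D] : exists x, x \in Xt :\: X.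
  apply/set0Pn; apply: contraNneq XXt => /eqP; rewrite setD_eq0 => sub.
  by rewrite eqEsubset (part_Xt P).
have [x + xmin] := arg_minnP (P := mem (Xt :\: X)) depth x0D.
rewrite /= inE => /andP[xX xXt].
have xR : x \notin R by apply: contra xX; apply: (subsetP (part_R P)).
have xr : x != rho by apply: contraNneq xR => ->.
have pXt : par x \in Xt by rewrite Xt_closed // inE xR.
have pX : par x \in X.
  apply: contraT => pX; have := xmin (par x); rewrite /= inE pX pXt => /(_ isT).
  by rewrite (depth_par rt); have := depth0 rt x; rewrite (negbTE xr); case: (depth x) => // k _; rewrite ltnn.
have lt (A : {set T}) a : [disjoint A & X] -> a \in A -> #|X| < #|X :|: A|.
  move=> dA aA; rewrite cardsU setIC (disjoint_setI0 dA) cards0 subn0 -addn1 leq_add2l.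
  by apply/card_gt0P; exists a.
have [/existsP[p /andP[pC /existsP[a /andP[a0 /eqP xE]]]]|none] :=
    boolP [exists p, (p \in C) && [exists a : 'I_ell, (0 < a) && (iter a par p == x)]].
  have new b : 0 < b < ell -> iter b par p \notin X.
    move=> b0; apply: contra xX => bX; rewrite -xE.
    by have [all_b _] := part_chain P pC b0 bX; apply: all_b; rewrite a0 ltn_ord.
  have topX : iter ell par p \in X.
    have aE : (a : nat).+1 = ell.
      apply/eqP; rewrite eqn_leq ltn_ord leqNgt; apply/negP => al.
      by have := new a.+1 al; rewrite /= xE pX.
    by rewrite -aE /= xE.
  have [phi' [pi' P']] := partial_add_chain P pC new topX.
  do 3 eexists; split; first exact: P'.
  apply: (lt _ x); last by rewrite -xE; apply/imsetP; exists a => //; rewrite inE.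
  rewrite -setI_eq0; apply/eqP/setP=> z; rewrite [LHS]inE in_set0; apply/negP.
  case/andP=> /imsetP[b]; rewrite inE => /andP[_ b0] ->; apply/negP/new.
  by rewrite b0 ltn_ord.
have [p a pC /andP[a0 al]|phi' [pi' P']] := partial_add_vertex P xXt xX pX.
  apply: contra none => xE; apply/existsP; exists p.
  by rewrite pC; apply/existsP; exists (Ordinal al); rewrite a0.
do 3 eexists; split; first exact: P'.
by apply: (lt _ x); rewrite ?inE // disjoints1.
Qed.

Lemma partial_start : xt (fun=> None) -> partial R q (fun=> None).
Proof.
move=> x0; have dom0 : dom (fun _ : V => @None V) = set0 by apply/setP=> y; rewrite !inE.
have k0 g : nkids (fun _ : V => @None V) g = 0.
  by apply/eqP; rewrite cards_eq0; apply/eqP/setP=> y; rewrite !inE.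
split=> //.
- by rewrite setDv imset0 setU0 /us /used dom0 setU0.
- by rewrite setDv cards0 addn0 /us /used dom0 setU0.
- by move=> x; rewrite setDv inE.
- by move=> p pC a a0 aR; have := C_chain pC a0; rewrite inE aR.
- by move=> x _; rewrite k0.
Qed.

Lemma embed_forest : xt (fun=> None) -> exists phi pi, partial Xt phi pi.
Proof.
move=> x0.
suff main k : k <= #|Xt| -> exists X phi pi, partial X phi pi /\ k <= #|X|.
  have [X [phi [pi [P le]]]] := main _ (leqnn _).
  have XE : X = Xt by apply/eqP; rewrite eqEcard (part_Xt P).
  by exists phi, pi; rewrite -XE.
elim: k => [|k IH] kXt; first by do 3 eexists; split; first exact: partial_start.
have [X [phi [pi [P le]]]] := IH (ltnW kXt).
have [lt|ge] := ltnP k #|X|; first by exists X, phi, pi.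
have [|X' [phi' [pi' [P' lt]]]] := partial_extend P.
  by apply: contraTneq kXt => <-; rewrite -leqNgt.
by exists X', phi', pi'; split=> //; apply: leq_ltn_trans lt.
Qed.

End EmbedForest.

(** * Covering the remaining vertices *)

Section Matching.

Variables (V : finType) (e : rel V).
Hypothesis e_sym : symmetric e.
Variables (S0 : {set V}) (D m M : nat).
Hypotheses (M_le : M <= 2 * m) (e_joined : joined e M.+1).

(** Sets of at most [M] vertices expand inside [W], which the vertices fixed in advance avoid;
    larger ones are adjacent to nearly everything, and there the room suffices. *)
Lemma ext_start (W : {set V}) : [disjoint S0 & W] ->
  (forall Y : {set V}, #|Y| <= M -> D * #|Y| <= #|nbh e Y :&: W|) ->
  #|S0| + M.+1 + 2 * m * D <= #|V| -> ext e S0 D m (fun=> None).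
Proof.
move=> dSW exW rm; split=> // U Um.
have dom0 : dom (fun _ : V => @None V) = set0 by apply/setP=> y; rewrite !inE.
rewrite sum_nat_const nbs_outer_dom /used dom0 setU0 mulnC.
apply: leq_trans (leq_addr _ _).
have [UM|MU] := leqP #|U| M.
  apply: leq_trans (exW _ UM) _; apply/subset_leq_card/subsetP=> y.
  by rewrite !inE => /andP[-> yW]; rewrite (disjointFl dSW yW).
apply: (@leq_trans (2 * m * D)); first by rewrite mulnC leq_mul2r Um orbT.
have := joined_nbh e_joined MU.
have := cardsCs (nbh e U :\: S0); rewrite setCD => ->.
have [+ _] := leq_card_setU (~: nbh e U) S0.
move: rm; move: #|_ :|: _| #|~: _| #|S0| #|V| (2 * m * D) => a b c n k; clear; lia.
Qed.

(* Small sets on the [A] side are handled by extendability; for a large one the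
   few vertices it misses are matched inside [Q] to indices outside of it. *)
Lemma final_match (A : finType) (loc : A -> V) b (Q : {set V}) pi :
  ext e S0 D m pi -> (forall x, #|[set a | loc a == x]| <= b) ->
  (forall a, nkids pi (loc a) + b <= D) -> #|A| = #|~: used S0 pi| ->
  (forall x, x \in Q -> exists a, loc a = x) ->
  (forall Y : {set V}, #|Y| <= M -> #|Y| <= #|nbh e Y :&: Q|) ->
  exists2 h : A -> V, injective h & forall a, h a \notin used S0 pi /\ e (loc a) (h a).
Proof.
move=> xp fib kD cA Qloc exQ.
have [X|h h_inj hN] := hall (N := fun a => [set y | e (loc a) y & y \notin used S0 pi]); last first.
  by exists h => // a; have := hN a; rewrite inE => /andP[].
set PX := loc @: X.
have -> : nbs (fun a => [set y | e (loc a) y & y \notin used S0 pi]) X = nbh e PX :\: used S0 pi.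
  apply/setP=> y; rewrite inE; apply/bigcupP/andP => [[a aX]|[yu /bigcupP[_ /imsetP[a aX ->]]]].
    by rewrite inE => /andP[ay ->]; rewrite (mem_nbh _ ay) // imset_f.
  by rewrite inE => ay; exists a; rewrite // inE ay.
have [PM|MP] := leqP #|PX| M.
  have cX : #|X| <= b * #|PX|.
    rewrite -sum1_card (partition_big_imset loc) /= mulnC -sum_nat_const.
    apply: leq_sum => x _; apply: leq_trans (fib x); rewrite sum1_card subset_leq_card //.
    by apply/subsetP=> a; rewrite !inE unfold_in => /andP[_].
  have ck : #|kids pi PX| <= (D - b) * #|PX|.
    apply: card_kids_le => _ /imsetP[a _ ->].
    by have := kD a; rewrite /nkids; move: #|_| => k; clear; lia.
  have [->|/card_gt0P[a _]] := posnP #|X|; first by [].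
  have bD : b <= D by apply: leq_trans (kD a); apply: leq_addl.
  have xx : (D - b) * #|PX| + b * #|PX| <= #|nbh e PX :\: used S0 pi| + #|kids pi PX|.
    by rewrite -mulnDl subnK //; apply: extP xp (leq_trans PM M_le).
  apply: leq_trans cX _; rewrite -(leq_add2l ((D - b) * #|PX|)).
  by apply: leq_trans xx _; rewrite addnC leq_add2r.
set Y := ~: used S0 pi :\: nbh e PX.
have YM : #|Y| <= M.
  rewrite leqNgt; apply/negP => MY; have [x [y [xP yY xy]]] := e_joined MP MY.
  by move: yY; rewrite inE (mem_nbh xP xy).
have YX : #|Y| <= #|~: X|.
  apply: leq_trans (exQ _ YM) _; apply: leq_trans (leq_imset_card loc _).
  apply/subset_leq_card/subsetP=> x; rewrite inE => /andP[/bigcupP[y yY] + xQ].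
  rewrite inE => yx; have [a ax] := Qloc _ xQ; apply/imsetP; exists a => //.
  rewrite inE; apply/negP => aX; move: yY; rewrite inE => /andP[/negP ny _]; apply: ny.
  by apply: (mem_nbh (x := x)); [rewrite -ax imset_f | rewrite e_sym].
have := cardsC X; have := cardsID (nbh e PX) (~: used S0 pi).
rewrite -/Y -cA (_ : _ :&: _ = nbh e PX :\: used S0 pi); last by rewrite setIC -setDE.
move: YX; move: #|Y| #|_ :\: _| #|X| #|~: X| #|A| => *; lia.
Qed.

End Matching.

(** * Trees with many leaves *)

Lemma subset_of_card (T : finType) (A : {set T}) k : k <= #|A| ->
  exists2 B : {set T}, B \subset A & #|B| = k.
Proof.
move=> kA; exists [set x in take k (enum A)].
  by apply/subsetP=> x; rewrite inE => /mem_take; rewrite mem_enum.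
rewrite cardsE (card_uniqP _) ?take_uniq ?enum_uniq // size_take -cardE.
by move: kA; case: ltngtP.
Qed.

Lemma between_of_card (T : finType) (A B : {set T}) k : A \subset B -> #|A| <= k <= #|B| ->
  exists C : {set T}, [/\ A \subset C, C \subset B & #|C| = k].
Proof.
move=> AB /andP[Ak kB].
have [|C CB cC] := @subset_of_card _ (B :\: A) (k - #|A|).
  by rewrite cardsD (setIidPr AB); move: #|A| #|B| Ak kB => a b; clear; lia.
exists (A :|: C); split; first exact: subsetUl.
  by rewrite subUset AB (subset_trans CB) // subsetDl.
rewrite cardsU (_ : A :&: C = set0) ?cards0 ?subn0 ?cC ?subnKC //.
by apply/setP=> x; rewrite !inE; apply/negP=> /andP[xA /(subsetP CB)]; rewrite inE xA.
Qed.

Lemma bijection_of_card (T V : finType) (P : {set T}) (Q : {set V}) (v0 : V) : #|P| = #|Q| ->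
  exists2 q : T -> V, {in P &, injective q} & q @: P = Q.
Proof.
move=> PQ; pose q x := nth v0 (enum Q) (index x (enum P)).
have lt x : x \in P -> index x (enum P) < size (enum Q).
  by move=> xP; rewrite -cardE -PQ cardE index_mem mem_enum.
have inj : {in P &, injective q}.
  move=> x y xP yP /eqP; rewrite nth_uniq ?enum_uniq ?lt // => /eqP /(congr1 (nth x (enum P))).
  by rewrite !nth_index ?mem_enum.
exists q => //; apply/eqP; rewrite eqEcard card_in_imset // PQ leqnn andbT.
by apply/subsetP=> _ /imsetP[x xP ->]; rewrite -mem_enum mem_nth ?lt.
Qed.

Section ManyLeaves.

Variables (V : finType) (e : rel V).
Hypothesis e_sym : symmetric e.
Variables (D m M d t : nat).
Hypotheses (m_gt0 : 0 < m) (M_le : M < m) (e_joined : joined e M.+1).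
Hypotheses (d_gt0 : 0 < d) (dD : d <= D) (mt : m <= d ^ t).
Variables (Q W : {set V}).
Hypotheses (QW : [disjoint Q & W]) (cQW : #|Q| + #|W| < #|V|).
Hypothesis exQ : forall Y : {set V}, #|Y| <= M -> #|Y| <= #|nbh e Y :&: Q|.
Hypothesis exW : forall Y : {set V}, #|Y| <= M -> D * #|Y| <= #|nbh e Y :&: W|.

Variables (T : finType) (eT : rel T) (rho : T) (par : T -> T) (depth : T -> nat).
Hypotheses (eT_sym : symmetric eT) (rt : rooted_tree eT rho par depth).
Variable Delta : nat.
Hypothesis eT_deg : forall x, #|[set y | eT x y]| <= Delta.
Hypotheses (cTV : #|T| = #|V|) (T_gt1 : 1 < #|T|) (Delta_gt0 : 0 < Delta).

Let ell := t.+1.*2.+1.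
Let L := leaves rho par.

Hypothesis DeltaD : ell + Delta + Delta < D.
Hypothesis start_room : #|Q|.+1 + M.+1 + 2 * m * D <= #|V|.
Hypothesis L_room : 2 * (\sum_(i < t.+1) d ^ i) + m + 2 * m * D < #|L|.
Hypothesis L_large : Delta * (ell.+1 * Delta ^ ell * #|Q|.+1) <= #|L|.

Lemma card_ch_le x : #|children rho par x| <= Delta.
Proof.
apply: leq_trans (eT_deg x); apply/subset_leq_card/subsetP=> y; rewrite !inE.
by case/andP=> yr /eqP <-; case: rt => _ _ _ + _; apply.
Qed.

Lemma par_notin_leaves x : x != rho -> par x \notin L.
Proof. by move=> xr; rewrite inE; apply/set0Pn; exists x; rewrite mem_ch_par. Qed.

Lemma root_notin_leaves : rho \notin L.
Proof.
rewrite inE; apply: contraL T_gt1 => /eqP ch0; rewrite -leqNgt.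
have only x : x = rho.
  apply/eqP; apply: contraT => xr.
  have [k] := ubnP (depth x); elim: k x xr => // k IH x xr.
  rewrite ltnS => dk; have [pr|pr] := eqVneq (par x) rho.
    by have := mem_ch_par par xr; rewrite pr ch0 inE.
  apply: IH pr _; apply: leq_trans dk; rewrite (depth_par rt).
  by have := depth0 rt x; rewrite (negbTE xr); case: (depth x).
by rewrite -cardsT -(cards1 rho) subset_leq_card //; apply/subsetP=> x _; rewrite inE (only x).
Qed.

(** Passing from leaves to parents loses a factor [Delta], and at most [Delta ^ ell] vertices share
    their [ell]-th ancestor, so disjoint chains cost another [ell.+1 * Delta ^ ell]. The additional
    1 in [#|Q|.+1] of [L_large] pays for the parents too close to the root. *)
Lemma far_parents : exists P1 : {set T}, [/\ #|P1| = #|Q|,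
  {in P1, forall p, ell <= depth p /\ exists2 l, l \in L & par l = p} &
  {in P1 &, forall z z' a a', a <= ell -> a' <= ell ->
      iter a par z = iter a' par z' -> z = z' /\ a = a'}].
Proof.
pose P := par @: L; pose Z := [set p in P | ell <= depth p].
have [z|x|Z1 [Z1Z cZ disj]] := @spread_chains _ _ _ _ _ rt Z ell (Delta ^ ell).
- by rewrite inE => /andP[].
- apply: leq_trans (card_descendants rt ell x card_ch_le); apply/subset_leq_card/subsetP=> z.
  by rewrite !inE => /andP[/andP[_ ->] ->].
have cL : #|L| <= Delta * #|P|.
  rewrite -sum1_card (partition_big_imset par) /= mulnC -sum_nat_const.
  apply: leq_sum => x _; apply: leq_trans (card_ch_le x); rewrite sum1_card subset_leq_card //.
  apply/subsetP=> z; rewrite unfold_in => /andP[zL zx]; rewrite inE zx andbT.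
  by apply: contraTneq zL => ->; apply: root_notin_leaves.
have cP : #|P| <= #|Z| + ell * Delta ^ ell.
  rewrite -(cardsID [set p | ell <= depth p] P) -setIdE leq_add2l.
  rewrite -[ell in ell * _]card_ord -sum_nat_const.
  apply: (@leq_trans (\sum_(a < ell) #|[set z | (a <= depth z) && (iter a par z == rho)]|)).
    apply: (@leq_trans #|\bigcup_(a < ell) [set z | (a <= depth z) && (iter a par z == rho)]|).
      apply/subset_leq_card/subsetP=> z; rewrite !inE -ltnNge => /andP[dz _].
      apply/bigcupP; exists (Ordinal dz) => //; rewrite inE leqnn /=.
      by rewrite -(depth0 rt) (depth_iter rt) subnn.
    elim/big_rec2: _ => [|a n A _ le]; first by rewrite cards0.
    by apply: leq_trans (leq_card_setU _ _).1 _; rewrite leq_add2l.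
  apply: leq_sum => a _; apply: leq_trans (card_descendants rt a rho card_ch_le) _.
  by rewrite leq_pexp2l // ltnW.
have QZ : #|Q| <= #|Z1|.
  rewrite -ltnS ltnNge; apply/negP => lt.
  have F0 : 0 < Delta ^ ell by rewrite expn_gt0 Delta_gt0.
  have : Delta * (ell.+1 * Delta ^ ell * #|Q|.+1) <= Delta * (ell.+1 * Delta ^ ell * #|Z1| + ell * Delta ^ ell).
    apply: leq_trans L_large _; apply: leq_trans cL _; rewrite leq_mul2l; apply/orP; right.
    by apply: leq_trans cP _; rewrite leq_add2r.
  rewrite leq_pmul2l // => h.
  have : ell.+1 * Delta ^ ell * #|Z1|.+1 <= ell.+1 * Delta ^ ell * #|Z1| + ell * Delta ^ ell.
    by apply: leq_trans h; rewrite leq_mul2l ltnS (ltnW lt) orbT.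
  rewrite mulnS addnC leq_add2l mulSn -[X in _ <= X]add0n leq_add2r leqNgt F0 //.
have [P1 P1Z cP1] := subset_of_card QZ.
have sub p : p \in P1 -> p \in Z by move=> /(subsetP P1Z)/(subsetP Z1Z).
exists P1; split=> // [p /sub|z z' zP z'P a a'].
  by rewrite inE => /andP[/imsetP[l lL ->] ->]; split=> //; exists l.
by apply: disj; apply: (subsetP P1Z).
Qed.

Lemma many_leaves_embed :
  exists2 f : T -> V, injective f & forall x y, eT x y -> e (f x) (f y).
Proof.
have [P1 [cP1 P1P P1d]] := far_parents.
have rP1 : rho \notin P1.
  by apply/negP => /P1P[+ _]; case: rt => _ -> _ _ _.
(* The root has to be placed in advance too, away from [Q] and [W], so that [S0] remains disjoint
   from [W]. *)
have [v0 v0Q v0W] : exists2 v0, v0 \notin Q & v0 \notin W.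
  have /set0Pn[v] : ~: (Q :|: W) != set0.
    rewrite -card_gt0 cardsCs setCK subn_gt0; apply: leq_ltn_trans cQW.
    exact: (leq_card_setU _ _).1.
  by rewrite !inE negb_or => /andP[? ?]; exists v.
have [q0 q0i q0Q] := bijection_of_card v0 cP1.
pose q x := if x == rho then v0 else q0 x.
have qP x : x \in P1 -> q x = q0 x by rewrite /q; case: eqP => // ->; rewrite (negbTE rP1).
pose R := rho |: P1; pose S0 := q @: R.
have qi : {in R &, injective q}.
  move=> x y; rewrite !inE => /orP[/eqP->|xP] /orP[/eqP->|yP] //; rewrite ?(qP x) ?(qP y) //.
  - by rewrite /q eqxx => E; have := v0Q; rewrite E -q0Q imset_f.
  - by rewrite /q eqxx => E; have := v0Q; rewrite -E -q0Q imset_f.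
  exact: q0i.
have S0W : [disjoint S0 & W].
  rewrite disjoint_sym disjoints_subset; apply/subsetP=> w wW; rewrite inE; apply/negP.
  case/imsetP=> x; rewrite !inE => /orP[/eqP->|xP].
    by rewrite /q eqxx => E; rewrite -E wW in v0W.
  rewrite qP // => E; have := disjointFl QW wW; rewrite E -q0Q imset_f //.
have cR : #|R| = #|Q|.+1 by rewrite /R cardsU1 rP1 cP1.
have cS0 : #|S0| = #|R| by apply: card_in_imset.
have jm : joined e m by move=> X Y mX mY; apply: e_joined; apply: leq_trans M_le _.
have start : ext e S0 D m (fun=> None).
  apply: (ext_start (M := M)) S0W exW _ => //; rewrite cS0 cR; exact: start_room.
pose Xt := ~: L.
have RXt : R \subset Xt.
  apply/subsetP=> x; rewrite !inE -/L => /orP[/eqP->|/P1P[dp [l lL <-]]].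
    by have := root_notin_leaves; rewrite inE.
  have lr : l != rho by apply: contraTneq lL => ->; apply: root_notin_leaves.
  by have := par_notin_leaves lr; rewrite inE.
have par_Xt x : x != rho -> par x \in Xt by move=> xr; rewrite inE par_notin_leaves.
have iter_Xt p a : p \in P1 -> 0 < a <= ell -> iter a par p \in Xt.
  move=> /P1P[dp _]; case: a => //= a al; apply: par_Xt.
  by apply: (iter_neq_root rt); apply: leq_trans dp.
have cXt : #|S0| + #|Xt :\: R| = #|T| - #|L|.
  by rewrite cS0 cardsD (setIidPr RXt) subnKC ?subset_leq_card // cardsCs setCK.
have LT : #|L| <= #|T| := max_card _.
have [|||||||||phi [pi P]] := @embed_forest V e e_sym S0 D m d t m_gt0 jm d_gt0 dD mt
    T eT rho par depth eT_sym rt Delta R P1 Xt q eT_deg _ _ _ RXt qi _ _ _ _ _ _ start.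
- by apply: leq_ltn_trans DeltaD; apply: leq_addr.
- by rewrite setU11.
- exact: subsetUr.
- by move=> x xR; apply: imset_f.
- move=> x; rewrite inE => /andP[xR _]; apply: par_Xt; apply: contraNneq xR => ->.
  by rewrite setU11.
- by move=> p /P1P[].
- move=> p pP a /andP[a0 al]; rewrite inE iter_Xt ?a0 ?(ltnW al) // andbT !inE negb_or.
  have [dp _] := P1P _ pP; rewrite (iter_neq_root rt) ?(leq_trans al dp) //=.
  apply/negP => aP; have [_ E] := P1d _ _ pP aP a 0 (ltnW al) isT erefl.
  by rewrite E in a0.
- by move=> p p' pP p'P a a' /andP[_ al] /andP[_ al'] E;
    have [] := P1d _ _ pP p'P a a' (ltnW al) (ltnW al') E.
- rewrite /room cXt -cTV; move: L_room LT; move: (2 * _) (2 * m * D) #|L| #|T| => a b c n; clear; lia.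
have cA : #|{: {x | x \in L}}| = #|~: used S0 pi|.
  by rewrite card_sig cardsCs setCK (part_card P) cXt -cTV subKn //; apply: eq_card.
pose loc (a : {x | x \in L}) := phi (par (val a)).
have aNr (a : {x | x \in L}) : val a != rho.
  by apply: contraTneq (valP a) => ->; apply: root_notin_leaves.
have pXt (a : {x | x \in L}) : par (val a) \in Xt by apply: par_Xt; apply: aNr.
(* Up to [Delta] leaves share a parent, which may already have [ell + Delta] children attached; this
   accounts for the second [Delta] in [DeltaD]. *)
have [|x|a|x xQ|h h_inj hP] := final_match (M := M) e_sym _ e_joined (loc := loc) (b := Delta) (Q := Q) (part_ext P) _ _ cA _ exQ.
- by apply: leq_trans (ltnW M_le) _; rewrite mul2n -addnn leq_addr.
- have [/existsP[a0 /eqP a0x]|none] := boolP [exists a, loc a == x].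
    apply: leq_trans (card_ch_le (par (val a0))); rewrite -(card_imset _ val_inj).
    apply/subset_leq_card/subsetP=> _ /imsetP[a + ->]; rewrite !inE -a0x (aNr a) => /eqP.
    by move/(part_inj P (pXt a) (pXt a0)) => ->; rewrite eqxx.
  rewrite eq_card0 // => a; rewrite inE.
  by apply: contraNF none => ax; apply/existsP; exists a.
- apply: leq_trans (ltnW DeltaD); rewrite leq_add2r; apply: leq_trans (part_kids P (pXt a)) _.
  rewrite leq_add2l; apply: leq_trans (eT_deg (par (val a))); apply/subset_leq_card/subsetP=> y.
  by rewrite !inE => /andP[].
- move: xQ; rewrite -q0Q => /imsetP[p pP ->]; have [_ [l lL lp]] := P1P _ pP.
  by exists (Sub l lL); rewrite /loc SubK lp (part_q P) ?qP // inE pP orbT.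
pose f x := if insub x is Some a then h a else phi x.
have fL (a : {x | x \in L}) : f (val a) = h a by rewrite /f valK.
have fX x : x \in Xt -> f x = phi x.
  by rewrite inE => xL; rewrite /f insubN.
have LX x : x \in Xt \/ exists a : {x | x \in L}, x = val a.
  by case: (boolP (x \in L)) => xL; [right; exists (Sub x xL); rewrite SubK | left; rewrite inE].
have us x : x \in Xt -> phi x \in used S0 pi.
  by apply: (partial_used _ P) => z zR; apply: imset_f.
have edge x : x != rho -> e (f (par x)) (f x).
  move=> xr; rewrite (fX (par x)) ?par_Xt //.
  case: (LX x) => [xX|[a ->]]; last by rewrite fL; case: (hP a).
  rewrite fX //; have [xR|xR] := boolP (x \in R); last first.
    by have xD : x \in Xt :\: R by [apply/setDP]; case: (part_edge P xD).
  have xP : x \in P1 by case/setU1P: xR => // xE; rewrite xE eqxx in xr.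
  by have [] := part_chain P xP (a := 1) isT (par_Xt _ xr).
exists f.
  move=> x y; case: (LX x) => [xX|[a ->]]; case: (LX y) => [yX|[b ->]]; rewrite ?fL ?fX //.
  - exact: (part_inj P).
  - by move=> E; have := us _ xX; rewrite E; case: (hP b) => /negbTE ->.
  - by move=> E; have := us _ yX; rewrite -E; case: (hP a) => /negbTE ->.
  - by move/h_inj => ->.
move=> x y xy; case: rt => _ _ _ _ /(_ x y xy)[] [zr <-]; last exact: edge.
by rewrite e_sym edge.
Qed.

End ManyLeaves.

(** * Gadgets realising a permutation network *)

Lemma uniq_flatten_map (J V : eqType) (P : J -> seq V) (js : seq J) :
  uniq (flatten [seq P j | j <- js]) ->
  {in js, forall j, uniq (P j)} /\
  {in js &, forall j j' x, x \in P j -> x \in P j' -> j = j'}.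
Proof.
elim: js => [|i js IH] //=; rewrite cat_uniq => /and3P[ui /hasPn dj /IH[ujs inj]].
split=> [j|j j']; rewrite ?inE => /predU1P[-> //|jJ]; first exact: ujs.
  move=> /predU1P[-> //|j'J] x xi xj.
  have fx : x \in flatten [seq P j | j <- js] by apply/flatten_mapP; exists j'.
  by have := dj _ fx; rewrite /= xi.
move=> /predU1P[->|j'J] x xj xi; last exact: (inj j j' jJ j'J x).
have fx : x \in flatten [seq P j | j <- js] by apply/flatten_mapP; exists j.
by have := dj _ fx; rewrite /= xi.
Qed.

Lemma size_flatten_const (J : eqType) (V : Type) (P : J -> seq V) (js : seq J) k :
  {in js, forall j, size (P j) = k} -> size (flatten [seq P j | j <- js]) = k * size js.
Proof.
elim: js => [|j js IH] sP /=; first by rewrite muln0.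
rewrite size_cat sP ?mem_head // IH ?mulnS // => i iJ.
by apply: sP; rewrite inE iJ orbT.
Qed.

Lemma count_ends (J V : eqType) (a b : J -> V) (js : seq J) x :
  count_mem x (flatten [seq [:: a j; b j] | j <- js]) =
  count (fun j => a j == x) js + count (fun j => b j == x) js.
Proof. by elim: js => //= j js ->; rewrite addnA addnACA. Qed.

Lemma count_enum_inj (J : finType) (V : eqType) (f : J -> V) x :
  injective f -> count (fun j => f j == x) (enum J) <= 1.
Proof.
move=> fi; rewrite -(count_map f (pred1 x)) count_uniq_mem ?leq_b1 //.
by rewrite map_inj_uniq ?enum_uniq.
Qed.

Lemma count_enum_le (X S : finType) (V : eqType) (f : X * S -> V) x :
  (forall s, injective (fun y => f (y, s))) ->
  count (fun j => f j == x) (enum {: X * S}) <= #|S|.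
Proof.
move=> fi; have -> : count (fun j => f j == x) (enum {: X * S}) = #|[set j | f j == x]|.
  by rewrite cardsE cardE -size_filter /enum_mem size_filter [in RHS]size_filter -enumT count_filter;
    apply: eq_count => j; rewrite /= andbT.
rewrite -(card_in_imset (f := snd)) ?max_card // => -[y s] [y' s'].
by rewrite !inE /= => /eqP fy /eqP fy' E; subst s'; congr (_, _); apply: (fi s); rewrite fy fy'.
Qed.

Section Gadgets.

Variables (V : finType) (e : rel V).
Hypothesis e_sym : symmetric e.
Variables (S0 : {set V}) (D m d t : nat).
Hypotheses (m_gt0 : 0 < m) (e_joined : joined e m) (d_gt0 : 0 < d) (dD : d <= D).
Hypothesis mt : m <= d ^ t.

Let k := t.+1.*2.

Variables (I : finType) (L : nat) (tau : nat -> I -> I) (z : nat -> I -> V).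
Hypothesis tau_inj : forall c, injective (tau c).
Hypothesis z_inj : forall c c' i i', c <= L -> c' <= L -> z c i = z c' i' -> c = c' /\ i = i'.

(** Two rails of [k] vertices start at [z c i], one to [z c.+1 i] and one to [z c.+1 (tau c i)];
    with [k] rungs of [k] vertices the ladder has [k * k.+2] vertices. As [k] is even, [s] selects
    the exit. A terminal starts at most two rails and, [tau c] being injective, ends at most two:
    this is the constant 4. *)
Lemma gadget_network pi0 : ext e S0 D m pi0 ->
  (forall c i, c <= L -> z c i \in used S0 pi0) ->
  (forall g, g \in used S0 pi0 -> nkids pi0 g + 4 <= D) -> k + 2 <= D ->
  room V D m (#|used S0 pi0| + L * #|I| * (k * k.+2) + 2 * \sum_(i < t.+1) d ^ i) ->
  exists pi2 (blk : nat -> I -> bool -> seq V), [/\ ext e S0 D m pi2,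
    #|used S0 pi2| = #|used S0 pi0| + L * #|I| * (k * k.+2) /\
    used S0 pi0 \subset used S0 pi2,
    (forall g, g \in used S0 pi2 -> g \in used S0 pi0 \/
       exists c i, c < L /\ forall s, g \in blk c i s),
    (forall c i s, c < L -> size (blk c i s) = k * k.+2 /\
       path e (z c i) (rcons (blk c i s) (z c.+1 (if s then i else tau c i)))) &
    forall g, g \in used S0 pi0 -> nkids pi2 g <= nkids pi0 g + 4].
Proof.
move=> xp0 zu kD0 kD rm.
have [L0|L_gt0] := posnP L.
  by exists pi0, (fun _ _ _ => [::]); split=> //; rewrite ?L0 ?mul0n ?addn0 // => g; [left|rewrite leq_addr].
pose J1 := ('I_L * I * bool)%type.
pose a1 (j : J1) := z j.1.1 j.1.2.
pose b1 (j : J1) := z j.1.1.+1 (if j.2 then j.1.2 else tau j.1.1 j.1.2).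
have a1_inj s : injective (fun y => a1 (y, s)).
  move=> [c i] [c' i'] /z_inj[]; try by rewrite ltnW.
  by move=> /= /val_inj -> ->.
have b1_inj s : injective (fun y => b1 (y, s)).
  move=> [c i] [c' i'] /z_inj[] //= [] /val_inj -> /=.
  by case: s => [->|/tau_inj ->].
have ends1 : {subset flatten [seq [:: a1 j; b1 j] | j <- enum {: J1}] <= used S0 pi0}.
  move=> x /flatten_mapP[[[c i] s] _]; rewrite !in_cons in_nil orbF => /orP[] /eqP ->; apply: zu => //=.
  exact: ltnW.
have cJ1 : size (enum {: J1}) = L * #|I| * 2.
  by rewrite -cardE !card_prod card_ord card_bool.
have cJ : L * #|I| * 2 * k + L * #|I| * k * k = L * #|I| * (k * k.+2).
  by rewrite -(addn2 k) !mulnDr addnC [k * 2]mulnC !mulnA.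
have [|||||pi1 [P [xp1 PP [uP Pu usE1] kE1 kP]]] :=
  connect_all e_sym m_gt0 e_joined d_gt0 dD (a := a1) (b := b1) (js := enum {: J1}) mt xp0.
- exact: enum_uniq.
- move=> [[c i] s] _; apply/eqP => /z_inj[] //=; first exact: ltnW.
  by move=> E; have := ltnn c; rewrite {2}E ltnSn.
- exact: ends1.
- move=> x /ends1 xu; apply: leq_trans (kD0 _ xu); rewrite leq_add2l count_ends.
  by apply: (@leq_add _ _ 2 2); rewrite -card_bool; apply: count_enum_le.
- apply: leq_ltn_trans rm; rewrite !leq_add2r leq_add2l cJ1 -cJ; exact: leq_addr.
have [uPj injP] := uniq_flatten_map uP.
have memJ1 (j : J1) : j \in enum {: J1} by rewrite mem_enum.
have sP j : size (P j) = k by case: (PP _ (memJ1 j)).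
have mem_P j g : g \in P j -> g \in flatten [seq P j | j <- enum {: J1}].
  by move=> gP; apply/flatten_mapP; exists j.
pose J2 := ('I_L * I * 'I_k)%type.
have L0 : 0 < #|V|. 
  by move: rm; rewrite /room; apply: leq_ltn_trans.
have [v0 _] := card_gt0P L0.
pose side s (j : J2) := nth v0 (P (j.1, s)) j.2.
have side_in s j : side s j \in P (j.1, s) by rewrite mem_nth // sP.
have side_inj s s' j j' : side s j = side s' j' -> s = s' /\ j = j'.
  move=> E; have := side_in s' j'; rewrite -E => in2.
  have := injP _ _ (memJ1 _) (memJ1 _) _ (side_in s j) in2.
  case: j j' E {in2} => [x r] [x' r'] /= E [ex es]; subst x' s'; split=> //; congr (_, _).
  apply/val_inj/eqP; move/eqP: E; rewrite /side /= nth_uniq ?sP //; exact: uPj.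
have side_u s j : side s j \in used S0 pi1.
  by rewrite usE1 in_setU [_ \in [set _ in _]]inE (mem_P _ _ (side_in s j)) orbT.
have ends2 x : x \in flatten [seq [:: side true j; side false j] | j <- enum {: J2}] ->
    exists s j, x = side s j.
  by case/flatten_mapP=> j _; rewrite !in_cons in_nil orbF => /orP[] /eqP ->; [exists true, j|exists false, j].
have cJ2 : size (enum {: J2}) = L * #|I| * k.
  by rewrite -cardE !card_prod !card_ord.
have c1 : #|used S0 pi1| = #|used S0 pi0| + L * #|I| * 2 * k.
  rewrite usE1 cardsU (_ : _ :&: _ = set0) ?cards0 ?subn0.
    congr (_ + _); rewrite cardsE (card_uniqP uP) (size_flatten_const (k := k)) ?cJ1 //.
    by rewrite mulnC.
  apply/setP=> x; rewrite in_setI in_set0 [x \in [set _ in _]]inE.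
  by apply/negP => /andP[xu /Pu]; rewrite xu.
have [|||||pi2 [G [xp2 GG [uG Gu usE2] kE2 kG]]] :=
  connect_all e_sym m_gt0 e_joined d_gt0 dD (a := side true) (b := side false) (js := enum {: J2}) mt xp1.
- exact: enum_uniq.
- by move=> j _; apply/eqP => /side_inj[].
- by move=> x /ends2[s [j ->]]; apply: side_u.
- move=> x /ends2[s [j ->]]; apply: leq_trans kD; apply: leq_add.
    by apply: kP; apply: mem_P (side_in s j).
  rewrite count_ends; apply: (@leq_add _ _ 1 1).
    by apply: count_enum_inj => j1 j2 /side_inj[].
  by apply: count_enum_inj => j1 j2 /side_inj[].
- by apply: leq_ltn_trans rm; rewrite !leq_add2r c1 -cJ addnA cJ2.
have memJ2 (j : J2) : j \in enum {: J2} by rewrite mem_enum.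
have sG j : size (G j) = k by case: (GG _ (memJ2 j)).
pose lad (y : 'I_L * I) := [seq (side true (y, r), side false (y, r), G (y, r)) | r <- enum 'I_k].
pose blk c i s := if insub c is Some o then zigzag s (lad (o, i)) else [::].
have blkE (o : 'I_L) i s : blk o i s = zigzag s (lad (o, i)) by rewrite /blk valK.
have slad y : size (lad y) = k by rewrite size_map -cardE card_ord.
have railE s y : [seq side s (y, r) | r <- enum 'I_k] = P (y, s).
  apply: (@eq_from_nth _ v0) => [|r]; rewrite size_map -cardE card_ord ?sP // => rk.
  rewrite (nth_map (Ordinal rk)) -?cardE ?card_ord // /side /=; congr nth.
  by rewrite -{2}[r]/(nat_of_ord (Ordinal rk)) nth_ord_enum.
have lad1 y : [seq u.1.1 | u <- lad y] = P (y, true) by rewrite -railE /lad -map_comp.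
have lad2 y : [seq u.1.2 | u <- lad y] = P (y, false) by rewrite -railE /lad -map_comp.
exists pi2, blk; split=> //.
- split.
    rewrite usE2 cardsU (_ : _ :&: _ = set0) ?cards0 ?subn0.
      rewrite c1 -cJ addnA; congr (_ + _).
      by rewrite cardsE (card_uniqP uG) (size_flatten_const (k := k)) ?cJ2 // mulnC.
    apply/setP=> x; rewrite in_setI in_set0 [x \in [set _ in _]]inE.
    by apply/negP => /andP[xu /Gu]; rewrite xu.
  by rewrite usE2 usE1 -setUA subsetUl.
- move=> g; rewrite usE2 usE1 !in_setU ![_ \in [set _ in _]]inE => /orP[/orP[gu|gP]|gG]; first by left.
    case/flatten_mapP: gP => -[[c i] s] _ gP; right; exists c, i; split=> // s'.
    rewrite blkE mem_zigzag; apply/hasP; move: gP; rewrite -railE => /mapP[r rk ->].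
    exists (side true (c, i, r), side false (c, i, r), G (c, i, r)); first by apply: map_f.
    by case: s; rewrite /= eqxx ?orbT.
  case/flatten_mapP: gG => -[[c i] r] _ gG; right; exists c, i; split=> // s'.
  rewrite blkE mem_zigzag; apply/hasP.
  exists (side true (c, i, r), side false (c, i, r), G (c, i, r)); first by apply: map_f; rewrite mem_enum.
  by rewrite /= gG !orbT.
- move=> c i s cL; rewrite -[c]/(nat_of_ord (Ordinal cL)) blkE; set o := Ordinal cL.
  have odd_k : odd k = false by rewrite odd_double.
  split.
    rewrite (@size_zigzag V s (lad (o, i)) k) ?slad; first by rewrite mulnC.
    by move=> u /mapP[r _ ->]; apply: sG.
  have [_ p1] := PP (o, i, true) (memJ1 _); have [_ p2] := PP (o, i, false) (memJ1 _).
  have pl u : u \in lad (o, i) -> path e u.1.1 (rcons u.2 u.1.2).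
    by move=> /mapP[r _ ->]; case: (GG (o, i, r) (memJ2 _)).
  have := @path_zigzag V e e_sym s (lad (o, i)) (z o i) (z o i) (z o.+1 i) (z o.+1 (tau o i)).
  by rewrite lad1 lad2 slad odd_k addbF if_same => /(_ p1 p2 pl); case: (s).
move=> g gu; have g1 : g \in used S0 pi1 by rewrite usE1 in_setU gu.
have g2 : g \notin flatten [seq [:: side true j; side false j] | j <- enum {: J2}].
  by apply/negP => /ends2[s [j gE]]; have := Pu _ (mem_P _ _ (side_in s j)); rewrite -gE gu.
apply: leq_trans (kE2 _ g1) _; rewrite (count_memPn g2) addn0.
apply: leq_trans (kE1 _ gu) _; rewrite leq_add2l count_ends.
by apply: (@leq_add _ _ 2 2); rewrite -card_bool; apply: count_enum_le.
Qed.

End Gadgets.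

(** The vertices fixed in advance: the entries [u i], the [L.+1] layers of terminals [z c i], and
    [v0] for the root. As [#|I|] will be a power of two, the reservoirs are only contained in the
    ranges of [u] and [z 0], which are filled up with further vertices. *)
Record placement (V I : finType) (L : nat) (Q1 Q2 W : {set V}) (u : I -> V)
    (z : nat -> I -> V) (v0 : V) (S : {set V}) : Prop := Placement {
  place_u : injective u;
  place_z : forall c c' i i', c <= L -> c' <= L -> z c i = z c' i' -> c = c' /\ i = i';
  place_uz : forall i c i', c <= L -> u i <> z c i';
  place_v0u : forall i, v0 <> u i;
  place_v0z : forall c i, c <= L -> v0 <> z c i;
  place_Q1 : forall x, x \in Q1 -> exists i, u i = x;
  place_Q2 : forall x, x \in Q2 -> exists i, z 0 i = x;
  place_S : forall g, g \in S <-> g = v0 \/ (exists i, g = u i) \/ exists c i, c <= L /\ g = z c i;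
  place_card : #|S| = (#|I| * L.+2).+1;
  place_W : [disjoint S & W] }.

Lemma placement_exists (V I : finType) (L : nat) (Q1 Q2 W : {set V}) :
  [disjoint Q1 & Q2] -> [disjoint Q1 & W] -> [disjoint Q2 & W] ->
  #|Q1| <= #|I| -> #|Q2| <= #|I| -> #|W| + #|Q2| + (#|I| * L.+2).+1 <= #|V| ->
  exists u z v0 S, @placement V I L Q1 Q2 W u z v0 S.
Proof.
move=> d12 d1 d2 c1 c2 cV.
have cC : #|W| + #|~: W| = #|V| by rewrite cardsC.
have sub_disj (A B : {set V}) : [disjoint A & B] -> A \subset ~: B by rewrite disjoints_subset.
have cD (A B : {set V}) : B \subset A -> #|A :\: B| = #|A| - #|B|.
  by move=> BA; rewrite cardsD (setIidPr BA).
have lI : (#|I| * L.+2).+1 = (#|I| * L).+1 + #|I| + #|I|.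
  by rewrite -addn2 mulnDr muln2 -addnn; move: (#|I| * L) #|I| => a b; clear; lia.
have [||U [QU UA cU]] := @between_of_card _ Q1 (~: W :\: Q2) #|I|.
- by rewrite subsetD sub_disj // d12.
- rewrite c1 cD ?sub_disj //; move: cC cV; rewrite lI.
  by move: #|W| #|~: W| #|Q2| #|V| (#|I| * L) #|I| => a b c x y f; clear; lia.
have UW : U \subset ~: W by apply: subset_trans UA _; apply: subsetDl.
have U2 : [disjoint Q2 & U].
  by rewrite disjoint_sym; move: UA; rewrite subsetD => /andP[].
have [||Z [QZ ZA cZ]] := @between_of_card _ Q2 (~: W :\: U) #|I|.
- by rewrite subsetD sub_disj.
- rewrite c2 cD // cU; move: cC cV; rewrite lI.
  by move: #|W| #|~: W| #|Q2| #|V| (#|I| * L) #|I| => a b c x y f; clear; lia.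
move: (ZA); rewrite subsetD => /andP[ZW ZU].
have UZW : U :|: Z \subset ~: W by rewrite subUset UW ZW.
have cUZ : #|U :|: Z| = #|I| + #|I|.
  by rewrite cardsU cU cZ setIC (disjoint_setI0 ZU) cards0 subn0.
have [|Y YA cY] := @subset_of_card _ (~: W :\: (U :|: Z)) (#|I| * L).+1.
  rewrite cD // cUZ; move: cC cV; rewrite lI.
  by move: #|W| #|~: W| #|Q2| #|V| (#|I| * L) #|I| => a b c x y f; clear; lia.
move: (YA); rewrite subsetD => /andP[YW YUZ].
have [x0 _] : exists x0, x0 \in Y by apply/card_gt0P; rewrite cY.
have [|u ui uU] := @bijection_of_card I V [set: I] U x0; first by rewrite cardsT.
have [|z0 z0i z0Z] := @bijection_of_card I V [set: I] Z x0; first by rewrite cardsT.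
have [|y yi yY] := @bijection_of_card (option ('I_L * I)) V setT Y x0.
  by rewrite cardsT card_option card_prod card_ord cY mulnC.
have {}yi : injective y by move=> a b; apply: yi; rewrite inE.
have {}ui : injective u by move=> a b; apply: ui; rewrite inE.
have {}z0i : injective z0 by move=> a b; apply: z0i; rewrite inE.
pose v0 := y None.
pose z c i := if c is c'.+1 then (if insub c' is Some o then y (Some (o, i)) else v0) else z0 i.
have uI i : u i \in U by rewrite -uU imset_f.
have z0I i : z0 i \in Z by rewrite -z0Z imset_f.
have yI o : y o \in Y by rewrite -yY imset_f.
have zE c i (cL : c < L) : z c.+1 i = y (Some (Ordinal cL, i)) by rewrite /z insubT.
have zY c i : 0 < c <= L -> z c i \in Y by case: c => [//|c /andP[_ cL]]; rewrite zE.
have YU g : g \in Y -> g \in U = false.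
  by move=> gY; have := disjointFr YUZ gY; rewrite inE => /norP[/negbTE].
have YZ g : g \in Y -> g \in Z = false.
  by move=> gY; have := disjointFr YUZ gY; rewrite inE => /norP[_ /negbTE].
have UZ g : g \in U -> g \in Z = false by move=> gU; apply: (disjointFl ZU).
exists u, z, v0, (U :|: Z :|: Y); split.
- exact: ui.
- move=> [|c] [|c'] i i' cL cL'.
  + by move/z0i => ->.
  + by move=> E; have := YZ _ (zY c'.+1 i' cL'); rewrite -E z0I.
  + by move=> E; have := YZ _ (zY c.+1 i cL); rewrite E z0I.
  + by rewrite !zE => /yi[-> ->].
- move=> i [|c] i' cL E; first by have := UZ _ (uI i); rewrite E z0I.
  by have := YU _ (zY c.+1 i' cL); rewrite -E uI.
- by move=> i E; have := YU _ (yI None); rewrite -/v0 E uI.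
- move=> [|c] i cL; first by move=> E; have := YZ _ (yI None); rewrite -/v0 E z0I.
  by rewrite zE => /yi.
- by move=> x /(subsetP QU); rewrite -uU => /imsetP[i _ ->]; exists i.
- by move=> x /(subsetP QZ); rewrite -z0Z => /imsetP[i _ ->]; exists i.
- move=> g; split.
    rewrite !inE => /orP[/orP[|]|].
    + by rewrite -uU => /imsetP[i _ ->]; right; left; exists i.
    + by rewrite -z0Z => /imsetP[i _ ->]; right; right; exists 0, i.
    rewrite -yY => /imsetP[[[o i]|] _ ->]; [right; right|by left].
    exists o.+1, i; rewrite ltn_ord; split=> //.
    by rewrite /z valK.
  case=> [->|[[i ->]|[[|c] [i [cL ->]]]]]; rewrite !inE ?yI ?uI ?z0I ?orbT //.
  by rewrite zY ?orbT.
- rewrite lI cardsU cUZ cY (_ : _ :&: Y = set0) ?cards0 ?subn0; last first.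
    by rewrite setIC; apply: disjoint_setI0.
  by rewrite [RHS]addnC addnA [RHS]addnC addnA addnC.
- by rewrite disjoints_subset !subUset UW ZW YW.
Qed.

(** * Routes through the network *)

Section Strands.

Variables (V I : finType) (e : rel V) (L : nat) (tau fs : nat -> I -> I).
Variables (z : nat -> I -> V) (blk : nat -> I -> bool -> seq V) (N : nat).
Hypothesis fs_switch : forall c, c < L -> switch (tau c) (fs c).
Hypothesis blkP : forall c i s, c < L -> size (blk c i s) = N /\
  path e (z c i) (rcons (blk c i s) (z c.+1 (if s then i else tau c i))).

(** Here [p] is the position reached after [c] levels; its ladder is crossed towards the same index
    exactly when level [c] leaves [p] fixed. *)
Definition segment (i : I) (c : nat) : seq V :=
  let p := run fs c i in z c p :: blk c p (run fs c.+1 i == p).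

Definition strand (i : I) (n : nat) : seq V := flatten [seq segment i c | c <- iota 0 n].

Lemma strandS i n : strand i n.+1 = strand i n ++ segment i n.
Proof. by rewrite /strand -addn1 iotaD map_cat flatten_cat /= cats0. Qed.

Lemma size_strand i n : n <= L -> size (strand i n) = n * N.+1.
Proof.
elim: n => // n IH nL; rewrite strandS size_cat IH ?(ltnW nL) //= (blkP _ _ nL).1.
by rewrite mulSn addnC.
Qed.

Lemma path_strand x i n : n <= L -> e x (z 0 i) ->
  path e x (rcons (strand i n) (z n (run fs n i))).
Proof.
move=> nL xi; elim: n nL => [|n IH] nL; first by rewrite /= xi.
rewrite strandS /segment rcons_cat /= -cat_rcons cat_path IH ?(ltnW nL) // last_rcons.
have [_] := blkP (run fs n i) (run fs n.+1 i == run fs n i) nL.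
set p := run fs n i; have rE : run fs n.+1 i = fs n p by [].
rewrite ?rE; have [_ /(_ p)] := fs_switch nL.
by case: eqP => [-> //|ne [E|-> //]]; case: ne.
Qed.

Lemma run_inj n : n <= L -> injective (run fs n).
Proof.
elim: n => [|n IH] nL; first by move=> x y.
by move=> x y; rewrite /run /= => /(fs_switch nL).1 /(IH (ltnW nL)).
Qed.

Lemma mem_strand i n g c : c < n -> g \in segment i c -> g \in strand i n.
Proof. by move=> cn gc; apply/flatten_mapP; exists c; rewrite // mem_iota. Qed.

End Strands.

(** * Trees with few leaves *)

(** The final map is shown to be surjective; injectivity then comes from counting, without comparing
    the various kinds of vertices pairwise. *)
Lemma surj_inj_card (T V : finType) (f : T -> V) :
  #|T| = #|V| -> (forall g, exists x, f x = g) -> injective f.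
Proof.
move=> cTV fs; have /imset_injP fi : #|f @: [set: T]| == #|[set: T]|.
  rewrite cardsT cTV -cardsT; apply/eqP; congr #|pred_of_set _|.
  by apply/setP=> g; rewrite !inE; have [x <-] := fs g; rewrite imset_f.
by move=> x y; apply: fi; rewrite inE.
Qed.

Section FewLeaves.

Variables (V : finType) (e : rel V).
Hypothesis e_sym : symmetric e.
Variables (D m M d t : nat).
Hypotheses (m_gt0 : 0 < m) (M_le : M < m) (e_joined : joined e M.+1).
Hypotheses (d_gt0 : 0 < d) (dD : d <= D) (mt : m <= d ^ t).
Variables (Q1 Q2 W : {set V}).
Hypotheses (Q12 : [disjoint Q1 & Q2]) (Q1W : [disjoint Q1 & W]) (Q2W : [disjoint Q2 & W]).
Hypothesis exQ1 : forall Y : {set V}, #|Y| <= M -> #|Y| <= #|nbh e Y :&: Q1|.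
Hypothesis exQ2 : forall Y : {set V}, #|Y| <= M -> #|Y| <= #|nbh e Y :&: Q2|.
Hypothesis exW : forall Y : {set V}, #|Y| <= M -> D * #|Y| <= #|nbh e Y :&: W|.

Variables (T : finType) (eT : rel T) (rho : T) (par : T -> T) (depth : T -> nat).
Hypotheses (eT_sym : symmetric eT) (rt : rooted_tree eT rho par depth).
Variables (Delta j : nat).
Hypothesis eT_deg : forall x, #|[set y | eT x y]| <= Delta.
Hypotheses (cTV : #|T| = #|V|).

(* A bare path has [K] edges: [ell] of them lead from its top to [u i], two pass
   through a remaining vertex to [z 0 i'], and each of the [L] levels of the
   network takes [N.+1], up to [z L i], the image of its lower end. *)
Let k := t.+1.*2.
Let ell := k.+1.
Let I := cube j.
Let L := j.*2.
Let N := k * k.+2.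
Let b := (L * N.+1).+2.
Let K := b + ell.

Hypothesis DeltaD : ell + Delta + k + 10 <= D.
Hypotheses (cQ1 : #|Q1| <= 2 ^ j) (cQ2 : #|Q2| <= 2 ^ j).
Hypothesis place_room : #|W| + #|Q2| + (2 ^ j * L.+2).+1 <= #|V|.
Hypothesis start_room : (2 ^ j * L.+2).+1 + M.+1 + 2 * m * D <= #|V|.
Hypothesis final_room : 2 * (\sum_(i < t.+1) d ^ i) + m + 2 * m * D < 2 ^ j.
Hypothesis few_leaves : K.+1 * 2 ^ j + (2 * #|leaves rho par| * K.+1).+1 <= #|T|.

(** By [unary_inj] different bare paths have different tops, so [spread_chains] applies with
    [mu = 1] and loses only the factor [K.+1]. *)
Lemma bare_path_ends : exists v : I -> T, [/\ forall i, K <= depth (v i),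
  forall i a x, a < K -> x != rho -> par x = iter a.+1 par (v i) -> x = iter a par (v i) &
  forall i i' a a', a <= K -> a' <= K -> iter a par (v i) = iter a' par (v i') -> i = i' /\ a = a'].
Proof.
pose Z := bare_ends rho par depth K.
have ZP z : z \in Z -> K <= depth z /\ forall a, 0 < a <= K -> #|children rho par (iter a par z)| = 1.
  rewrite inE => /andP[-> /forallP un]; split=> // a /andP[a0 aK].
  by have := un (Ordinal (aK : a < K.+1)); rewrite a0 => /eqP.
have [z /ZP[] //|x|Z1 [Z1Z cZ disj]] := @spread_chains _ _ _ _ _ rt Z K 1.
  apply/card_le1_eqP => z z' /setIdP[/ZP[dz uz] /eqP ez] /setIdP[/ZP[dz' uz'] /eqP ez'].
  by have := unary_inj rt dz dz' uz; rewrite ez ez' => /(_ erefl) ->.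
have hZ : #|I| <= #|Z1|.
  rewrite card_cube -(@leq_pmul2l K.+1) //; move: cZ; rewrite muln1; apply: leq_trans.
  have := card_bare_ends rt K; rewrite -/Z => h; have := leq_trans few_leaves h.
  by rewrite leq_add2r.
have [B BZ cB] := subset_of_card hZ.
have [|v vi vB] := @bijection_of_card I T [set: I] B rho; first by rewrite cardsT cB.
have vZ1 i : v i \in Z1 by apply: (subsetP BZ); rewrite -vB imset_f.
have vZ i : v i \in Z by apply: (subsetP Z1Z).
exists v; split=> [i|i a x aK xr px|i i' a a' aK aK' E].
- by case: (ZP _ (vZ i)).
- have [dz uz] := ZP _ (vZ i).
  have /eqP/cards1P[w chE] := uz a.+1 aK.
  have r : iter a par (v i) != rho by apply: (iter_neq_root rt); apply: leq_trans dz.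
  have := mem_ch_par par xr; have := mem_ch_par par r.
  by rewrite px -[par (iter a par _)]/(iter a.+1 par (v i)) chE !inE => /eqP -> /eqP.
have [vv aa] := disj _ _ (vZ1 i) (vZ1 i') a a' aK aK' E.
by split=> //; apply: vi; rewrite ?inE.
Qed.

(** The lower end [v i] is sent to [z L i], and [v' i], which lies [b] steps above it, to [u i]. The
    forest embedded by extension omits the vertices [Int] strictly between them; these are filled in
    by [full i] once the switches are set. *)
Lemma few_leaves_embed :
  exists2 f : T -> V, injective f & forall x y, eT x y -> e (f x) (f y).
Proof.
have [v [vdep vun vdisj]] := bare_path_ends.
have cI : #|I| = 2 ^ j := card_cube j.
have [u [z [v0 [S0 pl]]]] : exists u z v0 S, @placement V I L Q1 Q2 W u z v0 S.
  by apply: placement_exists; rewrite ?cI.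
have cS0 : #|S0| = (2 ^ j * L.+2).+1 by rewrite (place_card pl) cI.
have uS0 i : u i \in S0 by apply/(place_S pl); right; left; exists i.
have zS0 c i : c <= L -> z c i \in S0 by move=> cL; apply/(place_S pl); right; right; exists c, i.
have v0S0 : v0 \in S0 by apply/(place_S pl); left.
pose v' i := iter b par (v i).
have bK : b <= K by apply: leq_addr.
have v'E i a : iter a par (v' i) = iter (a + b) par (v i) by rewrite iterD.
have rho_chain i a : a < K -> iter a par (v i) != rho.
  by move=> aK; apply: (iter_neq_root rt); apply: leq_trans (vdep i).
have bltK : b < K by rewrite -addn1 leq_add2l.
pose Int := [set iter (ia.2 : 'I_b.-1).+1 par (v ia.1) | ia in setT].
have IntP x : reflect (exists i a, 0 < a < b /\ x = iter a par (v i)) (x \in Int).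
  apply: (iffP imsetP) => [[[i a] _ ->]|[i [[|a] [//= ab ->]]]].
    by exists i, a.+1; split=> //; apply: (ltn_ord a).
  by exists (i, Ordinal (ab : a < b.-1)).
pose Xt := ~: Int.
have chainX i a : a <= K -> (a == 0) || (b <= a) -> iter a par (v i) \in Xt.
  move=> aK ab; rewrite inE; apply/negP => /IntP[i' [a' [/andP[a0 ab'] E]]].
  have [_ aa] := vdisj _ _ _ _ aK (leq_trans (ltnW ab') bK) E.
  by move: ab; rewrite aa; move: a0 ab'; move: (b) => bb; clear; lia.
pose R := rho |: (v @: setT :|: v' @: setT).
pose C := v' @: setT.
pose q x := if x == rho then v0 else if [pick i | v i == x] is Some i then z L i
  else if [pick i | v' i == x] is Some i then u i else v0.
have q_rho : q rho = v0 by rewrite /q eqxx.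
have q_v i : q (v i) = z L i.
  rewrite /q (negbTE (rho_chain i 0 _)) //; case: pickP => [i' /eqP E|/(_ i)]; last by rewrite eqxx.
  by have [->] := vdisj i' i 0 0 isT isT E.
have q_v' i : q (v' i) = u i.
  rewrite /q (negbTE (rho_chain i b bltK)); case: pickP => [i' /eqP E|_].
    by have [] := vdisj i' i 0 b isT bK E.
  case: pickP => [i' /eqP E|/(_ i)]; last by rewrite eqxx.
  by have [->] := vdisj i' i b b bK bK E.
have RP x : x \in R -> [\/ x = rho, exists i, x = v i | exists i, x = v' i].
  rewrite !inE => /orP[/eqP ->|/orP[/imsetP[i _ ->]|/imsetP[i _ ->]]].
  - by constructor 1.
  - by constructor 2; exists i.
  - by constructor 3; exists i.
have vR i : v i \in R by rewrite !inE imset_f ?orbT.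
have v'R i : v' i \in R by rewrite !inE (imset_f v' (in_setT i)) !orbT.
have qi : {in R &, injective q}.
  move=> x y /RP[->|[i ->]|[i ->]] /RP[->|[i' ->]|[i' ->]]; rewrite ?q_rho ?q_v ?q_v' //.
  - by move/(place_v0z pl (leqnn L)).
  - by move/(place_v0u pl).
  - by move/esym/(place_v0z pl (leqnn L)).
  - by case/(place_z pl (leqnn L) (leqnn L)) => _ ->.
  - by move/esym/(place_uz pl (leqnn L)).
  - by move/esym/(place_v0u pl).
  - by move/(place_uz pl (leqnn L)).
  - by move/(place_u pl) => ->.
have jm : joined e m by move=> X Y mX mY; apply: e_joined; apply: leq_trans M_le _.
have start : ext e S0 D m (fun=> None).
  by apply: (ext_start (M := M)) (place_W pl) exW _ => //; rewrite cS0.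
have RXt : R \subset Xt.
  apply/subsetP=> x /RP[->|[i ->]|[i ->]].
  - rewrite inE; apply/negP=> /IntP[i [a [/andP[_ ab] E]]].
    by have := rho_chain i a (leq_trans ab bK); rewrite -E eqxx.
  - by apply: (chainX i 0).
  - by apply: chainX; rewrite ?leqnn ?orbT.
have bE : b.-1 = (L * N.+1).+1 by [].
have cInt : #|Int| = 2 ^ j * b.-1.
  rewrite card_imset ?cardsT ?card_prod ?card_ord ?cI // => -[i [a ab]] [i' [a' ab']] /= E.
  have lK c : c < b.-1 -> c.+1 <= K by move=> cb; apply: leq_trans bK; apply: leq_trans cb (leq_pred _).
  have [-> [aa]] := vdisj i i' a.+1 a'.+1 (lK _ ab) (lK _ ab') E.
  by congr (_, _); apply: val_inj.
have cR : #|R| = (2 ^ j + 2 ^ j).+1.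
  have vi : injective v by move=> i i' E; have [] := vdisj i i' 0 0 isT isT E.
  have v'i : injective v' by move=> i i' E; have [] := vdisj i i' b b bK bK E.
  rewrite cardsU1 cardsU !card_imset //.
  rewrite cardsT cI (_ : _ :&: _ = set0) ?cards0 ?subn0; last first.
    apply/setP=> x; rewrite !inE; apply/negP => /andP[/imsetP[i _ ->] /imsetP[i' _ E]].
    by have [] := vdisj i i' 0 b isT bK E.
  rewrite (_ : rho \notin _) //; rewrite inE negb_or; apply/andP; split; apply/imsetP => -[i _ E].
    by have := rho_chain i 0 isT; rewrite -E eqxx.
  by have := rho_chain i b bltK; rewrite /v' in E; rewrite -E eqxx.
have cXt : #|Xt :\: R| + 2 ^ j * b.-1 + (2 ^ j + 2 ^ j).+1 = #|T|.
  rewrite -cR -cInt -(cardsC Int) cardsD (setIidPr RXt) addnAC subnK ?subset_leq_card //.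
  exact: addnC.
(* Once forest and network are embedded, exactly [2 ^ j] vertices remain, one for each bare path;
   the length [b] is chosen to make this an equality. *)
have total : #|S0| + #|Xt :\: R| + L * 2 ^ j * N + 2 ^ j = #|T|.
  rewrite -cXt cS0 bE; move: #|_ :\: _| (2 ^ j) => x h; clear; nia.
have Xt_par x : x \in Xt -> x != rho -> par x \in Int -> exists i, x = v i.
  move=> xX xr /IntP[i [a [/andP[a0 ab] px]]].
  case: a a0 ab px => // a _ ab px.
  have xE := vun i a x (leq_trans (ltnW ab) bK) xr px.
  case: a xE ab {px} => [|a] xE ab; first by exists i.
  by case/setCP: xX; apply/IntP; exists i, a.+1; rewrite (ltnW ab).
have bb : 1 < b by [].
have [|||||||||phi [pi0 P]] := @embed_forest V e e_sym S0 D m d t m_gt0 jm d_gt0 dD mt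
    T eT rho par depth eT_sym rt Delta R C Xt q eT_deg _ _ _ RXt qi _ _ _ _ _ _ start.
- apply: leq_trans DeltaD; rewrite -/ell; move: (ell) => l; clear; lia.
- by rewrite setU11.
- by apply/subsetP=> x xC; rewrite !in_setU xC !orbT.
- by move=> x /RP[->|[i ->]|[i ->]]; rewrite ?q_rho ?q_v ?q_v' // zS0.
- move=> x; rewrite inE => /andP[xR xX]; rewrite inE; apply: contra xR => pI.
  have [->|xr] := eqVneq x rho; first by rewrite setU11.
  by have [i ->] := Xt_par x xX xr pI.
- by move=> _ /imsetP[i _ ->]; rewrite (depth_iter rt) leq_subRL ?(leq_trans bK) // vdep.
- move=> _ /imsetP[i _ ->] a /andP[a0 al]; rewrite v'E.
  have abK : a + b < K by rewrite addnC ltn_add2l.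
  rewrite inE chainX ?(ltnW abK) ?leq_addl ?orbT // andbT; apply/negP => /RP[E|[i' E]|[i' E]].
  + by have := rho_chain i _ abK; rewrite E eqxx.
  + have [_ /eqP] := vdisj i i' (a + b) 0 (ltnW abK) isT E.
    by rewrite addn_eq0 eqn0Ngt a0.
  + have [_] := vdisj i i' (a + b) b (ltnW abK) bK E.
    by move: a0; move: (b) => c; clear; lia.
- move=> _ _ /imsetP[i _ ->] /imsetP[i' _ ->] a a' /andP[_ al] /andP[_ al']; rewrite !v'E => E.
  have lK c : c < ell -> c + b <= K by move=> cl; rewrite addnC leq_add2l ltnW.
  by have [-> _] := vdisj i i' (a + b) (a' + b) (lK _ al) (lK _ al') E.
- rewrite /room -cTV -total; move: final_room.
  move: (#|S0| + #|_ :\: _|) (2 * _) (2 * m * D) (L * 2 ^ j * N) (2 ^ j) => x y w c h; clear; lia.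
have kids0 g : nkids pi0 g <= ell + Delta.
  have [/imsetP[x xX ->]|gX] := boolP (g \in phi @: Xt); last by rewrite (part_kids0 P gX).
  apply: leq_trans (part_kids P xX) _; rewrite leq_add2l; apply: leq_trans (eT_deg x).
  by apply/subset_leq_card/subsetP=> y; rewrite !inE => /andP[].
have S0u : S0 \subset used S0 pi0 by apply: subsetUl.
have [tau [tau_inj net]] := cube_network j.
have [||||pi2 [blk [xp2 [c2 u02] memU blkP k2]]] :=
    gadget_network e_sym m_gt0 jm d_gt0 dD mt tau_inj (place_z pl) (part_ext P).
- by move=> c i cL; apply: (subsetP S0u); apply: zS0.
- move=> g _; apply: leq_trans DeltaD; apply: (@leq_trans (ell + Delta + 4)).
    by rewrite leq_add2r kids0.
  by move: (ell + Delta) (k) => l c; clear; lia.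
- by apply: leq_trans DeltaD; rewrite -/k; move: (ell + Delta) (k) => l c; clear; lia.
- rewrite /room (part_card P) cI -/k -/N -cTV -total; move: final_room.
  move: (#|S0| + #|_ :\: _|) (2 * _) (2 * m * D) (L * 2 ^ j * N) (2 ^ j) => x y w c h; clear; lia.
have cA : #|I| = #|~: used S0 pi2|.
  rewrite cardsCs setCK c2 (part_card P) cI -cTV -total -/k -/N.
  by rewrite addKn.
have kids2 g : g \in S0 -> nkids pi2 g + 1 <= D.
  move=> gS; apply: leq_trans DeltaD; apply: (@leq_trans (ell + Delta + 4 + 1)).
    by rewrite leq_add2r; apply: leq_trans (k2 _ (subsetP S0u _ gS)) _; rewrite leq_add2r.
  by move: (ell + Delta) (k) => l c; clear; lia.
have M2 : M <= 2 * m by apply: leq_trans (ltnW M_le) _; rewrite mul2n -addnn leq_addr.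
have fib (g : I -> V) x : injective g -> #|[set a | g a == x]| <= 1.
  by move=> gi; apply/card_le1_eqP => a a'; rewrite !inE => /eqP <- /eqP /gi ->.
have z0_inj : injective (z 0) by move=> i i' /(place_z pl (leq0n L) (leq0n L))[].
have [hu hu_inj huP] := final_match e_sym M2 e_joined xp2 (fib u ^~ (place_u pl))
  (fun i => kids2 _ (uS0 i)) cA (place_Q1 pl) exQ1.
have [hz hz_inj hzP] := final_match e_sym M2 e_joined xp2 (fib (z 0) ^~ z0_inj)
  (fun i => kids2 _ (zS0 0 i (leq0n L))) cA (place_Q2 pl) exQ2.
have img (h : I -> V) : injective h -> (forall i, h i \notin used S0 pi2) ->
    forall g, g \notin used S0 pi2 -> exists i, h i = g.
  move=> hi hn g gn; have /setP/(_ g) : h @: setT = ~: used S0 pi2.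
    apply/eqP; rewrite eqEcard card_imset // cardsT cA leqnn andbT.
    by apply/subsetP=> _ /imsetP[i _ ->]; rewrite inE hn.
  by rewrite inE gn => /imsetP[i _ ->]; exists i.
have hu_surj := img _ hu_inj (fun i => (huP i).1).
have hz_surj := img _ hz_inj (fun i => (hzP i).1).
have ex i : exists i', hz i' == hu i.
  by have [i' E] := hz_surj (hu i) (huP i).1; exists i'; rewrite E.
pose sigma i := xchoose (ex i).
have sigmaP i : hz (sigma i) = hu i by apply/eqP/(xchooseP (ex i)).
have sigma_inj : injective sigma by move=> i i' E; apply: hu_inj; rewrite -!sigmaP E.
(* Path [i] reaches the network at [z 0 (sigma i)], the terminal matched to the same remaining
   vertex as [u i]. To leave it at [z L i], the network has to realise the inverse of [sigma]. *)
have [fs [fs_sw fs_run]] := net _ (can_inj (f_invF sigma_inj)).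
have runE i : run fs L (sigma i) = i by rewrite fs_run invF_f.
pose full i := hu i :: strand fs z blk (sigma i) L.
have sfull i : size (full i) = b.-1 by rewrite /= (size_strand fs blkP).
have pfull i : path e (u i) (rcons (full i) (z L i)).
  rewrite /= (huP i).2 -[in z L i](runE i); apply: (path_strand fs_sw blkP) => //.
  by rewrite -sigmaP e_sym; case: (hzP (sigma i)).
(* The index [a] counts upwards from [v i], whereas [full i] runs downwards from [u i]; hence the
   position [b.-1 - a]. *)
pose F x := if [pick ia : I * 'I_b | (0 < ia.2) && (iter ia.2 par (v ia.1) == x)] is Some ia
  then nth v0 (full ia.1) (b.-1 - ia.2) else phi x.
have FX x : x \in Xt -> F x = phi x.
  move=> xX; rewrite /F; case: pickP => // -[i a] /andP[a0 /eqP E].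
  by case/setCP: xX; apply/IntP; exists i, a; rewrite a0 ltn_ord.
have Fint i a : 0 < a < b -> F (iter a par (v i)) = nth v0 (full i) (b.-1 - a).
  case/andP=> a0 ab; rewrite /F; case: pickP => [[i' a'] /andP[a'0 /eqP E]|/(_ (i, Ordinal ab))].
    have [-> -> //] := vdisj i' i a' a (ltnW (leq_trans (ltn_ord a') bK)) (ltnW (leq_trans ab bK)) E.
  by rewrite /= a0 eqxx.
have phi_v i : phi (v i) = z L i by rewrite (part_q P) ?q_v.
have phi_v' i : phi (v' i) = u i by rewrite (part_q P) ?q_v'.
have Fpos i a : a <= b -> F (iter a par (v i)) = nth v0 (u i :: rcons (full i) (z L i)) (b - a).
  move=> ab; have [a0|/negP aN] := boolP (0 < a < b).
    rewrite Fint //; case/andP: a0 => a0 ab'; rewrite -[in RHS](@prednK (b - a)) ?subn_gt0 //=.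
    rewrite -rcons_cons nth_rcons sfull -subn1 -subnDA addnC subnDA subn1.
    by rewrite ltn_subrL a0.
  have [->|->] : a = 0 \/ a = b.
    case: (posnP a) => [|a0]; [by left|right; apply/eqP].
    by rewrite eqn_leq ab leqNgt; apply/negP => ab'; case: aN; rewrite a0.
    rewrite subn0 FX ?(chainX i 0) // phi_v.
    by rewrite -[b]/(b.-1.+1) -[nth _ (_ :: _) _]/(nth v0 (rcons (full i) (z L i)) b.-1) nth_rcons sfull ltnn eqxx.
  by rewrite subnn FX ?phi_v' // chainX ?leqnn ?orbT.
have edge_chain i a : a < b -> e (F (iter a.+1 par (v i))) (F (iter a par (v i))).
  move=> ab; rewrite !Fpos ?(ltnW ab) // -(subnSK ab).
  by have /(pathP v0) := pfull i; apply; rewrite size_rcons sfull ltn_subrL.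
have edge x : x != rho -> e (F (par x)) (F x).
  move=> xr; have [pI|pX] := boolP (par x \in Int).
    case/IntP: pI => i [[|a] [// /andP[_ ab] px]].
    by rewrite (vun i a x (leq_trans (ltnW ab) bK) xr px); apply/edge_chain/ltnW.
  have [/IntP[i [a [/andP[a0 ab] ->]]]|xX] := boolP (x \in Int); first exact: edge_chain.
  rewrite !FX ?inE //; have [xR|xR] := boolP (x \in R); last first.
    by have xD : x \in Xt :\: R by [apply/setDP; rewrite inE]; case: (part_edge P xD).
  case/RP: xR => [xE|[i xE]|[i xE]]; first by rewrite xE eqxx in xr.
    by case/negP: pX; apply/IntP; exists i, 1; rewrite xE.
  have xC : x \in C by rewrite xE imset_f.
  have pXt : iter 1 par x \in Xt by rewrite inE.
  by have [] := part_chain P xC (a := 1) isT pXt.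
have F_full i g : g \in full i -> exists x, F x = g.
  move=> gf; have := gf; rewrite -index_mem sfull => il.
  exists (iter (b.-1 - index g (full i)) par (v i)); rewrite Fint.
    by rewrite subKn ?(ltnW il) // nth_index.
  by rewrite subn_gt0 il ltnS leq_subr.
(* At every level the strands occupy all positions, so each ladder is traversed by some strand
   however the switches are set. *)
have run_surj c i : c <= L -> exists i', run fs c (sigma i') = i.
  move=> cL; have ri : injective (fun i' => run fs c (sigma i')).
    by move=> x y /(run_inj fs_sw cL)/sigma_inj.
  by exists (invF ri i); rewrite (f_invF ri).
have F_seg c i g : c < L -> (forall s, g \in z c i :: blk c i s) -> exists x, F x = g.
  move=> cL gs; have [i' ri] := run_surj c i (ltnW cL); apply: (F_full i').
  rewrite inE; apply/orP; right; apply: (mem_strand cL).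
  by rewrite /segment ri; apply: gs.
have F_S0 g : g \in S0 -> exists x, F x = g.
  move/(place_S pl) => [->|[[i ->]|[c [i [cL ->]]]]].
  - by exists rho; rewrite FX ?(part_q P) ?(subsetP RXt) ?setU11.
  - by exists (v' i); rewrite FX ?(subsetP RXt).
  have [->|cL'] := eqVneq c L; first by exists (v i); rewrite FX ?(subsetP RXt).
  by apply: (F_seg c i) => [|s]; rewrite ?mem_head // ltn_neqAle cL' cL.
have F_surj g : exists x, F x = g.
  have [gu|gu] := boolP (g \in used S0 pi2); last first.
    by have [i <-] := hu_surj g gu; apply: (F_full i); rewrite mem_head.
  case: (memU _ gu) => [|[c [i [cL gs]]]]; last by apply: (F_seg c i) => // s; rewrite inE gs orbT.
  rewrite (part_used P) inE => /orP[/F_S0 //|/imsetP[x + ->]].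
  by rewrite inE => /andP[_ xX]; exists x; rewrite FX.
exists F; first exact: surj_inj_card.
move=> x y xy; case: rt => _ _ _ _ /(_ x y xy)[] [zr <-]; last exact: edge.
by rewrite e_sym edge.
Qed.

End FewLeaves.

(** * The choice of parameters *)

Lemma geometric_sum_le d t : 1 < d -> \sum_(i < t.+1) d ^ i <= 2 * d ^ t.
Proof.
move=> d1; elim: t => [|t IH]; first by rewrite big_ord1.
rewrite big_ord_recr /=; apply: (@leq_trans (2 * d ^ t + d ^ t.+1)); first by rewrite leq_add2r.
by rewrite [2 * d ^ t.+1]mul2n -addnn leq_add2r expnS leq_mul2r d1 orbT.
Qed.

(** Factors polynomial in [w] are replaced by powers [2 ^ (c * s + c')]; the second inequality lets
    a single [Delta ^ w] absorb them. *)
Lemma linear_le_exp w : 256 <= w -> exists s, w + 2 <= 2 ^ s /\ 10 * s + 100 <= w.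
Proof.
move=> w0; exists (w %/ 64 + 7); have E := divn_eq w 64; have lt : w %% 64 < 64 by rewrite ltn_mod.
split; last by move: E lt w0; move: (w %/ 64) (w %% 64) => q r; clear; lia.
rewrite expnD; apply: (@leq_trans (64 * (w %/ 64).+2)).
  by move: E lt; move: (w %/ 64) (w %% 64) => q r; clear; lia.
have h q : q.+2 <= 2 ^ q.+1 by apply: (ltn_expl q.+1).
by rewrite mulnC (_ : 2 ^ 7 = 2 * 64) // mulnA leq_mul // mulnC -expnS h.
Qed.

Lemma expander_universal (V T : finType) (e : rel V) (eT : rel T) (Delta w M : nat) :
  symmetric e -> symmetric eT -> irreflexive eT -> (forall x y, connect eT x y) ->
  (forall c, ucycle eT c -> size c <= 2) -> #|T| = #|V| ->
  (forall x, #|[set y | eT x y]| <= Delta) -> 1 < Delta -> 256 <= w ->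
  #|V| <= 2 ^ (32 * (w + 1) ^ 2) -> 0 < M -> M * (4 * Delta ^ (20 * w)) <= #|V| ->
  joined e M.+1 ->
  (forall Y : {set V}, 0 < #|Y| <= M -> 4 * Delta ^ (10 * w) * #|Y| <= #|nbh e Y|) ->
  exists2 f : T -> V, injective f & forall x y, eT x y -> e (f x) (f y).
Proof.
move=> es eTs eTi conn acy cTV degT Delta1 w0 nw M0 Mn jM exp.
set n := #|V| in cTV nw Mn *.
have [s [ws sw]] := linear_le_exp w0.
have De a b : a <= b -> Delta ^ a <= Delta ^ b by move=> ab; rewrite leq_pexp2l // ltnW.
have D2 a : 2 ^ a <= Delta ^ a by apply: leq_expn2r.
have De0 a : 0 < Delta ^ a by rewrite expn_gt0 ltnW.
(* [D] is the demand of every vertex, [d] the branching of the connecting trees,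
   whose depth [t] is the least one yielding more than [M] leaves. *)
pose D := Delta ^ (9 * w); pose d := Delta ^ (8 * w).
have D0 : 0 < D := De0 _.
have d1 : 1 < d by apply: leq_trans (D2 _); rewrite -{1}(expn0 2) ltn_exp2l //; move: w0; clear; lia.
have dD : d <= D by apply: De; rewrite leq_mul2r orbT.
(* The exponent [4 * w + 6] works for every [Delta >= 2], because [8 * w * (4 * w + 6) + 20 * w]
   exceeds [32 * (w + 1) ^ 2]. *)
have big_d : M < d ^ (4 * w + 6).
  rewrite -(@ltn_pmul2r (4 * Delta ^ (20 * w))) ?muln_gt0 ?De0 //.
  apply: leq_ltn_trans Mn _; apply: leq_ltn_trans nw _.
  rewrite /d -expnM mulnCA -expnD; apply: (@leq_trans (4 * 2 ^ (8 * w * (4 * w + 6) + 20 * w))).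
    rewrite -[X in _ < X * _]/(2 ^ 2) -expnD ltn_exp2l // -mulnn.
    by move: w0; clear; lia.
  by rewrite leq_mul2l /= D2.
have ex_t : exists t, M < d ^ t by exists (4 * w + 6).
have [t tM tmin] := ex_minnP ex_t.
have tw : t <= 4 * w + 6 := tmin _ big_d.
pose m := d ^ t; have m0 : 0 < m by apply: leq_ltn_trans tM.
have t0 : 0 < t by case: (t) tM => //; rewrite expn0 ltnS leqNgt M0.
have mdM : m <= d * M.
  rewrite /m -(prednK t0) expnS leq_mul2l; apply/orP; right; rewrite leqNgt; apply/negP => /tmin.
  by rewrite -{1}(prednK t0) ltnn.
have mD : 4 * Delta ^ (3 * w) * (m * D) <= n.
  apply: leq_trans Mn; apply: (@leq_trans (4 * Delta ^ (3 * w) * (d * M * D))).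
    by rewrite leq_mul2l leq_mul2r mdM !orbT.
  rewrite /d /D (_ : 20 * w = 3 * w + 8 * w + 9 * w); last by clear; lia.
  rewrite !expnD; move: (Delta ^ (3 * w)) (Delta ^ (8 * w)) (Delta ^ (9 * w)) => x y z; clear; nia.
have mD' : 7 * (m * D) * 2 ^ (4 * s + 17) <= n.
  apply: leq_trans mD; rewrite mulnAC leq_mul2r; apply/orP; right.
  apply: (@leq_trans (2 ^ 3 * 2 ^ (4 * s + 17))); first by rewrite leq_mul2r orbT.
  rewrite -expnD -[4 * Delta ^ _]/(2 ^ 2 * Delta ^ _).
  apply: leq_trans (leq_mul (leqnn _) (D2 _)); rewrite -expnD leq_exp2l //.
  by move: sw; clear; lia.
have mD0 : 0 < m * D by rewrite muln_gt0 m0.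
have sum_m : 2 * (\sum_(i < t.+1) d ^ i) + m + 2 * m * D <= 7 * (m * D).
  have := geometric_sum_le t d1; rewrite -/m -mulnA; have : m <= m * D by rewrite leq_pmulr.
  by move: (\sum_(i < t.+1) d ^ i) (m * D) (m) => x y z; clear; lia.
have Mm1 : M.+1 + 2 * m * D <= 3 * (m * D).
  apply: (@leq_trans (m * D + 2 * m * D)); last by rewrite -mulnA; move: (m * D) => x; clear; lia.
  by rewrite leq_add2r; apply: leq_trans tM _; rewrite -/m leq_pmulr.
have Dn : D <= n.
  apply: leq_trans Mn; apply: leq_trans (leq_pmull _ M0); apply: leq_trans (leq_pmull _ _) => //.
  by apply: De; rewrite leq_mul2r orbT.
have n0 : 0 < n := leq_trans D0 Dn.
have [Q1 [Q2 [W [[Q12 Q1W Q2W] [cQ1 cQ2 cW] exQ]]]] :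
    exists Q1 Q2 W : {set V},
    [/\ [/\ [disjoint Q1 & Q2], [disjoint Q1 & W] & [disjoint Q2 & W]],
        [/\ #|Q1| * D <= #|V|, #|Q2| * D <= #|V| & 2 * #|W| <= #|V|] &
        forall Y : {set V}, #|Y| <= M -> [/\ #|Y| <= #|nbh e Y :&: Q1|,
          #|Y| <= #|nbh e Y :&: Q2| & D * #|Y| <= #|nbh e Y :&: W|]].
  (* Since [D <= n], it suffices that [2 ^ a] exceeds [5 * n ^ 2]. As [a] is only quadratic in [w],
     its cost in expansion fits into [Delta ^ w], the gap between the exponents [10 * w] and
     [9 * w]. *)
  apply: (reservoir (a := 64 * (w + 1) ^ 2 + 3)) => // [Y YM|]; rewrite -/n.
    apply: leq_trans (exp Y YM); rewrite leq_mul2r; apply/orP; right.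
    have -> : 10 * w = w + 9 * w by clear; lia.
    rewrite (expnD Delta w (9 * w)) -/D.
    have aw : 2 * (64 * (w + 1) ^ 2 + 3).+1 <= Delta ^ w.
      apply: leq_trans (D2 w); apply: (@leq_trans (2 ^ 8 * (2 ^ s * 2 ^ s))); last first.
        by rewrite -!expnD leq_exp2l //; move: sw; clear; lia.
      apply: leq_trans (leq_mul (leqnn _) (leq_mul ws ws)).
      by rewrite -mulnn -[2 ^ 8]/256; clear; lia.
    apply: (@leq_trans (2 * (64 * (w + 1) ^ 2 + 3).+1 * (2 * D.+1))).
      by move: ((64 * (w + 1) ^ 2 + 3).+1) (D.+1) => x y; clear; lia.
    rewrite [X in _ <= X]mulnCA; apply: leq_mul aw _.
    by move: D0; move: (D) => x; clear; lia.
  apply: (@leq_ltn_trans (5 * (n * n))).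
    have := leq_mul Dn (leqnn n); have := leq_mul n0 (leqnn n).
    by move: n0; move: (n) (D) => x y; clear; lia.
  apply: (@leq_ltn_trans (5 * (2 ^ (32 * (w + 1) ^ 2) * 2 ^ (32 * (w + 1) ^ 2)))).
    by rewrite leq_mul2l leq_mul.
  rewrite -expnD addnn -mul2n mulnA [2 ^ (_ + 3)]expnD mulnC ltn_pmul2l ?expn_gt0 //.
have exQ1 (Y : {set V}) (YM : #|Y| <= M) := let: And3 a _ _ := exQ Y YM in a.
have exQ2 (Y : {set V}) (YM : #|Y| <= M) := let: And3 _ a _ := exQ Y YM in a.
have exW (Y : {set V}) (YM : #|Y| <= M) := let: And3 _ _ a := exQ Y YM in a.
have [rho _] : exists rho, rho \in T by apply/card_gt0P; rewrite cTV.
have [par [depth rt]] := rooted_tree_exists rho eTs eTi conn acy.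
pose k := t.+1.*2; pose ell := k.+1.
have k_le : k.+2 <= 2 ^ (s + 3).
  rewrite expnD; apply: leq_trans (leq_mul ws (leqnn _)).
  by rewrite /k -[2 ^ 3]/8; move: tw w0; clear; lia.
have ellw : ell.+1 <= 8 * w + 16 by rewrite /ell /k; move: tw w0; clear; lia.
(* The number [h] of bare paths lies between [n / 2 ^ w.+1] and [n / 2 ^ w]. It is small enough for
   [h] paths of polylogarithmic length to fit into half of the tree, and larger than both reservoirs
   and the room of order [m * D]. *)
pose h := 2 ^ trunc_log 2 (n %/ 2 ^ w); pose j := trunc_log 2 (n %/ 2 ^ w).
have wD : 2 ^ w <= n.
  by apply: leq_trans Dn; apply: leq_trans (D2 _) _; apply: De; rewrite leq_pmull.
have nw0 : 0 < n %/ 2 ^ w by rewrite divn_gt0 ?expn_gt0.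
have hn : h * 2 ^ w <= n.
  by rewrite -leq_divRL ?expn_gt0 // trunc_logP.
have nh : n < h * 2 ^ w.+1.
  rewrite expnS mulnA [h * 2]mulnC -expnS -ltn_divLR ?expn_gt0 //.
  exact: trunc_log_ltn.
have jw : j <= 32 * (w + 1) ^ 2.
  rewrite -(@leq_exp2l 2) //; apply: leq_trans nw; apply: leq_trans hn.
  by rewrite leq_pmulr ?expn_gt0.
pose L := j.*2; pose K := (L * (k * k.+2).+1).+2 + ell.
have L_le : L.+4 <= 2 ^ (2 * s + 7).
  apply: (@leq_trans (128 * ((w + 2) * (w + 2)))).
    by rewrite /L; move: jw; rewrite -mulnn; move: (j); clear; lia.
  by rewrite expnD mulnC mul2n -addnn expnD leq_mul // leq_mul.
have K_le : K.+1 <= 2 ^ (4 * s + 14).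
  have N_le : (k * k.+2).+1 <= 2 ^ (s + 3) * 2 ^ (s + 3).
    by apply: leq_trans (leq_mul k_le k_le); move: (k) => x; clear; lia.
  apply: (@leq_trans (L.+4 * (2 ^ (s + 3) * 2 ^ (s + 3)))); last first.
    apply: leq_trans (leq_mul L_le (leqnn _)) _; rewrite -!expnD leq_exp2l //.
    by clear; lia.
  have : ell <= 2 ^ (s + 3) * 2 ^ (s + 3).
    by apply: leq_trans (leq_pmulr _ _); rewrite ?expn_gt0 //; apply: ltnW.
  have : 3 <= 2 ^ (s + 3) * 2 ^ (s + 3).
    by apply: leq_trans (leq_mul k_le k_le).
  rewrite /K; move: N_le; move: (k * k.+2) (2 ^ (s + 3) * 2 ^ (s + 3)) => N X; clear; nia.
have Q_small (Q : {set V}) : #|Q| * D <= n -> #|Q| <= h.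
  move=> cQ; rewrite -ltnS -(@ltn_pmul2r D) //; apply: leq_ltn_trans cQ _.
  apply: leq_trans nh _; apply: leq_mul (leqnSn _) _; apply: leq_trans (D2 _) _; apply: De.
  by move: w0; clear; lia.
have h0 : 0 < h by rewrite expn_gt0.
have small_ell : ell + k + 10 + Delta + Delta <= D.
  have kk : ell + k + 10 <= Delta ^ w.
    apply: leq_trans (D2 w); apply: (@leq_trans (2 ^ 3 * 2 ^ (s + 3))).
      by move: k_le; rewrite /ell -[2 ^ 3]/8; move: (k) => c; clear; lia.
    by rewrite -expnD leq_exp2l //; move: sw; clear; lia.
  have dd : Delta + Delta <= Delta ^ 2 by rewrite addnn -mul2n -mulnn leq_mul2r Delta1 orbT.
  have d2w : Delta ^ 2 <= Delta ^ w by apply: De; move: w0; clear; lia.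
  have dw1 : Delta ^ w + Delta ^ w <= Delta ^ w.+1 by rewrite addnn -mul2n expnS leq_mul2r Delta1 orbT.
  have dwD : Delta ^ w.+1 <= D by apply: De; move: w0; clear; lia.
  rewrite -addnA; apply: leq_trans dwD; apply: leq_trans dw1; apply: leq_add => //.
  exact: leq_trans d2w.
(* With at most [n / (4 * K.+1)] leaves, about half of all vertices are lower ends of bare paths of
   length [K]. With more leaves, [#|leaves rho par|] is [n] up to a factor polynomial in [w], and
   this outweighs [Delta ^ ell.+1 * n / D]. *)
have [few|many] := leqP (4 * K.+1 * #|leaves rho par|) n.
  apply: (few_leaves_embed es m0 tM jM _ dD (leqnn m) Q12 Q1W Q2W exQ1 exQ2 exW eTs rt (j := j) degT cTV).
  - exact: ltnW.
  - rewrite -/k -/ell; apply: leq_trans small_ell.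
    by move: (ell) (k) (Delta) => a b c; clear; lia.
  - exact: Q_small.
  - exact: Q_small.
  - have lw : 2 * (h * L.+4) <= n.
      apply: leq_trans hn; rewrite mulnCA leq_mul2l; apply/orP; right.
      apply: leq_trans (leq_mul (leqnn 2) L_le) _; rewrite -expnS leq_exp2l //.
      by move: sw; clear; lia.
    have := Q_small _ cQ2; rewrite -/h -/L; move: cW lw h0; rewrite -/n.
    by move: #|W| #|Q2| (n) (h) (L) => a b c x y; clear; nia.
  - have lw : 4 * (h * L.+4) <= n.
      apply: leq_trans hn; rewrite mulnCA leq_mul2l; apply/orP; right.
      apply: leq_trans (leq_mul (leqnn (2 ^ 2)) L_le) _; rewrite -expnD leq_exp2l //.
      by move: sw; clear; lia.
    have m3 : 3 * (m * D) * 2 <= n.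
      apply: leq_trans mD'; apply: leq_mul; first by rewrite leq_mul2r orbT.
      by rewrite -[X in X <= _](expn1 2) leq_exp2l //; clear; lia.
    rewrite -/n -/h -/L -addnA; apply: leq_trans (leq_add (leqnn _) Mm1) _.
    move: m3 lw h0; move: (3 * (m * D)) (n) (h) (L) => a c x y; clear; nia.
  - rewrite -/h; apply: leq_ltn_trans sum_m _; rewrite -(@ltn_pmul2r (2 ^ w.+1)) ?expn_gt0 //.
    apply: leq_ltn_trans nh; apply: leq_trans mD; rewrite mulnAC leq_mul2r; apply/orP; right.
    rewrite -[4 * Delta ^ _]/(2 ^ 2 * Delta ^ _); apply: leq_trans (leq_mul (leqnn _) (D2 _)).
    apply: (@leq_trans (2 ^ 3 * 2 ^ w.+1)); first by rewrite leq_mul2r orbT.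
    by rewrite -!expnD leq_exp2l //; move: w0; clear; lia.
  rewrite -/k -/ell -/L -/K -/h cTV.
  have hK : 4 * (K.+1 * h) <= n.
    apply: leq_trans hn; rewrite mulnA mulnC leq_mul2l; apply/orP; right.
    apply: leq_trans (leq_mul (leqnn (2 ^ 2)) K_le) _; rewrite -expnD leq_exp2l //.
    by move: sw; clear; lia.
  have n4 : 3 < n by apply: leq_trans wD; rewrite -[4]/(2 ^ 2) leq_exp2l //; move: w0; clear; lia.
  move: few hK n4; rewrite -!mulnA; move: (K.+1 * h) => a.
  rewrite [#|_| * K.+1]mulnC; move: (K.+1 * _) (n) => b c; clear; lia.
pose F := #|leaves rho par|; rewrite -/F in many.
have many' : n < 2 ^ (4 * s + 16) * F.
  apply: leq_trans many _; rewrite leq_mul2r; apply/orP; right.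
  apply: leq_trans (leq_mul (leqnn (2 ^ 2)) K_le) _; rewrite -expnD leq_exp2l //.
  by clear; lia.
have F7 : 7 * (m * D) < F.
  rewrite -(@ltn_pmul2r (2 ^ (4 * s + 17))) ?expn_gt0 //; apply: leq_ltn_trans mD' _.
  by apply: leq_trans many' _; rewrite mulnC leq_mul2l leq_exp2l // orbC; apply/orP; left; clear; lia.
have D4 : 8 <= D.
  by apply: leq_trans (D2 _); rewrite -[8]/(2 ^ 3) leq_exp2l //; move: w0; clear; lia.
have cQ8 : 8 * #|Q1| <= n by apply: leq_trans cQ1; rewrite mulnC leq_mul2l D4 orbT.
apply: (many_leaves_embed es m0 tM jM _ dD (leqnn m) Q1W _ exQ1 exW eTs rt degT cTV).
- exact: ltnW.
- rewrite -/n; move: cQ8 cW n0; rewrite -/n; move: #|Q1| #|W| (n) => a b c; clear; lia.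
- rewrite cTV; apply: leq_trans Dn; exact: leq_trans D4.
- exact: ltnW.
- rewrite -/k -/ell; apply: leq_trans small_ell.
  by move: (ell) (k) (Delta) => a b c; clear; lia.
- have m3 : 3 * (m * D) * 4 <= n.
    apply: leq_trans mD'; apply: leq_mul; first by rewrite leq_mul2r orbT.
    by rewrite -[X in X <= _]/(2 ^ 2) leq_exp2l //; clear; lia.
  have n8 : 8 <= n := leq_trans D4 Dn.
  rewrite -/n -addnA; apply: leq_trans (leq_add (leqnn _) Mm1) _.
  by move: m3 n8 cQ8; move: (3 * (m * D)) (n) #|Q1| => a c b; clear; lia.
- exact: leq_ltn_trans F7.
rewrite -/k -/ell -/F -(@leq_pmul2l (D * 2 ^ (4 * s + 16))) ?muln_gt0 ?D0 ?expn_gt0 //.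
have De1 : Delta * (ell.+1 * Delta ^ ell) * (2 * 2 ^ (4 * s + 16)) <= D.
  apply: (@leq_trans (2 ^ (s + 4) * Delta ^ ell.+1 * (2 * 2 ^ (4 * s + 16)))).
    rewrite [Delta * _]mulnCA -expnS; apply: leq_mul (leqnn _); apply: leq_mul (leqnn _).
    by apply: leq_trans k_le _; rewrite leq_exp2l //; clear; lia.
  rewrite mulnAC -expnS -expnD.
  apply: leq_trans (leq_mul (D2 _) (leqnn _)) _; rewrite -expnD; apply: De.
  by move: ellw sw; clear; lia.
have Q1n : #|Q1|.+1 * D <= 2 * n by rewrite mulSn; move: cQ1 Dn; rewrite -/n; move: (#|Q1| * D) (D) (n) => a b c; clear; lia.
apply: (@leq_trans (D * n)); last first.
  by rewrite -mulnA leq_mul2l (ltnW many') orbT.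
apply: leq_trans (leq_mul De1 (leqnn n)).
set Y := Delta * (ell.+1 * Delta ^ ell); set p := 2 ^ _.
apply: (@leq_trans (Y * p * (#|Q1|.+1 * D))).
  rewrite [Delta * _]mulnA -/Y; move: (#|Q1|.+1) (D) (Y) (p) => a b c x; clear; lia.
apply: leq_trans (leq_mul (leqnn _) Q1n) _.
by move: (Y) (p) (n) => a b c; clear; lia.
Qed.

(** * Bijumbled graphs *)

Lemma min_degree_le (G : sgraph) (x : G) : min_degree G <= degree x.
Proof.
rewrite /min_degree; have : x \in index_enum G by rewrite mem_index_enum.
elim: (index_enum G) => // y s IH; rewrite inE big_cons => /predU1P[<-|/IH le].
  exact: geq_minl.
exact: leq_trans (geq_minr _ _) le.
Qed.

Lemma edges_betweenE (G : sgraph) (X Y : {set G}) :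
  edges_between X Y = \sum_(x in X) #|[set y in Y | adj x y]|.
Proof.
rewrite /edges_between -sum1_card (partition_big (fun xy => xy.1) (mem X)) /=; last first.
  by move=> [x y]; rewrite !inE /= => /andP[/andP[]].
apply: eq_bigr => x xX; rewrite sum1_card.
have pair_inj : injective (pair x : G -> G * G) by move=> y y' [].
rewrite -[RHS](card_imset _ pair_inj); apply: eq_card => -[x' y]; rewrite unfold_in inE /=.
apply/andP/imsetP => [[/andP[+ xy] /eqP xE]|[z + [-> ->]]].
  by rewrite inE /= => /andP[_ yY]; exists y; rewrite -?xE // inE yY.
by rewrite !inE /= eqxx => /andP[-> ->]; rewrite [x \in X]xX.
Qed.

Lemma edges_between_disjoint (G : sgraph) (X Y : {set G}) :
  (forall x y, x \in X -> y \in Y -> ~~ adj x y) -> edges_between X Y = 0.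
Proof.
move=> h; rewrite edges_betweenE big1 // => x xX; apply/eqP; rewrite cards_eq0.
by apply/eqP/setP=> y; rewrite !inE; apply/negP=> /andP[/(h _ _ xX)/negP].
Qed.

Lemma edges_between_nbh (G : sgraph) (X : {set G}) :
  min_degree G * #|X| <= edges_between X (nbh (@adj G) X).
Proof.
rewrite edges_betweenE mulnC -sum_nat_const; apply: leq_sum => x xX.
apply: leq_trans (min_degree_le x) _; rewrite /degree; apply/subset_leq_card/subsetP=> y.
by rewrite !inE => xy; rewrite xy (mem_nbh xX xy).
Qed.

(** A non-root vertex with a child has two neighbours, so for [b <= 1] only the root has children,
    and at most one. This excludes [Delta <= 1], for which powers of [Delta] do not grow. *)
Lemma max_degree_gt1 (T : finType) (e : rel T) rho par depth b :
  symmetric e -> rooted_tree e rho par depth ->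
  (forall x, #|[set y | e x y]| <= b) -> 2 < #|T| -> 1 < b.
Proof.
move=> es rt deg T3; rewrite ltnNge; apply/negP => b1.
have d1 x : #|[set y | e x y]| <= 1 := leq_trans (deg x) b1.
have [pr dr dp pe _] := rt.
have ch_le x : #|children rho par x| <= (x == rho).
  have [->|xr] := eqVneq x rho.
    apply: leq_trans (d1 rho); apply/subset_leq_card/subsetP=> y; rewrite !inE.
    by move=> /andP[yr /eqP <-]; apply: pe.
  rewrite leqn0 cards_eq0; apply/eqP/setP=> y; rewrite !inE; apply/negP=> /andP[yr /eqP yx].
  have := d1 x; rewrite leqNgt => /negP[]; rewrite (cardsD1 y) inE -{1}yx pe // ltnS.
  apply/card_gt0P; exists (par x); rewrite !inE es pe // andbT.
  apply/eqP => E; have := dp _ yr; have := dp _ xr; rewrite yx E.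
  by move: (depth x) (depth y) => a c; clear; lia.
have := card_ch_sum rho par; have : \sum_(x : T) #|children rho par x| <= \sum_(x : T) (x == rho).
  exact: leq_sum.
rewrite (bigD1 rho) //= [X in _ <= X](bigD1 rho) //= eqxx [X in _ <= 1 + X]big1 => [|x /negbTE -> //].
by move: (_ + _) T3 => a; move: #|T| => n; lia.
Qed.

(** * Real estimates *)

Import Order.TTheory GRing.Theory Num.Theory.
Local Open Scope ring_scope.

Lemma expR1_le4 (R : realType) : expR 1 <= 4 :> R.
Proof.
have h : (2^-1 : R) <= expR (- 2^-1).
  by apply: le_trans (expR_ge1Dx _); lra.
have h2 : expR (2^-1) <= 2 :> R.
  rewrite -[2^-1]opprK expRN -[leRHS]invrK lef_pV2 // posrE ?invr_gt0 ?expR_gt0 //.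
have -> : (1 : R) = 2^-1 + 2^-1 by lra.
by rewrite expRD; have := expR_gt0 (2^-1 : R); nra.
Qed.

(** The bound [log n <= 16 (w + 1)^2], together with [e <= 4 = 2^2], is the origin of the exponent
    [32 (w + 1)^2]. *)
Lemma nat_lt_exp_sqrt_ln (R : realType) (n w : nat) : (0 < n)%N ->
  Num.sqrt (ln n%:R) < 4 * (w + 1)%:R :> R -> (n <= 2 ^ (32 * (w + 1) ^ 2))%N.
Proof.
move=> n0 sw; have n1 : (1 : R) <= n%:R by rewrite ler1n.
have np : (0 : R) < n%:R by rewrite ltr0n.
have lw : ln n%:R <= (16 * (w + 1) ^ 2)%:R :> R.
  rewrite -[leLHS]sqr_sqrtr ?ln_ge0 // natrM natrX.
  have := sqrtr_ge0 (ln n%:R : R); move: sw; move: (Num.sqrt _) ((w + 1)%:R : R) => a c.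
  by nra.
rewrite -(ler_nat R); have -> : n%:R = expR (ln n%:R) :> R by rewrite lnK.
apply: le_trans (_ : expR (16 * (w + 1) ^ 2)%:R <= _); first by rewrite ler_expR.
rewrite -[(16 * _)%:R]mulr1 expRM_natl.
apply: le_trans (lerXn2r _ _ _ (expR1_le4 R)) _; rewrite ?nnegrE ?expR_ge0 //.
have -> : (32 * (w + 1) ^ 2 = 2 * (16 * (w + 1) ^ 2))%N by rewrite mulnA.
by rewrite expnM natrX.
Qed.

(** * Expansion from bijumbledness and minimum degree *)

Section Bijumbled.

Variables (R : realType) (p beta : R) (G : sgraph) (B A : nat).
Hypotheses (p_gt0 : 0 < p) (beta_gt0 : 0 < beta) (bG : bijumbled p beta G).
Let n := #|G|.
Hypothesis betaB : beta * (4 * B)%:R <= p * n%:R.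
Hypothesis A2 : (2 <= A)%N.
Hypothesis AB : B = (A * A)%N.
Hypothesis deg : 4 * Num.sqrt (beta * p * n%:R) <= (min_degree G)%:R.

Lemma bijumbled_no_edge (X Y : {set G}) : edges_between X Y = 0%N ->
  p ^+ 2 * (#|X|%:R * #|Y|%:R) <= beta ^+ 2.
Proof.
move=> e0; have := bG X Y; rewrite e0 sub0r normrN.
set q : R := #|X|%:R * #|Y|%:R; have q0 : 0 <= q by rewrite mulr_ge0.
rewrite -mulrA -/q ger0_norm ?mulr_ge0 ?(ltW p_gt0) //.
have := sqr_sqrtr q0; have := sqrtr_ge0 q; move: (Num.sqrt q) => r r0 <-.
have [->|rn] := eqVneq r 0; first by move=> _; rewrite [0 ^+ 2]expr2 !mulr0 sqr_ge0.
have rp : 0 < r by rewrite lt_neqAle eq_sym rn.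
rewrite expr2 mulrA ler_pM2r // => h; rewrite -exprMn lerXn2r ?nnegrE ?mulr_ge0 //; exact: ltW.
Qed.

(** A vertex is not adjacent to itself, so a one-point set taken twice spans no edge and yields
    [p <= beta]. This ensures that [M] is positive. *)
Lemma bijumbled_order_ge : (0 < n)%N -> (4 * B <= n)%N.
Proof.
move=> n0; have /card_gt0P[x _] := n0.
have e0 : edges_between [set x] [set x] = 0%N.
  by apply: edges_between_disjoint => y z; rewrite !inE => /eqP -> /eqP ->; rewrite adj_irrefl.
have := bijumbled_no_edge e0; rewrite !cards1 !mulr1 => pb.
have pbeta : p <= beta.
  by rewrite -(@ler_pXn2r _ 2) ?nnegrE ?(ltW p_gt0) ?(ltW beta_gt0) //; move: pb; rewrite !mulr1.
rewrite -(ler_nat R) -(ler_pM2l beta_gt0); apply: le_trans betaB _.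
by rewrite ler_wpM2r.
Qed.

(** A set of more than [n / (4 * B)] vertices satisfies [p * #|X| > beta]; two such sets violate
    [bijumbled_no_edge]. *)
Lemma bijumbled_joined (M : nat) : (n < M.+1 * (4 * B))%N -> joined (@adj G) M.+1.
Proof.
move=> nM X Y MX MY.
have [/existsP[x /andP[xX /existsP[y /andP[yY xy]]]]|none] :=
  boolP [exists x in X, [exists y in Y, adj x y]]; first by exists x, y.
have e0 : edges_between X Y = 0%N.
  apply: edges_between_disjoint => x y xX yY; apply: contra none => xy.
  by apply/existsP; exists x; rewrite xX; apply/existsP; exists y; rewrite yY.
have := bijumbled_no_edge e0.
have big (Z : {set G}) : (M < #|Z|)%N -> beta < p * #|Z|%:R.
  move=> MZ; have B0 : 0 < (4 * B)%:R :> R.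
    by rewrite ltr0n AB !muln_gt0 /= !(leq_trans _ A2).
  rewrite -(ltr_pM2r B0); apply: le_lt_trans betaB _; rewrite -mulrA ltr_pM2l //.
  by rewrite -natrM ltr_nat; apply: leq_trans nM _; rewrite leq_mul2r MZ orbT.
have := big X MX; have := big Y MY.
move: (#|X|%:R : R) (#|Y|%:R : R) p_gt0 beta_gt0 => x y p0 b0 h1 h2 h3.
have : beta * beta < (p * y) * (p * x) by rewrite ltr_pM // ltW.
by move: h3; rewrite !expr2; move: (beta * beta) => bb; nra.
Qed.

(** If [p * #|X| <= beta], the degree condition gives at least [8 A beta #|X|] edges between [X] and
    its neighbourhood, while fewer than [4 A #|X|] neighbours would allow at most
    [(4 + 2) A beta #|X|]. Otherwise the non-neighbours number at most [n / (4 B)], and the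
    neighbourhood is nearly everything. *)
Lemma bijumbled_expand (X : {set G}) : (0 < #|X|)%N -> (#|X| * (4 * B) <= n)%N ->
  (4 * A * #|X| <= #|nbh (@adj G) X|)%N.
Proof.
move=> X0 XB; rewrite leqNgt; apply/negP => yx.
set Y := nbh _ X in yx.
have x0 : 0 < #|X|%:R :> R by rewrite ltr0n.
have AR : (2 : R) <= A%:R by rewrite (ler_nat R 2).
have [px|px] := leP (p * #|X|%:R) beta.
  have h1 : (min_degree G)%:R * #|X|%:R <= (edges_between X Y)%:R :> R.
    by rewrite -natrM ler_nat edges_between_nbh.
  have h2 : (edges_between X Y)%:R <= p * #|X|%:R * #|Y|%:R + beta * Num.sqrt (#|X|%:R * #|Y|%:R).
    have := bG X Y; rewrite ler_norml => /andP[_]; rewrite lerBlDl //.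
  have y_lt : #|Y|%:R < 4 * A%:R * #|X|%:R :> R by rewrite -!natrM ltr_nat.
  have h3 : Num.sqrt (#|X|%:R * #|Y|%:R) <= 2 * A%:R * #|X|%:R :> R.
    rewrite -[leRHS]ger0_norm ?mulr_ge0 // -sqrtr_sqr ler_sqrt ?sqr_ge0 //.
    move: x0 AR y_lt; move: (#|X|%:R : R) (#|Y|%:R : R) (A%:R : R) => x y a x0 AR y_lt.
    apply: (le_trans (y := x * (4 * a * x))); first by rewrite ler_pM2l // ltW.
    have -> : (2 * a * x) ^+ 2 = a * (x * (4 * a * x)) by ring.
    by rewrite ler_peMl ?mulr_ge0 //; lra.
  have h4 : 8 * A%:R * beta <= (min_degree G)%:R :> R.
    apply: le_trans deg.
    have -> : 8 * A%:R * beta = 4 * (2 * A%:R * beta) by ring.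
    rewrite ler_pM2l // -[leLHS]ger0_norm ?mulr_ge0 ?(ltW beta_gt0) // -sqrtr_sqr ler_sqrt.
      have -> : (2 * A%:R * beta) ^+ 2 = beta * (beta * (4 * B)%:R) by rewrite AB !natrM; ring.
      by rewrite -mulrA ler_pM2l.
    by rewrite !mulr_ge0 ?ler0n // ltW.
  have h5 : p * #|X|%:R * #|Y|%:R <= beta * (4 * A%:R * #|X|%:R).
    by apply: ler_pM => //; [rewrite mulr_ge0 // ltW | exact: ltW].
  have h6 : beta * Num.sqrt (#|X|%:R * #|Y|%:R) <= beta * (2 * A%:R * #|X|%:R) by rewrite ler_pM2l.
  have h7 : 8 * A%:R * beta * #|X|%:R <= (min_degree G)%:R * #|X|%:R by rewrite ler_pM2r.
  have pos : 0 < beta * A%:R * #|X|%:R by rewrite !mulr_gt0 // (lt_le_trans _ AR).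
  lra.
have e0 : edges_between X (~: Y) = 0%N.
  apply: edges_between_disjoint => x y xX; rewrite inE; apply: contra => xy.
  exact: mem_nbh xX xy.
have h1 := bijumbled_no_edge e0; set z := #|~: Y| in h1.
have yz : (#|Y| + z = n)%N by rewrite /z cardsC.
have h2 : p * z%:R < beta.
  have [->|zn] := eqVneq z 0%N; first by rewrite mulr0.
  have z0 : 0 < z%:R :> R by rewrite ltr0n lt0n.
  rewrite -(ltr_pM2l beta_gt0); apply: lt_le_trans (_ : p * #|X|%:R * (p * z%:R) <= _).
    by rewrite ltr_pM2r // mulr_gt0.
  by move: h1; rewrite !expr2; have -> : p * #|X|%:R * (p * z%:R) = p * p * (#|X|%:R * z%:R) by ring.
have h3 : (z * (4 * B) <= n)%N.
  rewrite -(ler_nat R) -(ler_pM2l p_gt0); apply: le_trans betaB.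
  by rewrite natrM mulrA ler_wpM2r // ltW.
have h4 : (8 * z <= n)%N.
  apply: leq_trans h3; rewrite mulnC leq_mul2l; apply/orP; right.
  by rewrite AB; move: A2; clear; nia.
have h5 : (8 * (A * #|X|) <= n)%N.
  apply: leq_trans XB; rewrite AB; move: A2; clear; nia.
by move: X0 yx yz h4 h5; move: #|X| #|Y| (z) (n) => x y c f; clear; lia.
Qed.

End Bijumbled.

Theorem theorem1p5 (R : realType) :
  exists n0 : nat, forall (n Delta : nat) (p beta : R),
    (n0 <= n)%N -> 0 < p -> 0 < beta ->
    beta <= p * n%:R / (4 * Delta%:R `^ (5 * Num.sqrt (ln n%:R))) ->
    forall G : sgraph,
      #|G| = n -> bijumbled p beta G ->
      4 * Num.sqrt (beta * p * n%:R) <= (min_degree G)%:R ->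
      tree_universal n Delta G.
Proof.
(* The second bound gives [sqrt (log n) >= 1024], hence [w >= 256]; three vertices are what excludes
   [Delta <= 1]. *)
exists (maxn 3 (Num.truncn (expR (1024 ^+ 2 : R))).+1) => n Delta p beta; rewrite geq_max => /andP[n3 n_large].
move=> p0 b0 hb G cG bG deg T [[[T0 conn] acy] cT degT].
have n0 : (0 < n)%N by apply: leq_trans n3.
have degx (x : T) : (#|[set y | adj x y]| <= Delta)%N.
  by apply: leq_trans degT; apply: (leq_bigmax x).
have [rho _] := card_gt0P T0.
have [par [depth rt]] := rooted_tree_exists rho (@adj_sym T) (@adj_irrefl T) conn acy.
have D1 : (1 < Delta)%N by apply: (max_degree_gt1 (@adj_sym T) rt degx); rewrite cT.
(* A quarter of [s] is rounded down, so that [20 * w <= 5 * s] turns the hypothesis on [beta] into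
   one with the integer power [Delta ^ (20 * w)]. *)
pose s : R := Num.sqrt (ln n%:R); pose w := Num.truncn (s / 4).
have s0 : 0 <= s := sqrtr_ge0 _.
have /andP[w_le w_gt] : w%:R <= s / 4 < w.+1%:R by apply: truncn_itv; rewrite divr_ge0.
have s_lt : s < 4 * (w + 1)%:R by rewrite addn1 mulrC -ltr_pdivrMr.
have s_ge : 1024 <= s.
  have n1 : expR (1024 ^+ 2) <= n%:R :> R.
    apply/ltW; apply: lt_le_trans (_ : (Num.truncn (expR (1024 ^+ 2 : R))).+1%:R <= _).
      by have /andP[] := truncn_itv (expR_ge0 (1024 ^+ 2 : R)).
    by rewrite ler_nat.
  rewrite /s -[leLHS]ger0_norm // -sqrtr_sqr ler_wsqrtr // -ler_expR lnK // posrE ltr0n //.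
have w256 : (256 <= w)%N.
  by rewrite -ltnS -(ltr_nat R); apply: le_lt_trans w_gt; lra.
pose A := (Delta ^ (10 * w))%N; pose B := (A * A)%N.
have BE : B = (Delta ^ (20 * w))%N by rewrite /B /A -expnD -mulnDl.
have A2 : (2 <= A)%N.
  apply: (leq_trans D1); apply: (@leq_trans (Delta ^ 1)); first by rewrite expn1.
  apply: leq_pexp2l; first exact: (ltnW D1).
  by rewrite muln_gt0 /=; apply: leq_trans w256.
have B0 : 0 < (4 * B)%:R :> R by rewrite ltr0n /B !muln_gt0 /= !(leq_trans _ A2).
have betaB : beta * (4 * B)%:R <= p * n%:R.
  have D1R : 1 <= Delta%:R :> R by rewrite ler1n ltnW.
  have le : (4 * B)%:R <= 4 * Delta%:R `^ (5 * s) :> R.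
    rewrite natrM ler_pM2l // BE natrX -powR_mulrn ?ler0n //; apply: ler_powR => //.
    by rewrite natrM; lra.
  apply: le_trans (_ : beta * (4 * Delta%:R `^ (5 * s)) <= _); first by rewrite ler_pM2l.
  by rewrite -ler_pdivlMr // (lt_le_trans B0).
rewrite -cG in betaB n0 cT deg.
have nB := bijumbled_order_ge p0 b0 bG betaB n0.
pose M := (n %/ (4 * B))%N.
have B0' : (0 < 4 * B)%N by rewrite -(ltr_nat R).
apply: (expander_universal (w := w) (M := M) (@adj_sym G) (@adj_sym T) (@adj_irrefl T) conn acy cT degx D1 w256).
- by rewrite cG; apply: (nat_lt_exp_sqrt_ln _ s_lt); rewrite -cG.
- by rewrite divn_gt0 // -cG.
- by rewrite -BE cG leq_trunc_div.
- by apply: (bijumbled_joined (B := B) (A := A) p0 b0 bG betaB) => //; rewrite cG ltn_ceil.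
move=> Y /andP[Y0 YM]; apply: (bijumbled_expand p0 b0 bG betaB A2) => //.
by rewrite cG; apply: leq_trans (leq_trunc_div n (4 * B)); rewrite leq_mul2r YM orbT.
Qed.
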